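(* Let $d>2$ and suppose that the probability density $\rho$ on $[0,\infty)$ satisfies the following conditions: (1) there exists a positive constant $\zeta>d/2$ such that, as $z\to 0$, $\int_0^z\rho(x)\,dx = z^d+O(z^{d+\zeta})$; (2) the $r$-th moment of $\rho$ is finite for some $r>4d/(d-2)$. Let $C_{n,n}^\rho$ be the total cost of the stable matching in $K_{n,n}^\rho$. Then there exists a constant $0<\gamma(d)<\infty$, depending only on $d$, such that as $n\to\infty$, $$\frac{\mathrm{Var}(C_{n,n}^\rho)}{n^{1-2/d}}\to\gamma(d)$$ and $$\frac{C_{n,n}^\rho-\mathbb{E}(C_{n,n}^\rho)}{\sqrt{\mathrm{Var}(C_{n,n}^\rho)}}\longrightarrow\mathcal{N}(0,1)\quad\text{in distribution}.$$
   Context: $K_{n,n}^\rho$ is the complete bipartite graph with vertex sets $V_n,V_n'$, each of size $n$, whose edges $e=(v,v')$, $v\in V_n$, $v'\in V_n'$, carry i.i.d. non-negative costs $\omega(e)$ with density $\rho$. A matching is a set of pairwise non-adjacent edges. The matching cost of a vertex is the cost of the edge of the matching incident to it (and $\infty$ if it is unmatched). A matching is stable if for every pair $v\in V_n$, $v'\in V_n'$, either $v$ and $v'$ are matched to each other or at least one of them has matching cost smaller than $\omega(v,v')$. Almost surely there is a unique stable matching; it is perfect and is obtained by the greedy algorithm which repeatedly adds the cheapest edge among those with both endpoints still unmatched. Its total cost $C_{n,n}^\rho$ is the sum of the costs of its $n$ edges. The $r$-th moment of $\rho$ is $\int_0^\infty x^r\rho(x)\,dx$. *)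

(* Defs.v *)
From HB Require Import structures.
From mathcomp Require Import all_boot all_order all_algebra.
From mathcomp Require Import all_classical all_reals all_analysis.
From mathcomp Require Import measurable_realfun.

Set Implicit Arguments.
Unset Strict Implicit.
Unset Printing Implicit Defensive.

Import Order.TTheory GRing.Theory Num.Theory.
Import numFieldNormedType.Exports.

Local Open Scope classical_set_scope.
Local Open Scope ring_scope.

Section stable_matching.
Context {R : realType} {n : nat}.

(* The two sides of the complete bipartite graph are the left and right copies
   of 'I_n; the edge (i, j) joins inl i and inr j. *)
Definition vertex : finType := ('I_n + 'I_n)%type.
Definition edge : finType := ('I_n * 'I_n)%type.

Definition incident (v : vertex) (e : edge) : bool :=
  match v with inl i => e.1 == i | inr j => e.2 == j end.

Definition is_matching (M : {set edge}) : bool :=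
  [forall e1 in M, forall e2 in M,
    (e1 != e2) ==> ~~ [exists v : vertex, incident v e1 && incident v e2]].

Implicit Types (w : edge -> R) (M : {set edge}).

Definition matching_cost w M (v : vertex) : \bar R :=
  if [pick e in M | incident v e] is Some e then (w e)%:E else +oo%E.

Definition is_stable w M : bool :=
  is_matching M &&
  [forall i : 'I_n, forall j : 'I_n,
    [|| (i, j) \in M,
        (matching_cost w M (inl i) < (w (i, j))%:E)%E |
        (matching_cost w M (inr j) < (w (i, j))%:E)%E]].

Definition is_unique_stable w M : bool :=
  is_stable w M && [forall M' : {set edge}, is_stable w M' ==> (M' == M)].

(* 0 is a dummy value, on the null event where there is no unique stable
   matching; it keeps the cost a measurable function of w. *)
Definition stable_cost w : R :=
  if [pick M | is_unique_stable w M] is Some M then \sum_(e in M) w e else 0.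

End stable_matching.

Arguments vertex : clear implicits.
Arguments edge : clear implicits.

Section stable_cost_rv.
Context {R : realType} {d} {T : measurableType d} {P : probability T R}.
Context {n : nat}.
Variable w : edge n -> {RV P >-> R}.

Definition random_stable_cost (t : T) : R := stable_cost (w ^~ t).

Let measurable_forall (I : finType) (p : T -> pred I) :
  (forall i, measurable_fun setT (p ^~ i)) ->
  measurable_fun setT (fun t => [forall i, p t i]).
Proof.
move=> mp; apply: (measurable_fun_bool true); rewrite setTI.
rewrite (_ : _ @^-1` _ = \bigcap_(i in [set: I]) ((p ^~ i) @^-1` [set true])).
  apply: fin_bigcap_measurable => [|i _]; first exact: finite_finset.
  by rewrite -[X in measurable X]setTI; exact: mp.
apply/seteqP; split => t /=; first by move=> /forallP pt i _; exact: pt.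
by move=> pt; apply/forallP => i; exact: pt.
Qed.

Let measurable_matching_cost (M : {set edge n}) (v : vertex n) :
  measurable_fun setT
    (fun t => matching_cost (w ^~ t) M v).
Proof.
rewrite /matching_cost; case: pickP => [e _|_]; last exact: measurable_cst.
exact/measurable_EFinP.
Qed.

Let measurable_is_stable (M : {set edge n}) :
  measurable_fun setT (fun t => is_stable (w ^~ t) M).
Proof.
apply: measurable_and; first exact: measurable_cst.
apply: measurable_forall => i; apply: measurable_forall => j.
apply: measurable_or; first exact: measurable_cst.
by apply: measurable_or; apply: measurable_fun_lte => //;
  exact/measurable_EFinP.
Qed.

Let measurable_is_unique_stable (M : {set edge n}) :
  measurable_fun setT (fun t => is_unique_stable (w ^~ t) M).
Proof.
apply: measurable_and => //; apply: measurable_forall => M' /=.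
under eq_fun do rewrite implybE.
apply: measurable_or; last exact: measurable_cst.
exact: measurable_neg.
Qed.

Let measurable_random_stable_cost : measurable_fun setT random_stable_cost.
Proof.
rewrite (_ : random_stable_cost = fun t => \sum_(M : {set edge n})
    if is_unique_stable (w ^~ t) M then \sum_(e <- enum M) w e t else 0).
  apply: measurable_sum => M; apply: measurable_fun_ifT => //.
  by apply: measurable_sum => e.
apply/funext => t; rewrite /random_stable_cost /stable_cost.
case: pickP => [M uM|noM]; last by rewrite big1// => M _; rewrite noM.
rewrite (bigD1 M)//= uM big_enum/= [X in _ + X]big1 ?addr0// => M' M'M.
case: ifPn => // /andP[sM' _]; case/andP: uM => _ /forallP/(_ M').
by rewrite sM' (negbTE M'M).
Qed.

HB.instance Definition _ := isMeasurableFun.Build _ _ _ _ random_stable_cost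
  measurable_random_stable_cost.

End stable_cost_rv.

Section probability_notions.
Context {R : realType}.

Definition is_density (rho : R -> R) : Prop :=
  [/\ measurable_fun (`[0, +oo[ : set R) rho,
      (forall x, 0 <= x -> 0 <= rho x) &
      (\int[lebesgue_measure]_(x in `[0%R, +oo[) (rho x)%:E = 1)%E].

Definition has_density d (T : measurableType d) (P : probability T R)
    (rho : R -> R) (X : {RV P >-> R}) : Prop :=
  forall A : set R, measurable A ->
    (distribution P X A =
     \int[lebesgue_measure]_(x in A `&` `[0%R, +oo[) (rho x)%:E)%E.

Definition mutually_independent d (T : measurableType d) (P : probability T R)
    (I : finType) (X : I -> {RV P >-> R}) : Prop :=
  forall (J : {set I}) (A : I -> set R), (forall i, measurable (A i)) ->
    (P (\bigcap_(i in [set` J]) (X i @^-1` A i)) =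
     \prod_(i in J) P (X i @^-1` A i))%E.

Section standardize.
Context {d} {T : measurableType d} {P : probability T R}.
Variable X : {RV P >-> R}.

Definition standardize (t : T) : R :=
  (X t - fine 'E_P[X]%E) / Num.sqrt (fine 'V_P[X]%E).

Let measurable_standardize : measurable_fun setT standardize.
Proof. by apply: measurable_funM => //; exact: measurable_funB. Qed.

HB.instance Definition _ := isMeasurableFun.Build _ _ _ _ standardize
  measurable_standardize.

End standardize.

(* The X n may live on different probability spaces. *)
Definition cvg_in_distribution (disp : nat -> measure_display)
    (T : forall n, measurableType (disp n)) (P : forall n, probability (T n) R)
    (X : forall n, {RV (P n) >-> R}) (mu : probability (measurableTypeR R) R) : Prop :=
  forall f : R -> R, continuous f -> bounded_fun f ->
    (\int[distribution (P n) (X n)]_x (f x)%:E)%E @[n --> \oo] -->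
    (\int[mu]_x (f x)%:E)%E.

End probability_notions.

Arguments standardize {R d T} P X.
Arguments cvg_in_distribution {R disp T} P X mu.
Arguments has_density {R d T} P rho X.
Arguments mutually_independent {R d T} P {I} X.
Arguments random_stable_cost {R d T} P {n} w.

(* Main.v *)
Require Import Defs.
From HB Require Import structures.
From mathcomp Require Import all_boot all_order all_algebra.
From mathcomp Require Import all_classical all_reals all_analysis.
From mathcomp Require Import measurable_realfun.
From mathcomp Require Import ring lra zify.

Set Implicit Arguments.
Unset Strict Implicit.
Unset Printing Implicit Defensive.

Import Order.TTheory GRing.Theory Num.Theory.
Import numFieldNormedType.Exports.

Local Open Scope classical_set_scope.
Local Open Scope ring_scope.

(** Let [mu] be the law of an edge and let [G] be the function that turns an
exponential variable into a variable of law [mu]: [mu] gives the mass [exp (- u)]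
to the costs above [G u]. The greedy algorithm, run on the costs of the edges,
produces the unique stable matching as soon as the costs are pairwise distinct
([greedy_stable_cost]), which happens almost surely. When [k] vertices remain on
each side and the last chosen cost is [x], the [k ^ 2] edges between them are
independent and only known to cost more than [x], because the choices made so far
compared them with nothing else ([integral_greedy]). Read in the scale of [G], the
cheapest of them is the minimum of [k ^ 2] exponential variables after the current
time, so by lack of memory the time increases by an exponential variable divided by
[k ^ 2] ([chain_cost]). Therefore the total cost has the law of
[sum_(m <= n) G (S_m)] with [S_m = sum_(m <= j <= n) e_j / j ^ 2], the [e_j] being
independent exponential variables ([stable_cost_law], [costE]).

Put [p = 1 / d] and [s_m = E S_m], which is close to [1 / m - 1 / n]. The assumption
on the distribution function near 0 gives [G u = u ^ p + O(u ^ a)] for some [a]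
between [1 / 2 + p] and 1; this is where [zeta > d / 2] is used ([quantile_near0]).
The moment assumption gives a fourth moment of [G], since [4 d / (d - 2) > 4]
([quantile_moment]). Replace [G (S_m)] by its linear approximation
[s_m ^ p + p s_m ^ (p - 1) (S_m - s_m)]. The error has L2 norm
[O(m ^ (- a) + (n + 1 - m) ^ (- a))]: the fluctuation of [S_m] is small compared with
[s_m] except for the last choices, where [m] is small, and the first ones, where [m]
is close to [n] and [S_m] has few terms ([taylor_error_integral]). Summing over [m],
the cost differs from an affine function of the [e_j] by [O(n ^ (1 - a))], which is
[o(n ^ (1 / 2 - p))] ([cost_approximation]).

The linear part is [sum_j b_j (e_j - 1)] with
[b_j = j ^ (- 2) sum_(m <= j) p s_m ^ (p - 1)], which is of the order of [j ^ (- p)].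
Thus its variance [sum_j b_j ^ 2] is of order [n ^ (1 - 2 p)]; after division by this
power it is a Riemann sum, which converges by dominated convergence to a number
depending only on [p] ([sigma2_cvg]). No coefficient dominates the standard
deviation, so the linear part is asymptotically normal. This case of the central limit
theorem is proved by adding the variables one by one to a Gaussian density and
comparing each addition with the heat flow up to a third order error ([bell_step],
[bell_clin]); small Gaussian smoothing of a Lipschitz test function and then monotone
approximation of a bounded continuous one give convergence in law
([gauss_lower], [gaussian_limit]). Finally, an error that is small in L2 compared with
the standard deviation changes neither the equivalent of the variance nor the limit
law ([perturbation_variance_ge], [perturbation_upper], [perturbation_standardized]). *)

(** * Integrals against a density and the exponential law *)

Section density.
Context {R : realType} d (T : measurableType d).
Local Open Scope ereal_scope.
Variables (m mu : {measure set T -> \bar R}) (D : set T) (f : T -> R).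
Hypothesis mD : measurable D.
Hypothesis mf : measurable_fun D f.
Hypothesis f0 : forall x, D x -> (0 <= f x)%R.
Hypothesis mE : forall A, measurable A -> m A = \int[mu]_(x in A `&` D) (f x)%:E.

Import HBNNSimple.

Let f0E x : D x -> 0 <= (f x)%:E.
Proof. by move=> Dx; rewrite lee_fin f0. Qed.

Let density_indic E : measurable E ->
  \int[m]_x (\1_E x)%:E = \int[mu]_(x in D) ((\1_E x)%:E * (f x)%:E).
Proof.
move=> mE0; rewrite integral_indic// setIT mE//.
rewrite setIC integral_mkcondr; apply: eq_integral => x xD.
rewrite /patch; case: ifPn => xE; first by rewrite indicE xE mul1e.
by rewrite indicE (negbTE xE) mul0e.
Qed.

Let density_nnsfun (h : {nnsfun T >-> R}) :
  \int[m]_x (h x)%:E = \int[mu]_(x in D) ((h x)%:E * (f x)%:E).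
Proof.
under [LHS]eq_integral do rewrite fimfunE -fsumEFin//.
rewrite [LHS]ge0_integral_fsum//; last 2 first.
  - by move=> r; exact/measurable_EFinP/measurableT_comp.
  - by move=> n x _; rewrite EFinM nnfun_muleindic_ge0.
under [RHS]eq_integral.
  move=> x xD; rewrite fimfunE -fsumEFin// ge0_mule_fsuml; last first.
    by move=> r; rewrite EFinM nnfun_muleindic_ge0.
  over.
rewrite [RHS]ge0_integral_fsum//; last 2 first.
  - move=> r; apply: emeasurable_funM; last exact/measurable_EFinP.
    by apply: measurable_funTS; exact/measurable_EFinP/measurableT_comp.
  - by move=> n x xD; rewrite mule_ge0 ?f0E// EFinM nnfun_muleindic_ge0.
apply: eq_fsbigr => r rh.
rewrite integralZl_indic_nnsfun//= density_indic//.
have [r0|r0] := leP 0%R r.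
  rewrite -ge0_integralZl_EFin//.
  - by apply: eq_integral => x _; rewrite EFinM muleA.
  - by move=> x Dx; rewrite mule_ge0 ?f0E// lee_fin.
  - apply: emeasurable_funM; last exact/measurable_EFinP.
    by apply: measurable_funTS; exact/measurable_EFinP.
have -> : (h @^-1` [set r]) = set0.
  by apply/seteqP; split => // x /= hx; move: r0; rewrite -hx ltNge fun_ge0.
under eq_integral do rewrite indic0 mul0e.
under [RHS]eq_integral do rewrite indic0 mulr0 mul0e.
by rewrite !integral0 mule0.
Qed.

(** Both sides are additive and continuous along increasing sequences, so it is
enough to compare them on simple functions, hence on indicators, where this is
the hypothesis. *)
Lemma ge0_integral_density (g : T -> \bar R) :
  measurable_fun setT g -> (forall x, 0 <= g x) ->
  \int[m]_x g x = \int[mu]_(x in D) (g x * (f x)%:E).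
Proof.
move=> mg g0; pose h := nnsfun_approx measurableT mg.
transitivity (limn (fun n => \int[m]_x (h n x)%:E)).
  rewrite -monotone_convergence//=.
  - apply: eq_integral => x _; apply/esym/cvg_lim => //=.
    exact: cvg_nnsfun_approx.
  - by move=> n; exact/measurable_EFinP.
  - by move=> n x _; rewrite lee_fin.
  - by move=> x _ a b ab; rewrite lee_fin//; exact/lefP/nd_nnsfun_approx.
rewrite (_ : \int[mu]_(x in D) _ =
    limn (fun n => \int[mu]_(x in D) ((h n x)%:E * (f x)%:E))); last first.
  rewrite -monotone_convergence//=.
  - apply: eq_integral => x /[!inE] xD; apply/esym/cvg_lim => //.
    apply: cvgeZr => //; exact: cvg_nnsfun_approx.
  - move=> n; apply: emeasurable_funM; last exact/measurable_EFinP.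
    by apply: measurable_funTS; exact/measurable_EFinP.
  - by move=> n x xD; rewrite mule_ge0 ?f0E// lee_fin.
  - move=> x xD a b ab; apply: lee_wpmul2r; first exact: f0E.
    by rewrite lee_fin//; exact/lefP/nd_nnsfun_approx.
by congr (limn _); apply/funext => n; exact: density_nnsfun.
Qed.

End density.

(** The rays are stable under intersection and generate the Borel sets. *)
Lemma eq_measure_rays {R : realType}
    (m1 m2 : {measure set (measurableTypeR R) -> \bar R}) :
  (forall x : R, m1 `]x, +oo[%classic = m2 `]x, +oo[%classic) ->
  (forall x : R, m1 `]x, +oo[%classic < +oo)%E ->
  forall A, measurable A -> m1 A = m2 A.
Proof.
move=> m12 m1fin A mA.
pose g (k : nat) : set R := `](- k%:R), +oo[%classic.
apply: (@measure_unique _ R (measurableTypeR R) (@RGenOInfty.G R) g) => //.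
- exact: RGenOInfty.measurableE.
- move=> _ _ [x ->] [y ->]; exists (Num.max x y); apply/seteqP; split => z /=;
  by rewrite !in_itv/= !andbT gt_max => /andP.
- by move=> k; exists (- k%:R).
- apply/seteqP; split => // x _; exists (Num.truncn `|x|).+1 => //=.
  rewrite /g/= in_itv/= andbT ltrNl (le_lt_trans (ler_norm _))// normrN.
  exact: truncnS_gt.
- by move=> _ [x ->]; exact: m12.
- by move=> k; exact: m1fin.
Qed.

Section affine.
Context {R : realType}.
Local Notation mu := (@lebesgue_measure R).
Variables (a b : R).
Hypothesis a0 : 0 < a.

Let aff (x : R) : measurableTypeR R := a * x + b.

Let maff : measurable_fun setT aff.
Proof. by apply: measurable_funD => //; exact: measurable_funM. Qed.

Let image : {measure set (measurableTypeR R) -> \bar R} :=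
  measure_function_pushforward__canonical__measure_function_Measure mu maff.

Let lebesgue_measure_affine (A : set R) : measurable A ->
  mu A = (mscale (NngNum (ltW a0)) image) A.
Proof.
apply: lebesgue_measure_unique => _ [[u v]] /= _ <-.
rewrite /mscale/= /image/= /pushforward.
have -> : aff @^-1` `]u, v]%classic = `](u - b) / a, (v - b) / a]%classic.
  apply/seteqP; split => x /=; rewrite !in_itv/= ltr_pdivrMr// ler_pdivlMr// /aff;
  by rewrite ltrBlDr lerBrDr (mulrC x).
rewrite !lebesgue_measure_itv/= !lte_fin ltr_pM2r ?invr_gt0// ltrD2r.
case: ifPn => uv; last by rewrite mule0.
by rewrite -!EFinD -EFinM; congr EFin; field; rewrite gt_eqF.
Qed.

(** Lebesgue measure is the only measure giving each interval its length, and the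
image under an affine map, multiplied by the slope, does so. *)
Lemma ge0_integral_affine (f : R -> \bar R) :
  measurable_fun setT f -> (forall x, 0 <= f x)%E ->
  (\int[mu]_x f x = a%:E * \int[mu]_x f (a * x + b)%R)%E.
Proof.
move=> mf f0.
rewrite (eq_measure_integral (mscale (NngNum (ltW a0)) image)); last first.
  by move=> A mA _; exact: lebesgue_measure_affine.
by rewrite ge0_integral_mscale//= ge0_integral_pushforward.
Qed.

End affine.

(** The exponential law of rate 1. *)
Definition expo (R : realType) : probability (measurableTypeR R) R :=
  exponential_distribution_exponential_prob__canonical__probability_measure_Probability
    (@ltr01 R).

Section expo.
Context {R : realType}.
Local Notation Q := (expo R).
Local Notation mu := (@lebesgue_measure R).

Lemma expoE (g : R -> \bar R) : measurable_fun setT g -> (forall x, 0 <= g x)%E ->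
  (\int[Q]_x g x = \int[mu]_(x in (`[0%R, +oo[%classic : set R)) (g x * (expR (- x))%:E))%E.
Proof.
move=> mg g0; apply: ge0_integral_density => //.
- by apply: measurable_funTS; apply: measurableT_comp => //; exact: oppr_measurable.
move=> A mA; rewrite /expo/= /exponential_prob.
rewrite integral_mkcondr; apply: eq_integral => x xA.
rewrite /exponential_pdf /patch; case: ifPn => // _.
by rewrite mul1r mulN1r.
Qed.

(** The change of variable [u = v + e / K]. For [K = k ^ 2], the factor
[exp (- (K - 1) u)] is the probability that the [K - 1] other exponential clocks
ring after [u], and [exp (K v)] conditions all of them to ring after [v]. *)
Lemma expo_affine (v K : R) (phi : R -> \bar R) : 0 <= v -> 0 < K ->
  measurable_fun setT phi -> (forall x, 0 <= phi x)%E ->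
  (\int[Q]_e phi (v + e / K)%R =
   (K * expR (K * v))%:E *
   \int[Q]_(u in (`]v, +oo[%classic : set R)) (phi u * (expR (- ((K - 1) * u)))%:E))%E.
Proof.
move=> v0 K0 mphi phi0.
have mexp (c d : R) : measurable_fun setT (fun u : R => (expR (- (c * u + d)))%:E).
  apply/measurable_EFinP; apply: measurableT_comp => //; apply: measurableT_comp => //.
  by apply: measurable_funD => //; exact: measurable_funM.
have mray (x : R) : measurable (`]x, +oo[%classic : set R) by exact: measurable_itv.
rewrite expoE//; last first.
  by apply: measurableT_comp => //; apply: measurable_funD => //; exact: measurable_funM.
rewrite -integral_itv_obnd_cbnd; last first.
  apply: measurable_funTS; apply: emeasurable_funM.
    by apply: measurableT_comp => //; apply: measurable_funD => //; exact: measurable_funM.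
  by apply/measurable_EFinP; apply: measurableT_comp => //; exact: oppr_measurable.
pose f := (fun u => phi u * (expR (- (K * u + - (K * v))))%:E)%E \_ (`]v, +oo[%classic : set R).
have mf : measurable_fun setT f.
  by apply/(measurable_restrictT _ _).1 => //; apply: measurable_funTS; exact: emeasurable_funM.
have f0 x : (0 <= f x)%E.
  by rewrite /f patchE; case: ifPn => // _; rewrite mule_ge0// lee_fin expR_ge0.
have Kinv : 0 < K^-1 by rewrite invr_gt0.
transitivity (K%:E * \int[mu]_u f u)%E.
  rewrite (ge0_integral_affine v Kinv)// muleA -EFinM divff ?gt_eqF// mul1e.
  rewrite integral_mkcond; apply: eq_integral => x _.
  rewrite /f !patchE !mem_setE !in_itv/= !andbT ltrDr (pmulr_rgt0 x Kinv).
  case: ifPn => // _; rewrite addrC (mulrC x); congr (_ * (expR _)%:E)%E.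
  by field; rewrite gt_eqF.
rewrite EFinM -muleA; congr (_ * _)%E.
rewrite [in RHS]integral_mkcond expoE; last 2 first.
- apply/(measurable_restrictT _ _).1 => //; apply: measurable_funTS; apply: emeasurable_funM => //.
  by have := mexp (K - 1) 0; under eq_fun do rewrite addr0.
- by move=> x; rewrite patchE; case: ifPn => // _; rewrite mule_ge0// lee_fin expR_ge0.
rewrite -ge0_integralZl//; last 2 first.
- apply: measurable_funTS; apply: emeasurable_funM; last first.
    by have := mexp 1 0; under eq_fun do rewrite mul1r addr0.
  apply/(measurable_restrictT _ _).1 => //; apply: measurable_funTS; apply: emeasurable_funM => //.
  by have := mexp (K - 1) 0; under eq_fun do rewrite addr0.
- move=> x _; rewrite mule_ge0// ?lee_fin ?expR_ge0//.
  by rewrite patchE; case: ifPn => // _; rewrite mule_ge0// lee_fin expR_ge0.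
rewrite [RHS]integral_mkcond; apply: eq_integral => x _.
rewrite /f !patchE !mem_setE !in_itv/= !andbT.
case: ifPn => [vx|_]; last by rewrite mul0e mule0 if_same.
rewrite ifT ?(le_trans v0 (ltW vx))//.
rewrite (_ : expR (- (K * x - K * v)) =
    expR (K * v) * expR (- ((K - 1) * x)) * expR (- x)); last first.
  by rewrite -!expRD; congr expR; ring.
by rewrite !EFinM !muleA (muleC (phi x)).
Qed.

Lemma expo_ray (x : R) : 0 <= x -> Q `]x, +oo[%classic = (expR (- x))%:E.
Proof.
move=> x0; have := @expo_affine x 1 (cst 1%E) x0 ltr01 (measurable_cst _) (fun=> lee01).
have mray : measurable (`]x, +oo[%classic : set R) by exact: measurable_itv.
rewrite (_ : (\int[Q]_e _)%E = 1%E); last first.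
  rewrite [LHS]integral_cst// mul1e. exact: probability_setT.
under eq_integral do rewrite subrr mul0r oppr0 expR0 mule1.
rewrite integral_cst// mul1e mul1r => h.
rewrite -[LHS]mul1e -[X in (X * _)%E](_ : (expR (- x) * expR (1 * x))%:E = 1%E); last first.
  by rewrite -expRD mul1r addNr expR0.
by rewrite EFinM -muleA -h mule1.
Qed.

Lemma expo_ge0 : {ae Q, forall x : R, 0 <= x}.
Proof.
exists (~` (`]0, +oo[%classic : set R)); split.
- by apply: measurableC; exact: measurable_itv.
- rewrite probability_setC; last exact: measurable_itv.
  by rewrite expo_ray// oppr0 expR0 subee.
- by apply: subsetC => x /=; rewrite in_itv/= andbT => /ltW.
Qed.

(* the primitive of [x ^ k exp (- x)] obtained by iterated integration by parts *)
Let prim := fix prim (k : nat) (x : R) : R :=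
  if k is k'.+1 then - (x ^+ k * expR (- x)) + k%:R * prim k' x else - expR (- x).

Let prim_is_derive k (x : R) : is_derive x (1:R) (prim k) (x ^+ k * expR (- x)).
Proof.
elim: k => [|k IH] /=.
  apply: is_derive_eq; lra.
pose g (y : R) := y ^+ k.+1 * expR (- y).
have dg : is_derive x (1:R) g (k.+1%:R * (x ^+ k * expR (- x)) - x ^+ k.+1 * expR (- x)).
  have dX : is_derive x (1:R) (fun y : R => y ^+ k.+1) (k.+1%:R * x ^+ k).
    have h := @is_deriveX R R id k.+1 x 1 1 (is_derive_id x 1).
    move: h; rewrite fctE => h.
    by apply: (is_derive_eq h); rewrite /GRing.scale/= mulr1.
  have dE : is_derive x (1:R) (fun y : R => expR (- y)) (- expR (- x)).
    by apply: is_derive_eq; rewrite mulrN1.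
  apply: (is_derive_eq (is_deriveM dX dE)); rewrite /GRing.scale/=; ring.
apply: (is_derive_eq (is_deriveD (is_deriveN dg) (is_deriveZ k.+1%:R IH))).
rewrite /GRing.scale/=; ring.
Qed.

Let prim_lim k : prim k x @[x --> +oo] --> (0 : R).
Proof.
elim: k => [|k IH] /=.
  by rewrite -oppr0; apply: cvgN; exact: cvgr_expR.
rewrite -[X in _ --> X]addr0 -{1}oppr0 -[X in _ + X](mulr0 k.+1%:R).
apply: cvgD; last by apply: cvgMr.
apply: cvgN.
apply: (@squeeze_cvgr _ _ _ _ (fun=> 0) (fun x : R => (k.+2)`!%:R / x)).
- near=> x.
  have x0 : 0 < x by near: x; exact: nbhs_pinfty_gt.
  apply/andP; split; first by rewrite mulr_ge0 ?expR_ge0// exprn_ge0// ltW.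
  rewrite expRN ler_pdivlMr// mulrAC -exprSr ler_pdivrMr ?expR_gt0//.
  have := expR_ge1Dxn k.+1 (ltW x0).
  have f0 : 0 < (k.+2)`!%:R :> R by rewrite ltr0n fact_gt0.
  rewrite -(ler_pM2l f0) mulrDr mulrCA divff ?gt_eqF// !mulr1; apply: le_trans.
  by rewrite lerDr ltW.
- exact: cvg_cst.
- rewrite -[X in _ --> X](mulr0 (k.+2)`!%:R); apply: cvgMr.
  apply/gtr0_cvgV0 => //; exact: nbhs_pinfty_gt.
Unshelve. all: by end_near. Qed.

Let prim0 k : prim k 0 = - k`!%:R.
Proof.
elim: k => [|k IH] /=; first by rewrite oppr0 expR0.
by rewrite exprS !mul0r oppr0 add0r IH factS natrM mulrN.
Qed.

Lemma expo_abs_moment k : (\int[Q]_x (`|x| ^+ k)%:E = (k`!%:R)%:E)%E.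
Proof.
rewrite expoE; last 2 first.
- by apply/measurable_EFinP; apply: measurable_funX; exact: normr_measurable.
- by move=> x; rewrite lee_fin exprn_ge0.
transitivity (\int[mu]_(x in (`[0%R, +oo[%classic : set R)) (x ^+ k * expR (- x))%:E)%E.
  by apply: eq_integral => x; rewrite inE/= in_itv/= andbT => x0; rewrite ger0_norm.
rewrite (@ge0_continuous_FTC2y _ _ (prim k) 0 0).
- by rewrite prim0 sub0e -EFinN opprK.
- by move=> x x0; rewrite mulr_ge0 ?expR_ge0// exprn_ge0.
- apply: continuous_subspaceT => x; apply: cvgM; first exact: exprn_continuous.
  by apply: continuous_comp; [exact: opp_continuous|exact: continuous_expR].
- exact: prim_lim.
- by move=> x _; have [] := prim_is_derive k x.
- apply/cvg_at_right_filter; apply: differentiable_continuous; apply/derivable1_diffP.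
  by have [] := prim_is_derive k 0.
- by move=> x _; rewrite derive1E; have [] := prim_is_derive k x.
Qed.

Lemma expo_integrable_X k : Q.-integrable setT (fun x => (x ^+ k)%:E).
Proof.
apply/integrableP; split.
  by apply/measurable_EFinP; exact: exprn_measurable.
under eq_integral do rewrite abse_EFin normrX.
by rewrite expo_abs_moment ltry.
Qed.

Lemma expo_moment k : (\int[Q]_x (x ^+ k)%:E = (k`!%:R)%:E)%E.
Proof.
rewrite -expo_abs_moment; apply: ae_eq_integral => //.
- by apply/measurable_EFinP; exact: exprn_measurable.
- by apply/measurable_EFinP; apply: measurable_funX; exact: normr_measurable.
- have [N [mN N0 NS]] := expo_ge0; exists N; split => //.
  by apply: subset_trans NS => x /= h x0; apply: h => _; rewrite ger0_norm.
Qed.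

(** Expectations of polynomials in an exponential variable are thus computed by a
list of coefficients, which reduces every moment computation below to [ring]. *)
Lemma expo_poly n (c : nat -> R) :
  Q.-integrable setT (fun x => (\sum_(i < n) c i * x ^+ i)%:E) /\
  (\int[Q]_x (\sum_(i < n) c i * x ^+ i)%:E = (\sum_(i < n) c i * i`!%:R)%:E)%E.
Proof.
have ci i : Q.-integrable setT (fun x : R => (c i * x ^+ i)%:E).
  under eq_fun do rewrite EFinM; apply: integrableZl => //; exact: expo_integrable_X.
have sE (x : R) : (\sum_(i < n) c i * x ^+ i)%:E = (\sum_(i < n) (c i * x ^+ i)%:E)%E.
  by rewrite sumEFin.
split.
  by under eq_fun do rewrite sE; exact: integrable_sum.
under eq_integral do rewrite sE.
rewrite integral_sum// -sumEFin; apply: eq_bigr => i _.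
under eq_integral do rewrite EFinM.
by rewrite integralZl//; [rewrite expo_moment EFinM|exact: expo_integrable_X].
Qed.

End expo.

(** * The stable matching is greedy *)

Section greedy.
Context {R : realType} {n : nat}.
Local Notation box := finset.setX.
Implicit Types (w : edge n -> R) (A B : {set 'I_n}) (M : {set edge n}) (e f : edge n).

Definition strict_min A B e w : bool :=
  [forall f : edge n, (f \in box A B) && (f != e) ==> (w e < w f)].

(** [h] of the cost of the greedy matching between [A] and [B], increased by [y].
The cheapest edge of the box is not selected by a choice function: the sum runs over
all edges and the test [strict_min] kills all the terms but one, so that measurability
in [w] is clear and the terms can be integrated separately. *)
Fixpoint greedy (h : R -> \bar R) k A B (y : R) w : \bar R :=
  if k is k'.+1 then
    (\sum_(e in box A B)
      if strict_min A B e w then greedy h k' (A :\ e.1) (B :\ e.2) (y + w e) w else 0)%E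
  else h y.

Definition meets e f := (e.1 == f.1) || (e.2 == f.2).

(** Stability expressed with edges only, so that it makes sense for the graph left by
the first steps of the greedy algorithm. *)
Definition stable_on A B w M : Prop :=
  [/\ M \subset box A B,
      {in M &, forall e f, meets e f -> e = f} &
      {in box A B, forall e, exists2 f, f \in M & meets e f && (w f <= w e)}].

(** The cheapest edge [e] of the box meets no cheaper edge, so every stable matching
contains it; no other edge of the matching then meets [e], and what remains is a
stable matching of the box deprived of the two endpoints of [e]. *)
Lemma greedy_stable_on k A B w : injective w -> #|A| = k -> #|B| = k ->
  exists M, [/\ stable_on A B w M, (forall M', stable_on A B w M' -> M' = M) &
    forall h y, greedy h k A B y w = h (y + \sum_(e in M) w e)].
Proof.
move=> winj; elim: k A B => [|k IH] A B cA cB.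
  have AB0 : box A B = finset.set0.
    by apply/setP => e; rewrite !inE (cards0_eq cA) inE.
  exists finset.set0; split.
  - by split; [rewrite finset.sub0set|move=> e f; rewrite inE|move=> e; rewrite AB0 inE].
  - by move=> M' [+ _ _]; rewrite AB0 finset.subset0 => /eqP.
  - by move=> h y /=; rewrite big_set0 addr0.
have [a aA] : exists a, a \in A by apply/finset.set0Pn; rewrite -card_gt0 cA.
have [b bB] : exists b, b \in B by apply/finset.set0Pn; rewrite -card_gt0 cB.
pose e0 : edge n := (a, b).
have e0AB : e0 \in box A B by rewrite inE aA.
(* the first edge chosen by the greedy algorithm *)
case: (@arg_minP _ _ _ e0 (fun e => e \in box A B) w e0AB) => e eAB emin.
have es : strict_min A B e w.
  apply/forallP => f; apply/implyP => /andP[fAB fe].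
  by rewrite lt_neqAle emin// andbT (inj_eq winj) eq_sym.
have [eA eB] : e.1 \in A /\ e.2 \in B by move: eAB; rewrite inE => /andP.
have cA' : #|A :\ e.1| = k by move: cA; rewrite (cardsD1 e.1) eA => -[].
have cB' : #|B :\ e.2| = k by move: cB; rewrite (cardsD1 e.2) eB => -[].
have {IH}[M [[sM mM stM] uM gM]] := IH _ _ cA' cB'.
have inM f : f \in M -> [/\ f.1 != e.1, f.2 != e.2, f.1 \in A & f.2 \in B].
  by move=> /(fintype.subsetP sM); rewrite !inE => /andP[/andP[-> ->] /andP[-> ->]].
have eM : e \notin M by apply/negP => /inM[]; rewrite eqxx.
exists (e |: M); split.
- split.
  + apply/fintype.subsetP => f; rewrite finset.in_setU1 => /predU1P[->//|/inM[_ _ fA fB]].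
    by rewrite inE fA.
  + move=> f g; rewrite !finset.in_setU1 /meets => /predU1P[->|fM] /predU1P[->|gM']//.
    * by have [/negbTE h1 /negbTE h2 _ _] := inM _ gM'; rewrite !(eq_sym e.1) !(eq_sym e.2) h1 h2.
    * by have [/negbTE h1 /negbTE h2 _ _] := inM _ fM; rewrite h1 h2.
    * exact: mM.
  + move=> f fAB; have [me|] := boolP (meets f e).
      by exists e; [rewrite finset.in_setU1 eqxx|rewrite me emin].
    rewrite /meets negb_or => /andP[f1 f2].
    have /stM[g gM' fg] : f \in box (A :\ e.1) (B :\ e.2).
      by move: fAB; rewrite !inE f1 f2.
    by exists g => //; rewrite finset.in_setU1 gM' orbT.
- move=> M' [sM' mM' stM'].
  have eM' : e \in M'.
    have [f fM' /andP[ef wfe]] := stM' _ eAB.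
    have -> // : e = f.
    apply/winj/le_anti; rewrite wfe andbT; apply: emin; exact: (fintype.subsetP sM').
  rewrite -(finset.setD1K eM'); congr (_ |: _); apply: uM; split.
  + apply/fintype.subsetP => f; rewrite finset.in_setD1 => /andP[fe fM'].
    have := fintype.subsetP sM' _ fM'; rewrite !inE => /andP[-> ->]; rewrite !andbT.
    by apply/andP; split; apply: contra_neq fe => h; apply: mM' => //; rewrite /meets h eqxx ?orbT.
  + by move=> f g; rewrite !finset.in_setD1 => /andP[_ ?] /andP[_ ?]; exact: mM'.
  + move=> f; rewrite !inE => /andP[/andP[f1 fA] /andP[f2 fB]].
    have /stM'[g gM' fg] : f \in box A B by rewrite inE fA.
    exists g => //; rewrite finset.in_setD1 gM' andbT; apply: contraTneq fg => ->.
    by rewrite /meets (negbTE f1) (negbTE f2).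
- move=> h y /=; rewrite (bigD1 e)//= es big1 ?adde0; last first.
    move=> f /andP[fAB fe]; case: ifPn => // /forallP/(_ e).
    by rewrite eAB eq_sym fe/= ltNge emin.
  by rewrite gM big_setU1//= addrA.
Qed.

(** Injectivity turns the weak inequality between costs into a strict one. *)
Lemma stable_onE w M : injective w ->
  is_stable w M <-> stable_on [set: 'I_n]%SET [set: 'I_n]%SET w M.
Proof.
move=> winj; have mE : is_matching M <-> {in M &, forall e f, meets e f -> e = f}.
  split.
    move=> + e f eM fM ef; move=> /forallP/(_ e); rewrite eM/= => /forallP/(_ f).
    rewrite fM/= => h; apply/eqP; apply: contraTT h => ne; rewrite ne/= negbK.
    apply/existsP; case/orP: ef => /eqP ef; [exists (inl e.1)|exists (inr e.2)];
    by rewrite /= ef !eqxx.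
  move=> h; apply/forallP => e; apply/implyP => eM; apply/forallP => f.
  apply/implyP => fM; apply/implyP => ef; apply/negP => /existsP[[i|i]] /= /andP[/eqP a /eqP b].
    by move/negP: ef; apply; apply/eqP/h => //; rewrite /meets a b eqxx.
  by move/negP: ef; apply; apply/eqP/h => //; rewrite /meets a b eqxx orbT.
split.
  move=> /andP[/mE mM stM]; split => //.
    by apply/fintype.subsetP => e _; rewrite !inE.
  move=> [i j] _; move/forallP: stM => /(_ i) /forallP/(_ j) /or3P[ijM|hi|hj].
  - by exists (i, j) => //; rewrite /meets eqxx/=.
  - move: hi; rewrite /matching_cost; case: pickP => [f /andP[fM fi]|_].
      by rewrite lte_fin => hf; exists f => //; rewrite /meets/= (eqP fi) eqxx/= ltW.
    by rewrite ltNge leey.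
  - move: hj; rewrite /matching_cost; case: pickP => [f /andP[fM fj]|_].
      by rewrite lte_fin => hf; exists f => //; rewrite /meets/= (eqP fj) eqxx orbT/= ltW.
    by rewrite ltNge leey.
move=> [_ mM stM]; apply/andP; split; first exact/mE.
apply/forallP => i; apply/forallP => j.
have [//|ijM] := boolP ((i, j) \in M).
have [f fM /andP[mf wf]] : exists2 f, f \in M & meets (i, j) f && (w f <= w (i, j)).
  by apply: stM; rewrite !inE.
have {}wf : w f < w (i, j).
  rewrite lt_neqAle wf andbT (inj_eq winj); apply: contraNneq ijM => <-//.
rewrite /=; apply/orP; move: mf; rewrite /meets/= => /orP[fi|fj]; [left|right];
rewrite /matching_cost; case: pickP.
- move=> g /andP[gM /eqP gi]; rewrite (mM g f)// /meets.
  by rewrite gi fi.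
- by move=> /(_ f); rewrite fM/= eq_sym fi.
- move=> g /andP[gM /eqP gi]; rewrite (mM g f)// /meets.
  by rewrite gi fj orbT.
- by move=> /(_ f); rewrite fM/= (eq_sym f.2) fj.
Qed.

Lemma greedy_stable_cost w h : injective w ->
  greedy h n [set: 'I_n]%SET [set: 'I_n]%SET 0 w = h (stable_cost w).
Proof.
move=> winj.
have cT : #|[set: 'I_n]%SET| = n by rewrite finset.cardsT card_ord.
have [M [stM uM ->]] := greedy_stable_on winj cT cT.
rewrite add0r /stable_cost; case: pickP => [M' /andP[sM' _]|/(_ M)].
  by rewrite (uM M')//; exact/stable_onE.
rewrite /is_unique_stable (stable_onE M winj).2// => /negP[]; apply/forallP => M'.
by apply/implyP => /(stable_onE _ winj)/uM ->.
Qed.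

End greedy.

(** * The law of the greedy cost *)

Section freeze.
Context {R : realType} d (T : measurableType d) (P : probability T R)
  d0 (T0 : measurableType d0) (mu : probability T0 R) (G : set (set T)) (X : T -> T0).
Hypothesis GI : setI_closed G.
Hypothesis GT : G setT.
Hypothesis Gm : G `<=` measurable.
Hypothesis mX : measurable_fun setT X.
Hypothesis indep : forall A B, measurable A -> G B ->
  P (X @^-1` A `&` B) = (mu A * P B)%E.

Local Notation T' := (g_sigma_algebraType G).

Let sGm : <<s G >> `<=` @measurable _ T.
Proof. by apply: smallest_sub => //; exact: sigma_algebra_measurable. Qed.

Let mid : measurable_fun [set: T] (idfun : T -> T').
Proof. by move=> _ B mB; rewrite setTI; exact: sGm. Qed.

Let idm_mixin := isMeasurableFun.Build _ _ _ _ (idfun : T -> T') mid.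
Let idm : {mfun T >-> T'} := HB.pack (idfun : T -> T') idm_mixin.
Let P' : probability T' R := distribution P idm.

Let j (t : T) : T0 * T' := (X t, t).

Let mj : measurable_fun setT j.
Proof. exact/measurable_fun_pair. Qed.

Let Pj : {measure set (T0 * T') -> \bar R} :=
  measure_function_pushforward__canonical__measure_function_Measure P mj.

Let indep_sigma A (B : set T') : measurable A -> measurable B ->
  P (X @^-1` A `&` B) = (mu A * P B)%E.
Proof.
move=> mA mB.
have mXA : measurable (X @^-1` A) by rewrite -[X in measurable X]setTI; exact: mX.
have muA0 : 0 <= fine (mu A) by exact: fine_ge0.
pose m1 : {measure set T' -> \bar R} :=
  measure_function_pushforward__canonical__measure_function_Measure (mrestr P mXA) mid.
pose m2 : {measure set T' -> \bar R} := mscale (NngNum muA0) P'.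
have m2E C : m2 C = (mu A * P C)%E.
  by rewrite /m2/= /mscale/= /P'/= /distribution/= fineK// fin_num_measure.
rewrite -m2E setIC; apply: (@measure_unique _ R T' G (fun=> setT) _ _ _ _ m1 m2) => //.
- by rewrite bigcup_const//; exists 0%N.
- by move=> C GC; rewrite m2E /m1/= /pushforward/mrestr setIC indep.
- move=> _; rewrite (le_lt_trans (probability_le1 P _)) ?ltry//.
  by rewrite setTI.
Qed.

(** Fubini for a variable [X] independent of a sigma-algebra, given by a generating
pi-system [G]. The point [t] itself serves as a variable with values in [T] equipped
with that sigma-algebra: the pair [(X t, t)] then has a product law, whatever part of
[t] the function [Phi] depends on. *)
Lemma integral_freeze (Phi : T0 * T' -> \bar R) :
  measurable_fun setT Phi -> (forall z, 0 <= Phi z)%E ->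
  (\int[P]_t Phi (X t, t) = \int[mu]_s \int[P]_t Phi (s, t))%E.
Proof.
move=> mPhi Phi0.
transitivity (\int[Pj]_z Phi z)%E.
  by rewrite /Pj/= ge0_integral_pushforward.
rewrite (eq_measure_integral (mu \x P')%E); last first.
  move=> C mC _; apply/esym.
  apply: (@product_measure_unique _ _ _ _ _ mu P' Pj) => // A B.
rewrite fubini_tonelli1//; apply: eq_integral => s _; rewrite /fubini_F.
rewrite ge0_integral_distribution//.
exact: measurable_fun_pair2.
Qed.

End freeze.

Section measurable_greedy.
Context {R : realType} {n : nat}.
Local Notation box := finset.setX.

Lemma measurable_forall_fin d (Z : measurableType d) (I : finType) (p : Z -> pred I) :
  (forall i, measurable_fun setT (p ^~ i)) ->
  measurable_fun setT (fun z => [forall i, p z i]).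
Proof.
move=> mp; apply: (measurable_fun_bool true); rewrite setTI.
rewrite (_ : _ @^-1` _ = \bigcap_(i in [set: I]) ((p ^~ i) @^-1` [set true])).
  apply: fin_bigcap_measurable => [|i _]; first exact: finite_finset.
  by rewrite -[X in measurable X]setTI; exact: mp.
apply/seteqP; split => t /=; first by move=> /forallP pt i _; exact: pt.
by move=> pt; apply/forallP => i; exact: pt.
Qed.

(** Only the costs of the edges of the box need be measurable: once the edge chosen
first is frozen, the remaining box avoids it. *)
Lemma measurable_greedy d (Z : measurableType d) (h : R -> \bar R) k
    (A B : {set 'I_n}) (y : Z -> R) (W : Z -> edge n -> R) :
  measurable_fun setT h -> measurable_fun setT y ->
  {in box A B, forall e, measurable_fun setT (W ^~ e)} ->
  measurable_fun setT (fun z => greedy h k A B (y z) (W z)).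
Proof.
move=> mh; elim: k A B y => [|k IH] A B y my mW /=; first exact: measurableT_comp.
under eq_fun do rewrite big_mkcond/=.
apply: (@emeasurable_sum _ _ _ _ _ _ (fun e z => if e \in box A B then
  if strict_min A B e (W z) then greedy h k (A :\ e.1) (B :\ e.2) (y z + W z e) (W z)
  else 0%E else 0%E)) => e; have [eAB|_] := boolP (e \in box A B); last exact: measurable_cst.
apply: measurable_fun_ifT => //.
- apply: measurable_forall_fin => f.
  have [fAB/=|] := boolP (f \in box A B); last by rewrite /= => _; exact: measurable_cst.
  case: (f != e) => /=; last exact: measurable_cst.
  by apply: measurable_fun_ltr; exact: mW.
- apply: IH; first by apply: measurable_funD => //; exact: mW.
  move=> f; rewrite !inE => /andP[/andP[_ fA] /andP[_ fB]].
  by apply: mW; rewrite inE fA.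
Qed.

Lemma greedy_ge0 (h : R -> \bar R) k (A B : {set 'I_n}) y w :
  (forall x, 0 <= h x)%E -> (0 <= greedy h k A B y w)%E.
Proof.
move=> h0; elim: k A B y => [|k IH] A B y //=.
by apply: sume_ge0 => e _; case: ifP.
Qed.

End measurable_greedy.

Section chain.
Context {R : realType} (mu : probability (measurableTypeR R) R).

(** The survival function of an edge cost. *)
Definition tail (s : R) : R := fine (mu (`]s, +oo[%classic : set R)).

(** The expectation of [h] of the final cost, when [k] vertices remain on each side,
the last chosen cost is [x] and the accumulated cost is [y], multiplied by the
probability [tail x ^+ (k ^ 2)] that the [k ^ 2] remaining edges cost more than [x].
With [k = k'.+1], there are [k ^ 2] choices of the next edge, of cost [s]; the [2 * k']
other edges that lose an endpoint with it contribute [tail s ^+ (2 * k')], and the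
[k' ^ 2] edges left are accounted for by [chain h k' s]. *)
Fixpoint chain (h : R -> \bar R) k (x y : R) : \bar R :=
  if k is k'.+1 then
    (\int[mu]_(s in (`]x, +oo[%classic : set R))
       (((k ^ 2)%:R * tail s ^+ (2 * k'))%:E * chain h k' s (y + s)))%E
  else h y.

Lemma tail_ge0 s : 0 <= tail s. Proof. exact: fine_ge0. Qed.

Lemma tail_nonincreasing x y : x <= y -> tail y <= tail x.
Proof.
move=> xy; apply: fine_le.
- by rewrite fin_num_measure//; exact: measurable_itv.
- by rewrite fin_num_measure//; exact: measurable_itv.
- by apply: le_measure; rewrite ?inE; try exact: measurable_itv; exact: subset_itvr.
Qed.

Lemma measurable_tail : measurable_fun setT tail.
Proof. by apply: nonincreasing_measurable => // x y; exact: tail_nonincreasing. Qed.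

Lemma chain_ge0 (h : R -> \bar R) k x y : (forall x, 0 <= h x)%E -> (0 <= chain h k x y)%E.
Proof.
move=> h0; elim: k x y => [|k IH] x y //=.
by apply: integral_ge0 => s _; rewrite mule_ge0// lee_fin mulr_ge0// exprn_ge0// tail_ge0.
Qed.

Lemma measurable_chain (h : R -> \bar R) k : measurable_fun setT h ->
  (forall x, 0 <= h x)%E ->
  measurable_fun setT (fun z : R * R => chain h k z.1 z.2).
Proof.
move=> mh h0; elim: k => [|k IH] /=.
  by apply: measurableT_comp => //; exact: measurable_snd.
pose f (z : (R * R) * measurableTypeR R) : \bar R := if z.1.1 < z.2 then
  (((k.+1 ^ 2)%:R * tail z.2 ^+ (2 * k))%:E * chain h k z.2 (z.1.2 + z.2))%E else 0%E.
have f0 z : (0 <= f z)%E.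
  rewrite /f; case: ifP => // _; rewrite mule_ge0 ?chain_ge0//.
  by rewrite lee_fin mulr_ge0// exprn_ge0// tail_ge0.
have mf : measurable_fun setT f.
  apply: measurable_fun_ifT => //.
  - apply: measurable_fun_ltr => //.
    by apply: measurableT_comp => //; exact: measurable_fst.
  - apply: emeasurable_funM.
      apply/measurable_EFinP; apply: measurable_funM => //; apply: measurable_funX.
      by apply: measurableT_comp; [exact: measurable_tail|exact: measurable_snd].
    pose g (z : (R * R) * measurableTypeR R) : R * R := (z.2, z.1.2 + z.2).
    apply: (@measurableT_comp _ _ _ _ _ _ _ _ g IH).
    apply: measurable_fun_pair => //; apply: measurable_funD => //.
    by apply: measurableT_comp => //; exact: measurable_fst.
apply: (eq_measurable_fun (fun z => \int[mu]_s f (z, s))%E); last first.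
  exact: (measurable_fun_fubini_tonelli_F (m2 := mu)).
move=> z _; rewrite [RHS]integral_mkcond; apply: eq_integral => s _.
by rewrite /f/= patchE mem_setE in_itv/= andbT.
Qed.

End chain.

Section law.
Context {R : realType} {n : nat} d (T : measurableType d) (P : probability T R)
  (mu : probability (measurableTypeR R) R) (X : edge n -> T -> R).
Local Notation box := finset.setX.
Implicit Types (A B : {set 'I_n}) (e : edge n) (C : edge n -> set R).

(** The [C e] form a rectangle of constraints on the individual costs; independence
means that the probability of such an event is a product. *)
Definition event C : set T := [set t | forall e, C e (X e t)].

Hypothesis mX : forall e, measurable_fun setT (X e).
Hypothesis indepX : forall C, (forall e, measurable (C e)) ->
  P (event C) = (\prod_(e : edge n) mu (C e))%E.
Variable h : R -> \bar R.
Hypothesis mh : measurable_fun setT h.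
Hypothesis h0 : forall x, (0 <= h x)%E.

Lemma measurable_event C : (forall e, measurable (C e)) -> measurable (event C).
Proof.
move=> mC; rewrite (_ : event C = \bigcap_(e in [set: edge n]) (X e @^-1` C e)).
  apply: fin_bigcap_measurable => [|e _]; first exact: finite_finset.
  by rewrite -[X in measurable X]setTI; exact: mX.
by apply/seteqP; split => t /= Ct e; [move=> _|]; exact: Ct.
Qed.

(** The cost of one edge is integrated first, the others being fixed. The second
hypothesis says that [Phi s t] depends on [t] only through the edges other than [e0]:
it remains measurable under every substitution that keeps these measurable. *)
Lemma integral_freeze_edge e0 (Phi : R -> T -> \bar R) :
  (forall s t, 0 <= Phi s t)%E ->
  (forall d' (Z : measurableType d') (s : Z -> R) (t : Z -> T), measurable_fun setT s ->
     (forall e, e != e0 -> measurable_fun setT (X e \o t)) ->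
     measurable_fun setT (fun z => Phi (s z) (t z))) ->
  (\int[P]_t Phi (X e0 t) t = \int[mu]_s \int[P]_t Phi s t)%E.
Proof.
move=> Phi0 mPhi.
pose G : set (set T) := [set S | exists C, [/\ forall e, measurable (C e),
  C e0 = setT & S = event C]].
have upd e C D : (forall f, measurable (C f)) -> measurable D ->
    forall f, measurable (if f == e then D else C f).
  by move=> mC mD f; case: ifP.
apply: (@integral_freeze _ _ _ P _ _ mu G (X e0) _ _ _ _ _ (fun z => Phi z.1 z.2)) => //.
- move=> _ _ [C [mC C0 ->]] [D [mD D0 ->]]; exists (fun e => C e `&` D e); split.
  + by move=> e; exact: measurableI.
  + by rewrite C0 D0 setIT.
  + apply/seteqP; split => t /=; first by move=> [h1 h2] e; split.
    by move=> h1; split => e; have [] := h1 e.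
- by exists (fun=> setT); split => //; apply/seteqP; split => t.
- by move=> _ [C [mC _ ->]]; exact: measurable_event.
- exact: mX.
- move=> A _ mA [C [mC C0 ->]].
  have -> : X e0 @^-1` A `&` event C = event (fun e => if e == e0 then A else C e).
    apply/seteqP; split => t /=.
      by move=> [At Ct] e; case: eqP => [->|].
    move=> At; split; first by have := At e0; rewrite eqxx.
    by move=> e; have := At e; case: eqP => // ->; rewrite C0.
  rewrite !indepX//; last exact: upd.
  rewrite (bigD1 e0)//= eqxx [in RHS](bigD1 e0)//= C0 probability_setT mul1e.
  by congr (_ * _)%E; apply: eq_bigr => e /negbTE ->.
- apply: mPhi; first exact: measurable_fst.
  move=> e ee0; apply: (@measurableT_comp _ _ _ _ _ _ (X e : g_sigma_algebraType G -> R)).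
    move=> _ A mA; rewrite setTI; apply: sub_sigma_algebra.
    exists (fun f => if f == e then A else setT); split.
    + by apply: (upd e (fun=> setT)).
    + by rewrite eq_sym (negbTE ee0).
    + apply/seteqP; split => t /=; first by move=> At f; case: eqP => [->|].
      by move=> /(_ e); rewrite eqxx.
  exact: measurable_snd.
Qed.

Lemma measurable_fun_mem d' (Z : measurableType d') (f : Z -> R) (D : set R) :
  measurable_fun setT f -> measurable D -> measurable_fun setT (fun z => f z \in D).
Proof.
move=> mf mD; apply: (measurable_fun_bool true); rewrite setTI.
rewrite (_ : _ @^-1` _ = f @^-1` D); first by rewrite -[X in measurable X]setTI; exact: mf.
by apply/seteqP; split => z /= => [/set_mem//|/mem_set].
Qed.

(** A box of side [k.+1] deprived of a row and a column through [e0] loses [e0] and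
[2 * k] other edges; all of these are constrained to cost more than [s]. *)
Lemma prode_boundary k A B e0 C (s : R) : #|A| = k.+1 -> #|B| = k.+1 -> e0 \in box A B ->
  (\prod_(e | e \notin box (A :\ e0.1) (B :\ e0.2))
     mu (if e == e0 then setT else if e \in box A B then (`]s, +oo[%classic : set R) else C e)
   = (\prod_(e | e \notin box A B) mu (C e)) * (tail mu s ^+ (2 * k))%:E)%E.
Proof.
move=> cA cB e0AB; set A' := A :\ _; set B' := B :\ _.
have [eA eB] : e0.1 \in A /\ e0.2 \in B by move: e0AB; rewrite inE => /andP.
have cA' : #|A'| = k by move: cA; rewrite (cardsD1 e0.1) eA => -[].
have cB' : #|B'| = k by move: cB; rewrite (cardsD1 e0.2) eB => -[].
have sub : box A' B' \subset box A B.
  by apply/fintype.subsetP => e; rewrite !inE => /andP[/andP[_ ->] /andP[_ ->]].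
have e0' : e0 \notin box A' B' by rewrite !inE eqxx.
rewrite (bigID (mem (box A B)))/= muleC; congr (_ * _)%E.
  rewrite (eq_bigl (fun e => e \notin box A B)); last first.
    move=> e; apply: andb_idl; apply: contra; exact: (fintype.subsetP sub).
  apply: eq_bigr => e eAB; rewrite (negbTE eAB) ifF//.
  by apply: contraNF eAB => /eqP ->.
rewrite (bigD1 e0)/=; last by rewrite e0' e0AB.
rewrite eqxx probability_setT mul1e.
rewrite (eq_bigr (fun=> (tail mu s)%:E)); last first.
  move=> e /andP[/andP[_ eAB] /negbTE ->]; rewrite eAB /tail fineK//.
  by rewrite fin_num_measure//; exact: measurable_itv.
rewrite (eq_bigl (mem ((box A B :\: box A' B') :\ e0))); last first.
  by move=> e; rewrite !inE andbC -!andbA.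
rewrite prodEFin prodr_const; congr (_ ^+ _)%:E.
have : #|(box A B :\: box A' B')| = (2 * k).+1.
  rewrite cardsD (finset.setIidPr sub) !cardsX cA cB cA' cB'; lia.
by rewrite (cardsD1 e0) finset.in_setD e0' e0AB => -[].
Qed.

(** The edges of the box carry no information except that they cost more than [x].
The edge [e0] of cost [s] is the cheapest one exactly when the others cost more than
[s], which is a rectangle of constraints again; so the induction hypothesis applies to
the smaller box, with [s] as the new threshold. The event [C] keeps track of the
constraints on the edges outside the box. *)
Lemma integral_greedy k A B x y C : #|A| = k -> #|B| = k ->
  (forall e, measurable (C e)) -> {in box A B, forall e, C e = `]x, +oo[%classic} ->
  (\int[P]_(t in event C) greedy h k A B y (X ^~ t) =
   (\prod_(e | e \notin box A B) mu (C e)) * chain mu h k x y)%E.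
Proof.
elim: k A B x y C => [|k IH] A B x y C cA cB mC CE.
  have AB0 e : e \notin box A B by rewrite inE (cards0_eq cA) inE.
  rewrite /= integral_cst; last exact: measurable_event.
  transitivity (h y * \prod_(e : edge n) mu (C e))%E.
    by congr (_ * _)%E; exact: indepX.
  by rewrite muleC; congr (_ * _)%E; apply: eq_bigl => e; rewrite AB0.
have mEC := measurable_event mC.
pose term e t := if strict_min A B e (X ^~ t)
  then greedy h k (A :\ e.1) (B :\ e.2) (y + X e t) (X ^~ t) else 0%E.
have mterm e : measurable_fun setT (term e).
  apply: measurable_fun_ifT => //.
  - apply: measurable_forall_fin => f; case: (_ && _) => /=; last exact: measurable_cst.
    exact: measurable_fun_ltr.
  - by apply: measurable_greedy => //; exact: measurable_funD.
have term0 e t : (0 <= term e t)%E by rewrite /term; case: ifP => // _; exact: greedy_ge0.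
pose c := (\prod_(e | e \notin box A B) mu (C e))%E.
have c0 : (0 <= c)%E by apply: prode_ge0.
pose I := (\int[mu]_(s in (`]x, +oo[%classic : set R))
  ((tail mu s ^+ (2 * k))%:E * chain mu h k s (y + s)))%E.
have mray : measurable (`]x, +oo[%classic : set R) by exact: measurable_itv.
have mI : measurable_fun setT
    (fun s : measurableTypeR R => (tail mu s ^+ (2 * k))%:E * chain mu h k s (y + s))%E.
  apply: emeasurable_funM.
    by apply/measurable_EFinP; apply: measurable_funX; exact: measurable_tail.
  pose g (s : R) : R * R := (s, y + s).
  apply: (@measurableT_comp _ _ _ _ _ _ _ _ g (measurable_chain mu k mh h0)).
  by apply: measurable_fun_pair => //; exact: measurable_funD.
have I0 (s : R) : (0 <= (tail mu s ^+ (2 * k))%:E * chain mu h k s (y + s))%E.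
  by rewrite mule_ge0 ?chain_ge0// lee_fin exprn_ge0// tail_ge0.
(* by symmetry each of the [k.+1 ^ 2] first edges contributes the same amount [c * I] *)
transitivity (\sum_(e in box A B) c * I)%E; last first.
  transitivity ((k.+1 ^ 2)%:R%:E * (c * I))%E; last first.
    rewrite muleCA; congr (_ * _)%E.
    rewrite /= /I -ge0_integralZl//; last exact: measurable_funTS.
    by apply: eq_integral => s _; rewrite EFinM muleA.
  by rewrite sumr_const cardsX cA cB mule_natl mulnn.
transitivity (\sum_(e in box A B) \int[P]_(t in event C) term e t)%E.
  rewrite -big_filter -ge0_integral_sum//; last by move=> e; exact: measurable_funTS.
  by apply: eq_integral => t _; rewrite big_filter.
apply: eq_bigr => e0 e0AB.
(* [Phi (X e0 t) t] is the term of [e0] on the event [event C]; in [Phi s t] the cost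
   of [e0] no longer appears, it has been replaced by [s] *)
pose p (s : R) t e := (e == e0) || (if e \in box A B then s < X e t else X e t \in C e).
pose Phi (s : R) t : \bar R := if (x < s) && [forall e, p s t e] then
  greedy h k (A :\ e0.1) (B :\ e0.2) (y + s) (X ^~ t) else 0%E.
transitivity (\int[P]_t Phi (X e0 t) t)%E.
  rewrite integral_mkcond; apply: eq_integral => t _; rewrite patchE /term /Phi.
  have -> : (x < X e0 t) && [forall e, p (X e0 t) t e] =
            (t \in event C) && strict_min A B e0 (X ^~ t).
    apply/andP/andP => -[].
    - move=> xX /forallP pX; split.
        apply/mem_set => e; have := pX e; rewrite /p; have [->|_] := eqVneq e e0.
          by rewrite CE//= in_itv/= xX.
        have [eAB /= Xe|_ /set_mem//] := boolP (e \in box A B).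
        by rewrite CE//= in_itv/= andbT (lt_trans xX).
      apply/forallP => e; apply/implyP => /andP[eAB ne].
      by have := pX e; rewrite /p (negbTE ne) eAB.
    - move=> /set_mem Ct /forallP mt; split.
        by have := Ct e0; rewrite CE//= in_itv/= andbT.
      apply/forallP => e; rewrite /p; have [//|ne] := eqVneq e e0.
      have [eAB|eAB] /= := boolP (e \in box A B).
        by have := mt e; rewrite eAB ne.
      by apply/mem_set; exact: Ct.
  by case: (t \in event C) => //=; case: ifP.
have Phi0 s t : (0 <= Phi s t)%E by rewrite /Phi; case: ifP => // _; exact: greedy_ge0.
rewrite integral_freeze_edge//; last first.
  move=> d' Z s t ms mt; apply: measurable_fun_ifT => //.
  - apply: measurable_and; first exact: measurable_fun_ltr.
    apply: measurable_forall_fin => e; rewrite /p.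
    have [_|ne] := eqVneq e e0; first exact: measurable_cst.
    case: (e \in box A B) => /=.
      by apply: measurable_fun_ltr => //; exact: mt.
    by apply: measurable_fun_mem => //; exact: mt.
  - apply: measurable_greedy => //; first exact: measurable_funD.
    move=> e; rewrite !inE => /andP[/andP[e1 _] _]; apply: mt.
    by apply: contraNneq e1 => ->.
rewrite /I -ge0_integralZl//; last exact: measurable_funTS.
rewrite [RHS]integral_mkcond; apply: eq_integral => s _.
rewrite patchE mem_setE in_itv/= andbT /Phi; case: ifPn => xs /=; last first.
  by rewrite integral0.
pose C' e := if e == e0 then setT else if e \in box A B then (`]s, +oo[%classic : set R) else C e.
transitivity (\int[P]_(t in event C')
    greedy h k (A :\ e0.1) (B :\ e0.2) (y + s) (X ^~ t))%E.
  rewrite [RHS]integral_mkcond; apply: eq_integral => t _; rewrite patchE.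
  congr (if _ then _ else _); apply/forallP/idP => [ps|/set_mem Ct e].
    apply/mem_set => e; have := ps e; rewrite /p /C'.
    have [//|_] := eqVneq e e0.
    have [eAB|_ /set_mem//] := boolP (e \in box A B).
    by rewrite /= in_itv/= andbT.
  have := Ct e; rewrite /p /C'; have [//|_] := eqVneq e e0.
  have [eAB|_ /mem_set//] := boolP (e \in box A B).
  by rewrite /= in_itv/= andbT.
have [eA eB] : e0.1 \in A /\ e0.2 \in B by move: e0AB; rewrite inE => /andP.
rewrite (IH _ _ s); first last.
- move=> e; rewrite !inE => /andP[/andP[e1 eA'] /andP[_ eB']]; rewrite /C'.
  by rewrite inE eA' eB' ifF//; apply: contraNF e1 => /eqP ->.
- by move=> e; rewrite /C'; case: ifP => // _; case: ifP => // _; exact: measurable_itv.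
- by move: cB; rewrite (cardsD1 e0.2) eB => -[].
- by move: cA; rewrite (cardsD1 e0.1) eA => -[].
by rewrite (prode_boundary _ _ cA cB e0AB) -/c muleA.
Qed.

Hypothesis mu_atomless : forall s : R, mu [set s] = 0%E.
Hypothesis mu_pos : mu (`]0, +oo[%classic : set R) = 1%E.

Let law_edge e (A : set R) : measurable A -> P (X e @^-1` A) = mu A.
Proof.
move=> mA; have := @indepX (fun f => if f == e then A else setT).
rewrite (bigD1 e)//= eqxx big1 ?mule1 => [|f /negbTE ->]; last exact: probability_setT.
move=> <-; last by move=> f; case: ifP.
congr (P _); apply/seteqP; split => t /=; first by move=> At f; case: eqP => [->|].
by move=> /(_ e); rewrite eqxx.
Qed.

(** Two independent costs without atoms are almost surely different: freeze one of
them. *)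
Lemma edges_injective : {ae P, forall t, injective (X ^~ t)}.
Proof.
suff : {ae P, forall t (ef : edge n * edge n), X ef.1 t = X ef.2 t -> ef.1 = ef.2}.
  move=> [N [mN N0 NS]]; exists N; split => //.
  by apply: subset_trans NS => t /= nt i; apply: nt => e f; exact: (i (e, f)).
apply: filter_forall => -[e f] /=.
have [->|ne] := eqVneq e f; first by apply: aeW.
exists [set t | X e t = X f t].
have mE : measurable [set t | X e t = X f t].
  have mt : measurable [set true] by [].
  have := measurable_fun_eqr (mX e) (mX f) measurableT mt.
  rewrite setTI; congr measurable; apply/seteqP; split => t /=; first by move/eqP.
  by move=> ->; rewrite eqxx.
split => //; last by move=> t /= h1; apply: contrapT => h2; apply: h1 => /h2.
pose Phi (s : R) t : \bar R := if X f t == s then 1%E else 0%E.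
have Phi0 s t : (0 <= Phi s t)%E by rewrite /Phi; case: ifP.
transitivity (\int[P]_t Phi (X e t) t)%E.
  rewrite -[LHS]mul1e -integral_cst// integral_mkcond.
  apply: eq_integral => t _; rewrite patchE /Phi eq_sym.
  congr (if _ then _ else _); apply/idP/eqP => [/set_mem//|]; exact: mem_set.
rewrite integral_freeze_edge//; last first.
  move=> d' Z s t ms mt; apply: measurable_fun_ifT => //.
  by apply: measurable_fun_eqr => //; apply: mt; rewrite eq_sym.
rewrite integral0_eq// => s _.
transitivity (\int[P]_(t in X f @^-1` [set s]) 1)%E.
  rewrite [RHS]integral_mkcond; apply: eq_integral => t _; rewrite patchE /Phi.
  congr (if _ then _ else _); apply/eqP/idP => [|/set_mem//]; exact: mem_set.
have mXs : measurable (X f @^-1` [set s]).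
  by rewrite -[X in measurable X]setTI; exact: mX.
rewrite integral_cst// mul1e.
transitivity (mu [set s]); [exact: law_edge|exact: mu_atomless].
Qed.

Lemma integral_stable_cost :
  measurable_fun setT (fun t => stable_cost (X ^~ t)) ->
  (\int[P]_t h (stable_cost (X ^~ t)) = chain mu h n 0 0)%E.
Proof.
move=> mstable; pose C (e : edge n) := `]0, +oo[%classic : set R.
have mC e : measurable (C e) by exact: measurable_itv.
have mEC := measurable_event mC.
have PEC : P (event C) = 1%E by rewrite indepX// big1.
have cT : #|[set: 'I_n]%SET| = n by rewrite finset.cardsT card_ord.
have := integral_greedy 0 cT cT mC (fun _ _ => erefl).
rewrite big_pred0 ?mul1e => [<-|e]; last by rewrite !inE.
rewrite [RHS]integral_mkcond; apply: ge0_ae_eq_integral => //.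
- exact: measurableT_comp.
- by apply/(measurable_restrictT _ _).1 => //; apply: measurable_funTS; exact: measurable_greedy.
- by move=> t _; rewrite patchE; case: ifP => // _; exact: greedy_ge0.
have [N [mN N0 NS]] := edges_injective.
exists (N `|` ~` event C); split; first by apply: measurableU => //; exact: measurableC.
- rewrite null_set_setU//; first exact: measurableC.
  by transitivity (1 - P (event C))%E; [exact: probability_setC|rewrite PEC subee].
move=> t /= nt; have [tC|] := pselect (event C t); last by right.
left; apply: NS => /= it; apply: nt => _.
by rewrite patchE mem_set// greedy_stable_cost.
Qed.

End law.

(** * Representation by independent exponential variables *)

Section omega.
Context {R : realType}.

Fixpoint omega_display (k : nat) : measure_display :=
  if k is k'.+1 then (R.-ocitv.-measurable.-sigma, omega_display k').-prod%mdisp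
  else default_measure_display.

(** The space of [k] independent exponential variables, as a nested product: the first
coordinate of [omega k] is the variable of index [k], so that the greedy algorithm,
which goes down from [k] to 1, reads them in order and every integral unfolds one
variable at a time. *)
Fixpoint omega (k : nat) : measurableType (omega_display k) :=
  match k return measurableType (omega_display k) with
  | 0 => unit
  | k'.+1 => (measurableTypeR R * omega k')%type
  end.

Fixpoint omegaP (k : nat) : probability (omega k) R :=
  match k return probability (omega k) R with
  | 0 => \d_tt
  | k'.+1 => (expo R \x omegaP k')%E
  end.

Lemma integral_omega0 (f : omega 0 -> \bar R) : (\int[omegaP 0]_w f w = f tt)%E.
Proof. by rewrite /= integral_dirac// diracT mul1e. Qed.

Lemma integral_omegaS k (f : omega k.+1 -> \bar R) :
  measurable_fun setT f -> (forall w, 0 <= f w)%E ->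
  (\int[omegaP k.+1]_w f w = \int[expo R]_e \int[omegaP k]_w f (e, w))%E.
Proof. by move=> mf f0; rewrite /= fubini_tonelli1. Qed.

(** [lin a w] is the sum of [a j * e_j] over the indices [1 <= j <= k]. *)
Fixpoint lin (a : nat -> R) (k : nat) : omega k -> R :=
  match k return omega k -> R with
  | 0 => fun=> 0
  | k'.+1 => fun w => a k'.+1 * w.1 + lin a w.2
  end.

Lemma measurable_lin a k : measurable_fun setT (@lin a k).
Proof.
elim: k => [|k IH] /=; first exact: measurable_cst.
apply: measurable_funD.
  by apply: measurable_funM => //; exact: measurable_fst.
by apply: (measurableT_comp IH); exact: measurable_snd.
Qed.

Lemma eq_lin (a b : nat -> R) k (w : omega k) :
  (forall j, (0 < j <= k)%N -> a j = b j) -> lin a w = lin b w.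
Proof.
elim: k w => //= k IH w ab; rewrite ab ?ltnSn//; congr (_ + _).
by apply: IH => j /andP[j0 jk]; rewrite ab// j0 ltnW.
Qed.

Lemma lin0 k (w : omega k) : lin (fun=> 0) w = 0.
Proof. by elim: k w => //= k IH w; rewrite IH mul0r addr0. Qed.

Variable G : R -> R.

(** The greedy cost in the scale of [G]: [x] is the current time, and the next edge
is chosen after a delay [e_k / k ^ 2]. *)
Fixpoint cost (k : nat) (x : R) : omega k -> R :=
  match k return omega k -> R with
  | 0 => fun=> 0
  | k'.+1 => fun w => G (x + w.1 / (k'.+1 ^ 2)%:R) + cost (x + w.1 / (k'.+1 ^ 2)%:R) w.2
  end.

(** The coefficients of the time [S_m] of the choice made when [m] vertices remain on
each side, the sum of the [e_j / j ^ 2] over [j >= m]. *)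
Definition recip2 m j : R := if (m <= j)%N then ((j ^ 2)%:R)^-1 else 0.

Lemma costE k x (w : omega k) :
  cost x w = \sum_(1 <= m < k.+1) G (x + lin (recip2 m) w).
Proof.
elim: k x w => [|k IH] x w /=; first by rewrite big_geq.
rewrite big_nat_recr//= addrC IH; congr (_ + _); last first.
  apply: eq_big_nat => m /andP[m0 mk]; congr G.
  by rewrite /recip2 ifT 1?ltnW// mulrC addrA.
congr G; rewrite /recip2 leqnn mulrC; congr (_ + _).
rewrite (eq_lin (b := fun=> 0)) ?lin0 ?addr0// => j /andP[_ jk].
by rewrite leqNgt ltnS jk.
Qed.

Hypothesis mG : measurable_fun setT G.

Lemma measurable_cost k :
  measurable_fun setT (fun z : measurableTypeR R * omega k => cost z.1 z.2).
Proof.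
elim: k => [|k IH] /=; first exact: measurable_cst.
have mx : measurable_fun setT (fun z : measurableTypeR R * omega k.+1 =>
  z.1 + z.2.1 / (k.+1 ^ 2)%:R).
  apply: measurable_funD; first exact: measurable_fst.
  apply: measurable_funM => //.
  apply: (@measurableT_comp _ _ _ _ _ _ (@fst (measurableTypeR R) (omega k))).
    exact: measurable_fst.
  exact: measurable_snd.
apply: measurable_funD; first exact: measurableT_comp.
pose g (z : measurableTypeR R * omega k.+1) : measurableTypeR R * omega k :=
  (z.1 + z.2.1 / (k.+1 ^ 2)%:R, z.2.2).
apply: (@measurableT_comp _ _ _ _ _ _ _ _ g IH).
apply: measurable_fun_pair => //.
apply: (@measurableT_comp _ _ _ _ _ _ (@snd (measurableTypeR R) (omega k))).
  exact: measurable_snd.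
exact: measurable_snd.
Qed.

Lemma measurable_cost0 k x : measurable_fun setT (@cost k x).
Proof.
exact: (@measurableT_comp _ _ _ _ _ _ _ _ _ (@measurable_cost k)
  (pair1_measurable (x : measurableTypeR R))).
Qed.

Variable mu : probability (measurableTypeR R) R.
Hypothesis G_le0 : forall u, u <= 0 -> G u = 0.
Hypothesis G_incr : forall u v, 0 <= u -> u < v -> G u < G v.
Hypothesis muG : forall A, measurable A -> mu A = expo R (G @^-1` A).
Variable h : R -> \bar R.
Hypothesis mh : measurable_fun setT h.
Hypothesis h0 : forall x, (0 <= h x)%E.

Let preG v : 0 <= v -> G @^-1` `]G v, +oo[%classic = `]v, +oo[%classic.
Proof.
move=> v0; apply/seteqP; split => u /=; rewrite !in_itv/= !andbT; last exact: G_incr.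
apply: contraTT; rewrite -!leNgt => uv.
have [u0|u0] := leP u 0.
  rewrite (G_le0 u0); move: v0; rewrite le_eqVlt => /predU1P[<-|v0].
    by rewrite G_le0.
  by rewrite -(G_le0 (lexx 0)) ltW// G_incr.
by move: uv; rewrite le_eqVlt => /predU1P[->//|uv]; rewrite ltW// G_incr// ltW.
Qed.

Let tailG v : 0 <= v -> tail mu (G v) = expR (- v).
Proof.
move=> v0; rewrite /tail muG; last exact: measurable_itv.
by rewrite preG// expo_ray.
Qed.

Let integral_muG (D : set R) (f : R -> \bar R) : measurable D -> measurable_fun D f ->
  {in D, forall x, 0 <= f x}%E ->
  (\int[mu]_(x in D) f x = \int[expo R]_(u in G @^-1` D) f (G u))%E.
Proof.
move=> mD mf f0; have mG' : measurable_fun setT (G : measurableTypeR R -> measurableTypeR R) by [].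
rewrite (eq_measure_integral
  (measure_function_pushforward__canonical__measure_function_Measure (expo R) mG')).
  by rewrite ge0_integral_pushforward.
by move=> A mA _; exact: muG.
Qed.

(** At time [v], where the threshold is [G v], the weight of [chain] is
[exp (- k ^ 2 v)]: the minimum of [k ^ 2] exponential variables is an exponential
variable divided by [k ^ 2], and the times still to come are not influenced by [v]. *)
Lemma chain_cost k v y : 0 <= v ->
  (chain mu h k (G v) y =
   (expR (- ((k ^ 2)%:R * v)))%:E * \int[omegaP k]_w h (y + cost v w)%R)%E.
Proof.
elim: k v y => [|k IH] v y v0.
  by rewrite integral_omega0/= mul0r oppr0 expR0 mul1e addr0.
have mH : measurable_fun setT (fun z : measurableTypeR R * omega k => h (y + G z.1 + cost z.1 z.2)).
  apply: (measurableT_comp mh); apply: measurable_funD; last exact: measurable_cost.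
  by apply: measurable_funD => //; apply: (measurableT_comp mG); exact: measurable_fst.
pose H (u : R) : \bar R := (\int[omegaP k]_w h (y + G u + cost u w)%R)%E.
have mHu : measurable_fun setT H.
  apply: (measurable_fun_fubini_tonelli_F (m2 := omegaP k) _ mH) => z; exact: h0.
have H0 u : (0 <= H u)%E by apply: integral_ge0.
have K0 : 0 < (k.+1 ^ 2)%:R :> R by rewrite ltr0n expn_gt0.
transitivity ((k.+1 ^ 2)%:R%:E * \int[expo R]_(u in (`]v, +oo[%classic : set R))
    (H u * (expR (- (((k.+1 ^ 2)%:R - 1) * u)))%:E))%E.
  rewrite /= integral_muG; first last.
  - by move=> s _; rewrite mule_ge0 ?chain_ge0// lee_fin mulr_ge0// exprn_ge0// tail_ge0.
  - apply: measurable_funTS; apply: emeasurable_funM.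
      apply/measurable_EFinP; apply: measurable_funM => //; apply: measurable_funX.
      exact: measurable_tail.
    pose g (s : R) : R * R := (s, y + s).
    apply: (@measurableT_comp _ _ _ _ _ _ _ _ g (measurable_chain mu k mh h0)).
    by apply: measurable_fun_pair => //; exact: measurable_funD.
  - exact: measurable_itv.
  rewrite preG// -ge0_integralZl//; last 2 first.
  - apply: measurable_funTS; apply: emeasurable_funM => //.
    apply/measurable_EFinP; apply: measurableT_comp => //; apply: measurableT_comp => //.
  - by move=> u _; rewrite mule_ge0// lee_fin expR_ge0.
  apply: eq_integral => u; rewrite inE/= in_itv/= andbT => vu.
  have u0 : 0 <= u by rewrite (le_trans v0)// ltW.
  rewrite IH// tailG// -/(H u) EFinM -!muleA; congr (_ * _)%E.
  rewrite muleA -EFinM muleC; congr (_ * (_)%:E)%E.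
  (* [2 k + k ^ 2 = (k + 1) ^ 2 - 1], the number of edges other than the chosen one *)
  rewrite -expRM_natl -expRD; congr expR; rewrite !natrX; ring.
have mC : measurable_fun setT (fun w : omega k.+1 => h (y + cost v w)).
  by apply: (measurableT_comp mh); apply: measurable_funD => //; exact: measurable_cost0.
rewrite integral_omegaS//.
have -> : (\int[expo R]_e \int[omegaP k]_w h (y + @cost k.+1 v (e, w))%R =
    \int[expo R]_e H (v + e / (k.+1 ^ 2)%:R)%R)%E.
  apply: eq_integral => e _; rewrite /H; apply: eq_integral => w _ /=.
  by rewrite addrA.
rewrite (expo_affine v0 K0 mHu H0) muleA -EFinM mulrCA -expRD addNr expR0 mulr1.
by [].
Qed.

End omega.

(** * Moments of linear forms in exponential variables *)

Lemma integral_prob_cst {R : realType} d (T : measurableType d) (P : probability T R)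
    (c : \bar R) : (\int[P]_t c = c)%E.
Proof.
by transitivity (c * P setT)%E; [exact: integral_cst|rewrite probability_setT mule1].
Qed.

Section moments.
Context {R : realType}.
Local Notation Q := (expo R).

Lemma integral_omegaSr k (f : omega k.+1 -> \bar R) :
  measurable_fun setT f -> (forall w, 0 <= f w)%E ->
  (\int[omegaP k.+1]_w f w = \int[omegaP k]_w \int[Q]_e f (e, w))%E.
Proof. by move=> mf f0; rewrite /= fubini_tonelli2. Qed.

(** The centred linear form: the sum of [a j * (e_j - 1)]. *)
Definition clin (a : nat -> R) k (w : omega k) : R :=
  lin a w - \sum_(1 <= j < k.+1) a j.

Lemma clinS a k (w : omega k.+1) : clin a w = a k.+1 * (w.1 - 1) + clin a w.2.
Proof. by rewrite /clin big_nat_recr//=; ring. Qed.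

Lemma clin0 a (w : omega 0) : clin a w = 0.
Proof. by rewrite /clin big_geq//= subrr. Qed.

Lemma measurable_clin a k : measurable_fun setT (@clin a k).
Proof. by apply: measurable_funB => //; exact: measurable_lin. Qed.

Lemma expo_square (w a : R) :
  (\int[Q]_e ((w + a * (e - 1)) ^+ 2)%:E = (w ^+ 2 + a ^+ 2)%:E)%E.
Proof.
pose c i := match i with 0 => (w - a) ^+ 2 | 1 => 2 * a * (w - a) | _ => a ^+ 2 end.
have [_ h] := expo_poly 3 c.
transitivity (\int[Q]_e (\sum_(i < 3) c i * e ^+ i)%:E)%E.
  by apply: eq_integral => e _; rewrite !big_ord_recl big_ord0 /=; congr EFin; ring.
rewrite h !big_ord_recl big_ord0 /= /bump /= !factS fact0; congr EFin; ring.
Qed.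

Lemma expo_fourth (w a : R) :
  (\int[Q]_e ((w + a * (e - 1)) ^+ 4)%:E =
   (w ^+ 4 + 6 * w ^+ 2 * a ^+ 2 + 8 * w * a ^+ 3 + 9 * a ^+ 4)%:E)%E.
Proof.
pose b := w - a.
pose c i := match i with 0 => b ^+ 4 | 1 => 4 * a * b ^+ 3 | 2 => 6 * a ^+ 2 * b ^+ 2
  | 3 => 4 * a ^+ 3 * b | _ => a ^+ 4 end.
have [_ h] := expo_poly 5 c.
transitivity (\int[Q]_e (\sum_(i < 5) c i * e ^+ i)%:E)%E.
  by apply: eq_integral => e _; rewrite !big_ord_recl big_ord0 /= /b; congr EFin; ring.
rewrite h !big_ord_recl big_ord0 /= /b /bump /= !factS fact0; congr EFin; ring.
Qed.

Let measurable_pow a c n k : measurable_fun setT (fun w : omega k => ((c + clin a w) ^+ n)%:E).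
Proof.
apply/measurable_EFinP; apply: measurable_funX; apply: measurable_funD => //.
exact: measurable_clin.
Qed.

Lemma clin_square a c k :
  (\int[omegaP k]_w ((c + clin a w) ^+ 2)%:E =
   (c ^+ 2 + \sum_(1 <= j < k.+1) a j ^+ 2)%:E)%E.
Proof.
elim: k c => [|k IH] c.
  by rewrite integral_omega0 clin0 big_geq// !addr0.
rewrite integral_omegaSr//; last by move=> w; rewrite lee_fin exprn_even_ge0.
transitivity (\int[omegaP k]_w (((c + clin a w) ^+ 2)%:E + (a k.+1 ^+ 2)%:E))%E.
  apply: eq_integral => w _; rewrite -EFinD -expo_square; apply: eq_integral => e _.
  by rewrite clinS/=; congr ((_ ^+ _)%:E); ring.
rewrite ge0_integralD//; last 2 first.
- by move=> w _; rewrite lee_fin exprn_even_ge0.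
- by move=> w _; rewrite lee_fin exprn_even_ge0.
rewrite IH integral_prob_cst [in RHS]big_nat_recr//=.
by rewrite -EFinD addrA.
Qed.

(** Induction on the number of variables: a new term [b (e - 1)] adds
[6 x ^ 2 b ^ 2 + 8 x b ^ 3 + 9 b ^ 4] to the conditional fourth moment, and
[8 x b ^ 3] is at most [4 x ^ 2 b ^ 2 + 4 b ^ 4]. The constant 13 closes the induction
because [10 <= 2 * 13]. *)
Lemma clin_fourth a k :
  (\int[omegaP k]_w ((clin a w) ^+ 4)%:E <=
   (13 * (\sum_(1 <= j < k.+1) a j ^+ 2) ^+ 2)%:E)%E.
Proof.
elim: k => [|k IH].
  by rewrite integral_omega0 clin0 big_geq// !expr0n /= mulr0.
have m4 : forall k, measurable_fun setT (fun w : omega k => ((clin a w) ^+ 4)%:E).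
  by move=> j; have := @measurable_pow a 0 4 j; under eq_fun do rewrite add0r.
have m2 : measurable_fun setT (fun w : omega k => ((clin a w) ^+ 2)%:E).
  by have := @measurable_pow a 0 2 k; under eq_fun do rewrite add0r.
rewrite integral_omegaSr//; last by move=> w; rewrite lee_fin exprn_even_ge0.
set s := \sum_(1 <= j < k.+1) a j ^+ 2; set b := a k.+1.
have b10 : 0 <= 10 * b ^+ 2 by rewrite mulr_ge0// exprn_even_ge0.
have b13 : 0 <= 13 * b ^+ 4 by rewrite mulr_ge0// exprn_even_ge0.
apply: (@le_trans _ _ (\int[omegaP k]_w (((clin a w) ^+ 4)%:E +
    ((10 * b ^+ 2)%:E * ((clin a w) ^+ 2)%:E + (13 * b ^+ 4)%:E)))%E).
  apply: ge0_le_integral => //.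
  - move=> w _; apply: integral_ge0 => e _; rewrite lee_fin exprn_even_ge0//.
  - apply: (@measurable_fun_fubini_tonelli_G _ _ (measurableTypeR R) (omega k) R Q
      (fun z => ((@clin a k.+1 z) ^+ 4)%:E) (m4 k.+1)).
    by move=> w; rewrite lee_fin exprn_even_ge0.
  - apply: emeasurable_funD => //; apply: emeasurable_funD => //.
    exact: emeasurable_funM.
  - move=> w _; rewrite -EFinM -!EFinD.
    under eq_integral do rewrite clinS/= addrC.
    rewrite expo_fourth lee_fin -/b.
    have := sqr_ge0 (clin a w - b); have := sqr_ge0 b; nra.
have p4 (w : omega k) : (0 <= (clin a w ^+ 4)%:E)%E by rewrite lee_fin exprn_even_ge0.
have p2 (w : omega k) : (0 <= (clin a w ^+ 2)%:E)%E by rewrite lee_fin exprn_even_ge0.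
have p10 (w : omega k) : (0 <= (10 * b ^+ 2)%:E * (clin a w ^+ 2)%:E)%E.
  by rewrite mule_ge0// lee_fin.
have p13 : (0 <= (13 * b ^+ 4)%:E)%E by rewrite lee_fin.
have p1013 (w : omega k) :
  (0 <= (10 * b ^+ 2)%:E * (clin a w ^+ 2)%:E + (13 * b ^+ 4)%:E)%E by rewrite adde_ge0.
have m10 : measurable_fun setT (fun w : omega k => (10 * b ^+ 2)%:E * (clin a w ^+ 2)%:E)%E.
  exact: emeasurable_funM.
have m1013 : measurable_fun setT
    (fun w : omega k => (10 * b ^+ 2)%:E * (clin a w ^+ 2)%:E + (13 * b ^+ 4)%:E)%E.
  exact: emeasurable_funD.
rewrite ge0_integralD// ge0_integralD// ge0_integralZl_EFin//.
have -> : (\int[omegaP k]_w (clin a w ^+ 2)%:E = \int[omegaP k]_w ((0 + clin a w) ^+ 2)%:E)%E.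
  by under [RHS]eq_integral do rewrite add0r.
rewrite clin_square expr0n add0r -/s integral_prob_cst.
apply: (le_trans (leeD IH (lexx _)));
  rewrite -EFinM -!EFinD lee_fin [\sum_(1 <= j < k.+2) _]big_nat_recr//= -/s -/b.
have s0 : 0 <= s by apply: sumr_ge0 => j _; exact: sqr_ge0.
have := sqr_ge0 b; nra.
Qed.

Lemma expo_mgf theta : 0 <= theta < 1 ->
  (\int[Q]_e (expR (theta * e))%:E = ((1 - theta)^-1)%:E)%E.
Proof.
move=> /andP[t0 t1]; have l0 : 0 < 1 - theta by rewrite subr_gt0.
have mexp (c : R) : measurable_fun setT (fun e : R => (expR (c * e))%:E).
  by apply/measurable_EFinP; apply: measurableT_comp => //; exact: mulrl_measurable.
rewrite expoE; [|exact: mexp|by move=> x; rewrite lee_fin expR_ge0].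
have h := integral_exponential_pdf l0.
transitivity (((1 - theta)^-1)%:E *
  \int[lebesgue_measure]_x (exponential_pdf (1 - theta) x)%:E)%E; last by rewrite h mule1.
rewrite -ge0_integralZl//; last 3 first.
- by apply/measurable_EFinP; exact: measurable_exponential_pdf.
- by move=> x _; rewrite lee_fin exponential_pdf_ge0// ltW.
- by rewrite lee_fin invr_ge0 ltW.
rewrite [LHS]integral_mkcond; apply: eq_integral => x _.
rewrite /exponential_pdf !patchE; case: ifPn => _; last by rewrite mule0.
rewrite -!EFinM mulrA mulVf ?gt_eqF// mul1r -expRD; congr (expR _)%:E; ring.
Qed.

(** The variable [e_1 + e_2 / 4 + ... + e_(k+1) / (k + 1) ^ 2] has a density at most
twice that of [e_1] alone. Adding a variable [e_j / j ^ 2] multiplies the bound on the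
density by [E exp (e_j / j ^ 2) = j ^ 2 / ((j - 1) (j + 1))], and the product of these
factors telescopes. *)
Lemma integral_lin_recip k (x : R) (phi : R -> \bar R) : 0 <= x ->
  measurable_fun setT phi -> (forall u, 0 <= phi u)%E ->
  (\int[omegaP k.+1]_w phi (x + lin (recip2 1) w)%R <=
   (2 * k.+1%:R / k.+2%:R * expR x)%:E * \int[Q]_u phi u)%E.
Proof.
move=> x0 mphi phi0.
have mp j y : measurable_fun setT (fun w : omega j => phi (y + lin (recip2 1) w)%R).
  by apply: (measurableT_comp mphi); apply: measurable_funD => //; exact: measurable_lin.
have I0 : (0 <= \int[Q]_u phi u)%E by exact: integral_ge0.
elim: k x x0 => [|k IH] x x0.
  rewrite integral_omegaS//.
  have -> : (\int[Q]_e \int[omegaP 0]_w phi (x + lin (recip2 1) ((e, w) : omega 1))%R =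
      \int[Q]_e phi (x + e / 1)%R)%E.
    apply: eq_integral => e _; rewrite integral_omega0/= /recip2/=.
    by rewrite exp1n !invr1 mul1r mulr1 addr0.
  rewrite (expo_affine x0 ltr01 mphi phi0) !mul1r mulr1 divff// mul1r.
  apply: lee_wpmul2l; first by rewrite lee_fin expR_ge0.
  apply: (@le_trans _ _ (\int[Q]_(u in `]x, +oo[) phi u)%E).
    rewrite le_eqVlt; apply/orP; left; apply/eqP; apply: eq_integral => u _.
    by rewrite subrr mul0r oppr0 expR0 mule1.
  by apply: ge0_subset_integral => //; exact: measurable_itv.
rewrite integral_omegaS//.
have th : 0 <= ((k.+2 ^ 2)%:R^-1 : R) < 1.
  by rewrite invr_ge0 ler0n invf_lt1 ?ltr0n ?ltr1n ?expn_gt0.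
have k0 : 0 < k.+1%:R / k.+2%:R :> R by rewrite divr_gt0.
have mexp (c : R) : measurable_fun setT (fun e : R => (expR (x + c * e))%:E).
  apply/measurable_EFinP; apply: measurableT_comp => //; exact: measurable_funD.
have inner (e : R) : 0 <= e ->
    (\int[omegaP k.+1]_w phi (x + lin (recip2 1) ((e, w) : omega k.+2))%R <=
     (2 * k.+1%:R / k.+2%:R * expR (x + (k.+2 ^ 2)%:R^-1 * e))%:E * \int[Q]_u phi u)%E.
  move=> e0; have := IH (x + (k.+2 ^ 2)%:R^-1 * e).
  rewrite addr_ge0// ?mulr_ge0 ?invr_ge0// => /(_ isT).
  by under eq_integral do rewrite -addrA.
apply: (@le_trans _ _ (\int[Q]_e ((2 * k.+1%:R / k.+2%:R * expR (x + (k.+2 ^ 2)%:R^-1 * e))%:E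
    * \int[Q]_u phi u))%E).
  apply: ae_ge0_le_integral => //.
  - by move=> e _; exact: integral_ge0.
  - exact: (measurable_fun_fubini_tonelli_F (m2 := omegaP k.+1) _ (mp k.+2 x)).
  - by move=> e _; rewrite mule_ge0// lee_fin mulr_ge0 ?expR_ge0// -mulrA mulr_ge0// ltW.
  - apply: emeasurable_funM => //; under eq_fun do rewrite EFinM.
    by apply: emeasurable_funM => //; exact: mexp.
  have [N [mN N0 NS]] := @expo_ge0 R; exists N; split => //.
  by apply: subset_trans NS => e nh e0; apply: nh => _; exact: inner.
pose c : R := 2 * k.+1%:R / k.+2%:R.
have c0 : 0 <= c by rewrite /c -mulrA mulr_ge0// ltW.
have mE : measurable_fun setT (fun e : measurableTypeR R =>
  (c * expR (x + (k.+2 ^ 2)%:R^-1 * e))%:E).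
  by under eq_fun do rewrite EFinM; apply: emeasurable_funM => //; exact: mexp.
have pE (e : measurableTypeR R) : (0 <= (c * expR (x + (k.+2 ^ 2)%:R^-1 * e))%:E)%E.
  by rewrite lee_fin mulr_ge0// expR_ge0.
rewrite ge0_integralZr// -/c.
apply: lee_wpmul2r => //.
have c1 : 0 <= c * expR x by rewrite mulr_ge0// expR_ge0.
have mE' : measurable_fun setT (fun e : measurableTypeR R => (expR ((k.+2 ^ 2)%:R^-1 * e))%:E).
  by apply/measurable_EFinP; apply: measurableT_comp => //; exact: mulrl_measurable.
have pE' (e : measurableTypeR R) : (0 <= (expR ((k.+2 ^ 2)%:R^-1 * e))%:E)%E.
  by rewrite lee_fin expR_ge0.
under eq_integral do rewrite expRD mulrA EFinM.
rewrite ge0_integralZl_EFin//.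
rewrite expo_mgf// -EFinM lee_fin le_eqVlt; apply/orP; left; apply/eqP.
rewrite mulrAC; congr (_ * _).
rewrite /c natrX -(natr1 k.+2) -(natr1 k.+1).
have kR : 0 <= k%:R :> R by [].
by field; apply/and3P; split; rewrite gt_eqF//; nra.
Qed.
End moments.

(** * Inequalities between powers *)

Section power_inequalities.
Context {R : realType}.
Implicit Types (p x y : R).

(** Concavity of the power, obtained from Young's inequality for the conjugate
exponents [1 / p] and [1 / (1 - p)]. *)
Lemma powR_tangent p y : 0 <= p <= 1 -> 0 <= y -> y `^ p <= 1 + p * (y - 1).
Proof.
move=> /andP[p0 p1] y0.
have [->|y_neq0] := eqVneq y 0.
  have [->|pn0] := eqVneq p 0; first by rewrite powRr0 mul0r addr0.
  by rewrite powR0//; lra.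
have [->|p_neq0] := eqVneq p 0; first by rewrite powRr0 mul0r addr0.
have [->|p_neq1] := eqVneq p 1; first by rewrite powRr1// mul1r addrCA subrr addr0.
have p_gt0 : 0 < p by rewrite lt_neqAle eq_sym p_neq0.
have p_lt1 : 0 < 1 - p by rewrite subr_gt0 lt_neqAle p_neq1.
have := @conjugate_powR _ (y `^ p) 1 p^-1 (1 - p)^-1 (powR_ge0 _ _) ler01.
rewrite !invr_gt0 !invrK [p + _]addrC subrK => /(_ p_gt0 p_lt1 erefl).
rewrite -powRrM divff// powRr1// powR1 mulr1; lra.
Qed.

Lemma powR_sub1_le p y : 0 <= p <= 1 -> 0 <= y -> `|y `^ p - 1| <= `|y - 1|.
Proof.
move=> /andP[p0 p1] y0; have [y1|/ltW y1] := leP 1 y.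
  have h1 : 1 <= y `^ p by rewrite -(powRr0 y) ler_powR.
  have h2 : y `^ p <= y by exact: ler1_powR.
  by rewrite !ger0_norm ?subr_ge0// lerD2r.
move: y0; rewrite le_eqVlt => /predU1P[<-|y0].
  have [->|pn0] := eqVneq p 0; first by rewrite powRr0 subrr normr0.
  by rewrite powR0.
have h1 : y `^ p <= 1 by rewrite -(powRr0 y) ger_powR// y0.
have h2 : y <= y `^ p by apply: ger1_powR => //; rewrite y0.
by rewrite !ler0_norm ?subr_le0// !opprB lerD2l lerN2.
Qed.

(** The upper half is the tangent inequality for [p]. The lower half follows from the
one for [1 - p], since the two powers multiply to [y]. *)
Lemma powR_tangent_error p y : 0 <= p <= 1 -> 0 <= y ->
  `|y `^ p - (1 + p * (y - 1))| <= (y - 1) ^+ 2.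
Proof.
move=> p01 y0; have /andP[p0 p1] := p01.
rewrite ler0_norm ?subr_le0 ?powR_tangent// opprB.
move: y0; rewrite le_eqVlt => /predU1P[<-|y0].
  by have := powR_ge0 0 p; nra.
have r01 : 0 <= 1 - p <= 1 by rewrite subr_ge0 p1 gerBl.
have hr := powR_tangent r01 (ltW y0).
have yr0 : 0 < y `^ (1 - p) by exact: powR_gt0.
have ypr : y `^ p * y `^ (1 - p) = y.
  by rewrite -powRD ?(gt_eqF y0) ?implybT// addrCA subrr addr0 powRr1// ltW.
set z := y `^ (1 - p) in hr yr0 ypr *; set w := y `^ p in ypr *.
have w0 : 0 <= w by exact: powR_ge0.
have sq : 0 <= p * (y - 1) ^+ 2 by rewrite mulr_ge0// sqr_ge0.
suff : y * (1 - (1 - p) * (y - 1)) <= w by lra.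
set E := 1 - (1 - p) * (y - 1).
have -> : y * E = w * (z * E) by rewrite mulrA ypr.
rewrite ler_piMr//.
have [h|h] := leP E 0; first by rewrite (le_trans (mulr_ge0_le0 (ltW yr0) h)).
apply: (le_trans (ler_wpM2r (ltW h) hr)).
by have := sqr_ge0 ((1 - p) * (y - 1)); rewrite /E; nra.
Qed.

End power_inequalities.

(** * The quantile function of the edge costs *)

Section quantile.
Context {R : realType} (rho : R -> R) (mu : probability (measurableTypeR R) R).
Local Notation leb := (@lebesgue_measure R).
Hypothesis rho_density : is_density rho.
Hypothesis muE : forall A : set R, measurable A ->
  (mu A = \int[leb]_(x in A `&` `[0%R, +oo[) (rho x)%:E)%E.

Let mrho : measurable_fun (`[0%R, +oo[%classic : set R) rho. Proof. by case: rho_density. Qed.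
Let rho0 x : 0 <= x -> 0 <= rho x. Proof. by case: rho_density => _ + _; exact. Qed.
Let rho1 : (\int[leb]_(x in (`[0%R, +oo[%classic : set R)) (rho x)%:E = 1)%E.
Proof. by case: rho_density. Qed.

Lemma density_atomless s : mu [set s] = 0%E.
Proof.
rewrite muE; last exact: measurable_set1.
by rewrite (@integral_Sset1 _ _ _ s)//; exact: subIsetl.
Qed.

Lemma density_positive : mu (`]0%R, +oo[%classic : set R) = 1%E.
Proof.
rewrite muE; last exact: measurable_itv.
rewrite setIidl; last by move=> x/=; rewrite !in_itv/= !andbT => /ltW.
rewrite integral_itv_obnd_cbnd//.
apply/measurable_EFinP; apply: (measurable_funS _ _ mrho) => //.
by move=> x/=; rewrite !in_itv/= !andbT => /ltW.
Qed.

Let tail_le x y : x <= y -> tail mu y <= tail mu x.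
Proof. exact: tail_nonincreasing. Qed.

Lemma tail_le0 z : z <= 0 -> tail mu z = 1.
Proof.
move=> z0; apply/eqP; rewrite eq_le; apply/andP; split.
  by rewrite -lee_fin fineK ?probability_le1 ?fin_num_measure//; exact: measurable_itv.
by rewrite (le_trans _ (tail_le z0))// /tail density_positive.
Qed.

Let irho z : leb.-integrable `[0, z] (EFin \o rho).
Proof.
have sub : `[0, z]%classic `<=` (`[0, +oo[%classic : set R) by exact: subset_itvl.
apply/integrableP; split.
  by apply/measurable_EFinP; exact: (measurable_funS _ sub mrho).
apply: (@le_lt_trans _ _ 1%E); last exact: ltry.
rewrite -rho1.
rewrite [leRHS](_ : _ = \int[leb]_(x in `[0%R, +oo[) `|(EFin \o rho) x|)%E; last first.
  by apply: eq_integral => x; rewrite inE/= in_itv/= andbT => x0; rewrite ger0_norm// rho0.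
apply: ge0_subset_integral => //.
by apply: measurableT_comp => //; exact/measurable_EFinP.
Qed.

Lemma tail_density z : 0 <= z -> tail mu z = 1 - \int[leb]_(x in `[0, z]) rho x.
Proof.
move=> z0; rewrite /tail muE; last exact: measurable_itv.
rewrite setIidl; last by move=> x/=; rewrite !in_itv/= !andbT => /ltW; exact: le_trans.
have mz : measurable_fun `]z, +oo[ (EFin \o rho).
  apply/measurable_EFinP; apply: (measurable_funS _ _ mrho) => //.
  by move=> x/=; rewrite !in_itv/= !andbT => /ltW; exact: le_trans.
have := rho1.
have -> : (`[0%R, +oo[%classic : set R) = `[0, z]%classic `|` `]z, +oo[%classic.
  apply/seteqP; split => x/=; rewrite !in_itv/= !andbT.
    by move=> x0; case: (leP x z) => xz; [left|right]; rewrite ?x0.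
  by move=> [/andP[]//|/ltW]; exact: le_trans.
rewrite ge0_integral_setU//=; last 3 first.
- apply/measurable_EFinP; apply: (measurable_funS _ _ mrho) => //.
  move=> x/= []; rewrite !in_itv/= !andbT; first by case/andP.
  by move=> /ltW; exact: le_trans.
- move=> x [] /=; rewrite in_itv/= ?andbT lee_fin; first by case/andP=> x0 _; exact: rho0.
  by move=> zx; apply: rho0; rewrite (le_trans z0)// ltW.
- by apply/disj_setPS => x /= []; rewrite !in_itv/= andbT => /andP[_ h1]; rewrite ltNge h1.
have h1 : (\int[leb]_(x in `[0%R, z]) (rho x)%:E)%E \is a fin_num.
  by apply: integrable_fin_num; [exact: measurable_itv|exact: irho].
rewrite -[X in (X + _)%E]fineK// => /(congr1 (fun x =>
  x - (fine (\int[leb]_(x in `[0, z]) (rho x)%:E))%:E)%E).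
by rewrite [X in (X - _)%E]addeC addeK// => ->.
Qed.

Lemma continuous_tail z : 0 <= z -> {within `[0, z], continuous (tail mu)}.
Proof.
move=> z0.
have c := parameterized_integral_continuous z0 (irho z).
have : {within `[0, z], continuous (fun x => 1 - parameterized_integral leb 0 x rho)}.
  by move=> x; apply: cvgB; [exact: cvg_cst|exact: c].
apply: subspace_eq_continuous => x; rewrite inE/= in_itv/= => /andP[x0 _].
by rewrite /from_subspace/= tail_density.
Qed.

Lemma tail_cvg0 e : 0 < e -> exists2 z, 0 <= z & tail mu z < e.
Proof.
move=> e0.
have mid : measurable_fun setT (idfun : measurableTypeR R -> R) by exact: measurable_id.
pose X : {RV mu >-> R} := HB.pack (idfun : measurableTypeR R -> R)
  (isMeasurableFun.Build _ _ _ _ (idfun : measurableTypeR R -> R) mid).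
have := @cvg_ccdfy0 _ _ _ mu X.
move=> /fine_cvgP[_] /cvgrPdist_lt/(_ _ e0)[M [_ hM]].
pose z := Num.max 0 (M + 1).
exists z; first by rewrite le_max lexx.
have /hM/= : M < z by rewrite lt_max ltrDl ltr01 orbT.
by rewrite sub0r normrN; apply: le_lt_trans; rewrite /ccdf /= /distribution/=; exact: ler_norm.
Qed.

Lemma quantile_subproof u : 0 < u -> exists z, (0 < z) && (tail mu z == expR (- u)).
Proof.
move=> u0; have [M M0 tM] := tail_cvg0 (expR_gt0 (- u)).
have eu1 : expR (- u) < 1 by rewrite expR_lt1 oppr_lt0.
have [] := @IVT _ (tail mu) 0 M (expR (- u)) M0 (continuous_tail M0).
  by rewrite ge_min le_max (ltW tM) orbT (tail_le0 (lexx 0)) (ltW eu1).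
move=> z; rewrite in_itv/= => /andP[z0 _] tz; exists z; rewrite tz eqxx andbT.
rewrite lt_neqAle z0 andbT; apply: contraTneq eu1 => z00.
by rewrite -tz -z00 tail_le0// ltxx.
Qed.

(** Any cost with the prescribed tail: the distribution function is continuous but may
be constant on intervals, so there may be several. The value 0 for nonpositive [u]
makes the function nondecreasing on the whole line. *)
Definition quantile (u : R) : R :=
  if pselect (0 < u) is left u0 then xchoose (quantile_subproof u0) else 0.

Lemma quantile_le0 u : u <= 0 -> quantile u = 0.
Proof. by rewrite /quantile; case: pselect => // u0; rewrite leNgt u0. Qed.

Lemma tail_quantile u : 0 <= u -> tail mu (quantile u) = expR (- u).
Proof.
rewrite le_eqVlt => /predU1P[<-|u0]; first by rewrite quantile_le0// tail_le0// oppr0 expR0.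
rewrite /quantile; case: pselect => // h.
by have /andP[_ /eqP] := xchooseP (quantile_subproof h).
Qed.

Lemma quantile_ge0 u : 0 <= quantile u.
Proof.
rewrite /quantile; case: pselect => // h.
by have /andP[/ltW] := xchooseP (quantile_subproof h).
Qed.

Lemma quantile_incr u v : 0 <= u -> u < v -> quantile u < quantile v.
Proof.
move=> u0 uv; rewrite ltNge; apply/negP => /tail_le.
rewrite !tail_quantile//; last by rewrite (le_trans u0)// ltW.
by rewrite ler_expR lerN2 leNgt uv.
Qed.

Lemma quantile_nd : {homo quantile : u v / u <= v}.
Proof.
move=> u v; rewrite le_eqVlt => /predU1P[->//|uv].
have [u0|u0] := leP u 0; first by rewrite (quantile_le0 u0) quantile_ge0.
by apply/ltW/quantile_incr => //; exact: ltW.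
Qed.

Lemma measurable_quantile : measurable_fun setT quantile.
Proof. by apply: nondecreasing_measurable => // u v; exact: quantile_nd. Qed.

(** It is enough to compare the masses of the rays. If [tail x = exp (- u0)], then
[quantile u > x] for [u > u0] and fails for [u < u0]; the point [u0] has mass 0. *)
Lemma quantile_law (A : set (measurableTypeR R)) : measurable A -> mu A = expo R (quantile @^-1` A).
Proof.
have mq : measurable_fun setT (quantile : measurableTypeR R -> measurableTypeR R).
  exact: measurable_quantile.
pose m2 := measure_function_pushforward__canonical__measure_function_Measure (expo R) mq.
apply: (@eq_measure_rays R mu m2) => [x|x]; last first.
  by rewrite (le_lt_trans (probability_le1 _ _)) ?ltry//; exact: measurable_itv.
rewrite /m2/= /pushforward.
have [x0|x0] := ltP x 0.
  have -> : quantile @^-1` `]x, +oo[ = setT.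
    by apply/seteqP; split => // u _ /=; rewrite in_itv/= andbT (lt_le_trans x0)// quantile_ge0.
  transitivity (1%E : \bar R); last by apply/esym; exact: probability_setT.
  apply/eqP; rewrite eq_le probability_le1/=; last exact: measurable_itv.
  rewrite -density_positive; apply: le_measure; rewrite ?inE; try exact: measurable_itv.
  by move=> y/=; rewrite !in_itv/= !andbT; apply: lt_trans.
have tE : mu `]x, +oo[%classic = (tail mu x)%:E.
  by rewrite /tail fineK// fin_num_measure//; exact: measurable_itv.
rewrite tE.
have := tail_ge0 mu x; rewrite le_eqVlt => /predU1P[t0|t0].
  have -> : quantile @^-1` `]x, +oo[ = set0.
    apply/seteqP; split => // u /=; rewrite in_itv/= andbT => xu.
    have [u0|u0] := leP u 0; first by move: xu; rewrite quantile_le0// ltNge x0.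
    have := tail_le (ltW xu); rewrite (tail_quantile (ltW u0)) -t0.
    by rewrite leNgt expR_gt0.
  by rewrite -t0; apply/esym; exact: measure0.
pose u0 := - ln (tail mu x).
have eu0 : expR (- u0) = tail mu x by rewrite opprK lnK.
have t1 : tail mu x <= 1.
  by rewrite -lee_fin -tE probability_le1//; exact: measurable_itv.
have u00 : 0 <= u0 by rewrite oppr_ge0 ln_le0.
have mray y : measurable (`]y, +oo[%classic : set (measurableTypeR R)) by exact: measurable_itv.
have mpre : measurable (quantile @^-1` `]x, +oo[%classic : set (measurableTypeR R)).
  by rewrite -[X in measurable X]setTI; apply: measurable_quantile.
rewrite -eu0; apply/eqP; rewrite eq_le; apply/andP; split.
  rewrite -(expo_ray u00); apply: le_measure; rewrite ?inE// => u /=.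
  rewrite !in_itv/= !andbT => uu; rewrite ltNge; apply/negP => /tail_le.
  rewrite (tail_quantile (le_trans u00 (ltW uu))) -eu0.
  by rewrite ler_expR lerN2 leNgt uu.
have atom : expo R [set u0] = 0%E by exact: integral_set1.
apply: (@le_trans _ _ (expo R (`]u0, +oo[%classic `|` [set u0]))).
  apply: le_measure; rewrite ?inE//; first by apply: measurableU => //; exact: measurable_set1.
  move=> u /=; rewrite !in_itv/= !andbT => xu.
  have u_ge0 : 0 <= u by rewrite leNgt; apply/negP => /ltW/quantile_le0 uE;
    rewrite uE ltNge x0 in xu.
  have := tail_le (ltW xu); rewrite (tail_quantile u_ge0) -eu0 ler_expR lerN2 le_eqVlt.
  by move=> /predU1P[->|]; [right|left].
have mset1 : measurable ([set u0] : set (measurableTypeR R)) by exact: measurable_set1.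
apply: (@le_trans _ _ (expo R (`]u0, +oo[%classic : set R) + expo R [set u0])%E).
  exact: measureU2.
by rewrite expo_ray// atom adde0.
Qed.

(** On the support, [x ^ 4 <= 1 + x ^ r]. *)
Lemma quantile_moment (r : R) : 4 < r ->
  (\int[leb]_(x in `[0%R, +oo[) (x `^ r * rho x)%:E < +oo)%E ->
  (\int[expo R]_u (quantile u ^+ 4)%:E < +oo)%E.
Proof.
move=> r4 hr.
have mq : measurable_fun setT (quantile : measurableTypeR R -> measurableTypeR R).
  exact: measurable_quantile.
have mr : measurable_fun (`[0%R, +oo[%classic : set R) (fun x => (x `^ r * rho x)%:E).
  apply/measurable_EFinP; apply: measurable_funM => //.
  by apply: measurable_funTS; exact: measurable_powR.
have -> : (\int[expo R]_u (quantile u ^+ 4)%:E = \int[mu]_x (x ^+ 4)%:E)%E.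
  rewrite [RHS](eq_measure_integral
    (measure_function_pushforward__canonical__measure_function_Measure (expo R) mq)).
    rewrite ge0_integral_pushforward//.
    - by apply/measurable_EFinP; exact: exprn_measurable.
    - by move=> x _; rewrite lee_fin exprn_even_ge0.
  by move=> A mA _; exact: quantile_law.
rewrite (@ge0_integral_density _ _ _ _ leb `[0%R, +oo[%classic rho)//; last 2 first.
- by apply/measurable_EFinP; exact: exprn_measurable.
- by move=> x; rewrite lee_fin exprn_even_ge0.
apply: (@le_lt_trans _ _ (\int[leb]_(x in `[0%R, +oo[) ((rho x)%:E + (x `^ r * rho x)%:E))%E).
  apply: ge0_le_integral => //.
  - move=> x; rewrite /= in_itv/= andbT => x0.
    by rewrite -EFinM lee_fin mulr_ge0 ?rho0// exprn_even_ge0.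
  - apply: emeasurable_funM; last exact/measurable_EFinP.
    by apply: measurable_funTS; apply/measurable_EFinP; exact: exprn_measurable.
  - by apply: emeasurable_funD => //; exact/measurable_EFinP.
  - move=> x; rewrite /= in_itv/= andbT => x0.
    rewrite -EFinM -EFinD lee_fin -[X in _ <= X + _]mul1r -mulrDl ler_wpM2r ?rho0//.
    have [x1|/ltW x1] := leP x 1.
      by rewrite ler_wpDr ?powR_ge0// exprn_ile1.
    by rewrite ler_wpDl// -powR_mulrn// ler_powR// ltW.
rewrite ge0_integralD//; last 3 first.
- by move=> x; rewrite /= in_itv/= andbT => x0; rewrite lee_fin rho0.
- exact/measurable_EFinP.
- by move=> x; rewrite /= in_itv/= andbT => x0; rewrite lee_fin mulr_ge0 ?rho0// powR_ge0.
  by rewrite rho1 lte_add_pinfty// ltry.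
by move=> x; rewrite /= in_itv/= andbT; exact: rho0.
Qed.

(** Write [z = quantile u] and [F] for the distribution function. Then
[F z = 1 - exp (- u) = u + O(u ^ 2)] and [F z = z ^ d + O(z ^ (d + zeta))], hence
[z ^ d = u + O(u ^ (1 + zeta / d)) + O(u ^ 2)]; taking the root of order [d] does not
increase the relative error. *)
Lemma quantile_near0 (d zeta a : R) : 1 <= d -> 0 < zeta ->
  (fun z : R => (\int[leb]_(x in `[0, z]) rho x) - z `^ d)
      =O_ (0^'+) (fun z : R => z `^ (d + zeta)) ->
  a <= d^-1 + zeta / d -> a <= d^-1 + 1 ->
  exists K u0, [/\ 0 < K, 0 < u0 &
    forall u, 0 < u <= u0 -> `|quantile u - u `^ d^-1| <= K * u `^ a].
Proof.
move=> d1 z0 /eqO_exP[K [K0 hK]] ha1 ha2.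
have d0 : 0 < d by rewrite (lt_le_trans ltr01).
have [delta [delta0 hd]] : exists delta, 0 < delta /\ forall z, 0 < z < delta ->
    `|(\int[leb]_(x in `[0, z]) rho x) - z `^ d| <= K * z `^ (d + zeta).
  case: hK => e /= e0 he; exists e; split => // z /andP[z0' ze].
  have := he z; rewrite /ball_/= sub0r normrN gtr0_norm// => /(_ ze z0').
  by rewrite [X in _ <= _ * X]ger0_norm// powR_ge0.
(* below [z0'] the distribution function is within a factor 2 of the power *)
pose z0' := Num.min (delta / 2) ((2 * K)^-1 `^ zeta^-1).
have z0'0 : 0 < z0' by rewrite lt_min divr_gt0// powR_gt0// invr_gt0 mulr_gt0.
have z0'd : z0' < delta.
  by rewrite (le_lt_trans (_ : _ <= delta / 2)) ?ge_min ?lexx// ltr_pdivrMr//; lra.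
have Kz z : 0 < z -> z <= z0' -> K * z `^ zeta <= 1 / 2.
  move=> z_gt0 zz; rewrite -ler_pdivlMl//.
  rewrite (@le_trans _ _ (((2 * K)^-1 `^ zeta^-1) `^ zeta))//.
    apply: ge0_ler_powR; rewrite ?nnegrE ?powR_ge0//; try exact: ltW.
    by rewrite (le_trans zz)// ge_min lexx orbT.
  rewrite -powRrM mulVf ?gt_eqF// powRr1 ?invr_ge0 ?mulr_ge0 ?(ltW K0)//.
  by rewrite invfM mulrC mul1r.
pose F z := \int[leb]_(x in `[0, z]) rho x.
have FD z : 0 < z -> z <= z0' ->
    `|F z - z `^ d| <= K * (z `^ d * z `^ zeta) /\ K * (z `^ d * z `^ zeta) <= z `^ d / 2.
  move=> z_gt0 zz; split.
    rewrite -powRD ?(gt_eqF z_gt0) ?implybT//; apply: hd.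
    by rewrite z_gt0 (le_lt_trans zz).
  rewrite mulrCA ler_wpM2l ?powR_ge0//.
  by rewrite -[leRHS]mul1r; exact: Kz.
pose u0 := Num.min 1 (z0' `^ d / 4).
have zd0 : 0 < z0' `^ d by exact: powR_gt0.
pose K' := 2 * K * 2 `^ (zeta / d) + 1.
have K'0 : 0 < K' by rewrite ltr_wpDl// !mulr_ge0 ?powR_ge0 ?(ltW K0).
exists K', u0; split => //.
  by rewrite lt_min ltr01 divr_gt0.
move=> u /andP[u_gt0]; rewrite le_min => /andP[u1 uz].
set z := quantile u.
have z_gt0 : 0 < z by rewrite -(quantile_le0 (lexx 0)); exact: quantile_incr.
have tz : tail mu z = 1 - F z by rewrite tail_density// ltW.
have eF : expR (- u) = 1 - F z by rewrite -tz tail_quantile// ltW.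
have e1 := expR_ge1Dx (- u).
have zz : z <= z0'.
  rewrite leNgt; apply/negP => /ltW/tail_le; rewrite tz tail_density ?(ltW z0'0)//.
  have [] := FD _ z0'0 (lexx _); rewrite /F => /(le_trans) h/h{h}.
  rewrite ler_norml => /andP[h1 _] h2; move: h1 h2 zd0 uz e1 eF; rewrite /F; lra.
have [hF1 hF2] := FD _ z_gt0 zz.
have hF3 := le_trans hF1 hF2.
have D2u : z `^ d <= 2 * u by move: hF3 e1 eF; rewrite ler_norml => /andP[]; lra.
have zzeta : z `^ zeta <= 2 `^ (zeta / d) * u `^ (a - d^-1).
  have -> : z `^ zeta = (z `^ d) `^ (zeta / d).
    by rewrite -powRrM mulrCA divff ?gt_eqF// mulr1.
  rewrite (@le_trans _ _ ((2 * u) `^ (zeta / d)))//.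
    apply: ge0_ler_powR; rewrite ?nnegrE ?powR_ge0 ?divr_ge0 ?mulr_ge0//; exact: ltW.
  rewrite powRM ?(ltW u_gt0)// ler_wpM2l ?powR_ge0// ger_powR ?u_gt0//; lra.
have u2 : u <= u `^ (a - d^-1).
  by rewrite -{1}(powRr1 (ltW u_gt0)) ger_powR ?u_gt0//; lra.
have Du : `|z `^ d - u| <= K' * (u * u `^ (a - d^-1)).
  have -> : z `^ d - u = - (F z - z `^ d) + (F z - u) by ring.
  apply: (le_trans (ler_normD _ _)); rewrite normrN mulrDl mul1r; apply: lerD.
    apply: (le_trans hF1).
    have -> : 2 * K * 2 `^ (zeta / d) * (u * u `^ (a - d^-1)) =
      K * ((2 * u) * (2 `^ (zeta / d) * u `^ (a - d^-1))) by ring.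
    by rewrite ler_wpM2l ?(ltW K0)// ler_pM ?powR_ge0.
  have -> : F z = 1 - expR (- u) by lra.
  rewrite (@le_trans _ _ (u * u))//; last by rewrite ler_wpM2l// ltW.
  rewrite ler0_norm; last by lra.
  have : expR (- u) * (1 + u) <= 1.
    by have := ler_wpM2l (expR_ge0 (- u)) (expR_ge1Dx u); rewrite -expRD addNr expR0.
  by have := expR_gt0 (- u); nra.
have -> : z = (z `^ d) `^ d^-1 by rewrite -powRrM divff ?gt_eqF// powRr1// ltW.
have -> : z `^ d = u * (z `^ d / u) by rewrite mulrCA divff ?gt_eqF// mulr1.
have q0 : 0 <= z `^ d / u by rewrite divr_ge0 ?powR_ge0// ltW.
have -> : (u * (z `^ d / u)) `^ d^-1 - u `^ d^-1 = u `^ d^-1 * ((z `^ d / u) `^ d^-1 - 1).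
  by rewrite [X in X - _]powRM ?(ltW u_gt0)//; ring.
rewrite normrM ger0_norm ?powR_ge0//.
have p01 : 0 <= d^-1 <= 1 by rewrite invr_ge0 (ltW d0) invf_le1.
apply: (le_trans (ler_wpM2l (powR_ge0 _ _) (powR_sub1_le p01 q0))).
have -> : z `^ d / u - 1 = (z `^ d - u) / u by rewrite mulrBl divff// gt_eqF.
rewrite normrM [X in _ * (_ * X)]gtr0_norm ?invr_gt0//.
have -> : u `^ a = u `^ d^-1 * u `^ (a - d^-1).
  by rewrite -powRD ?(gt_eqF u_gt0) ?implybT// addrCA subrr addr0.
rewrite [leRHS]mulrCA ler_wpM2l ?powR_ge0// ler_pdivrMr// -mulrA [_ * u]mulrC.
exact: Du.
Qed.

End quantile.

(** * Gaussian smoothing, one exponential variable at a time *)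

Section gaussian_step.
Context {R : realType}.
Local Notation Q := (expo R).

Lemma derivative_bound (g dg : R -> R) (h M : R) :
  (forall t, is_derive t (1:R) g (dg t)) -> g 0 = 0 ->
  (forall t, `|t| <= `|h| -> `|dg t| <= M) -> `|g h| <= M * `|h|.
Proof.
move=> dgP g0 dgM.
have cg x : {for x, continuous g}.
  by apply: differentiable_continuous; apply/derivable1_diffP; have [] := dgP x.
have [h0|h0|->] := ltgtP h 0; last by rewrite g0 !normr0 mulr0.
- have [c] := MVT_segment (ltW h0) (fun x _ => dgP x) (continuous_subspaceT cg).
  rewrite in_itv/= => /andP[hc c0]; rewrite g0 sub0r => gh.
  rewrite -normrN gh sub0r normrM normrN ler_wpM2r// dgM//.
  by rewrite !ler0_norm ?lerN2// ltW.
- have [c] := MVT_segment (ltW h0) (fun x _ => dgP x) (continuous_subspaceT cg).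
  rewrite in_itv/= => /andP[c0 ch]; rewrite g0 !subr0 => gh.
  rewrite gh normrM ler_wpM2r// dgM//.
  by rewrite !ger0_norm// ltW.
Qed.

(** Three successive applications of the mean value inequality, which lose the
factor [1 / 6] of an exact remainder. *)
Lemma taylor3 (f f1 f2 f3 : R -> R) (M y h : R) :
  (forall t, is_derive t (1:R) f (f1 t)) -> (forall t, is_derive t (1:R) f1 (f2 t)) ->
  (forall t, is_derive t (1:R) f2 (f3 t)) -> (forall t, `|f3 t| <= M) ->
  `|f (y + h) - (f y + h * f1 y + h ^+ 2 / 2 * f2 y)| <= M * `|h| ^+ 3.
Proof.
move=> d1 d2 d3 M3.
have shift (u du : R -> R) t : (forall t, is_derive t (1:R) u (du t)) ->
    is_derive t (1:R) (fun t => u (y + t)) (du (y + t)).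
  move=> hu; have hut := hu (y + t).
  have hs : is_derive t (1:R) (fun t : R => y + t) 1.
    by apply: (is_derive_eq (is_deriveD (is_derive_cst y t 1) (is_derive_id t 1))); rewrite add0r.
  have hc := is_derive1_comp hut hs.
  by apply: (is_derive_eq hc); rewrite mulr1.
have b2 t : `|f2 (y + t) - f2 y| <= M * `|t|.
  apply: (@derivative_bound (fun t => f2 (y + t) - f2 y) (fun t => f3 (y + t))).
  - by move=> s; have hs := shift _ _ s d3; apply: is_derive_eq; rewrite subr0.
  - by rewrite addr0 subrr.
  - by move=> s _; exact: M3.
have M0 : 0 <= M by apply: le_trans (M3 0).
have b1 t : `|f1 (y + t) - f1 y - t * f2 y| <= M * `|t| * `|t|.
  apply: (@derivative_bound (fun t => f1 (y + t) - f1 y - t * f2 y)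
    (fun t => f2 (y + t) - f2 y)).
  - move=> s; have hs := shift _ _ s d2; apply: is_derive_eq.
    by rewrite /GRing.scale/=; ring.
  - by rewrite addr0 subrr mul0r subr0.
  - by move=> s st; rewrite (le_trans (b2 s))// ler_wpM2l.
have : `|f (y + h) - (f y + h * f1 y + h ^+ 2 / 2 * f2 y)| <= (M * `|h| * `|h|) * `|h|.
  apply: (@derivative_bound (fun h => f (y + h) - (f y + h * f1 y + h ^+ 2 / 2 * f2 y))
    (fun t => f1 (y + t) - f1 y - t * f2 y)).
  - move=> s; have hs := shift _ _ s d1; apply: is_derive_eq.
    by rewrite /GRing.scale/=; field.
  - by rewrite addr0; ring.
  - move=> s st; rewrite (le_trans (b1 s))// -!mulrA ler_wpM2l// ler_pM//.
by move=> /le_trans; apply; rewrite !exprS expr0 mulr1 -!mulrA.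
Qed.

(** The unnormalised standard Gaussian density. *)
Definition psi (y : R) := expR (- (y ^+ 2 / 2)).

Lemma psi_ge0 y : 0 <= psi y. Proof. exact: expR_ge0. Qed.

Lemma psi_is_derive y : is_derive y (1:R) psi (- y * psi y).
Proof. by rewrite /psi; apply: is_derive_eq; rewrite /GRing.scale/=; field. Qed.

Lemma psi_decay y : (1 + y ^+ 4 / 8) * psi y <= 1.
Proof.
have h : 0 <= y ^+ 2 / 2 by rewrite divr_ge0// sqr_ge0.
have := expR_ge1Dxn 1 h; rewrite (_ : 2`! = 2)// => e.
have e' : 1 + y ^+ 4 / 8 <= expR (y ^+ 2 / 2).
  by apply: le_trans e; rewrite le_eqVlt; apply/orP; left; apply/eqP; field.
rewrite (le_trans (ler_wpM2r (psi_ge0 y) e'))//.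
by rewrite /psi -expRD subrr expR0.
Qed.

(** The third derivative of [psi] is [(3 y - y ^ 3) psi y], bounded by 32. *)
Lemma psi_taylor y h :
  `|psi (y + h) - psi y * (1 - y * h + (y ^+ 2 - 1) * h ^+ 2 / 2)| <= 32 * `|h| ^+ 3.
Proof.
have d1 := psi_is_derive.
have d2 t : is_derive t (1:R) (fun y => - y * psi y) ((t ^+ 2 - 1) * psi t).
  by have d := d1 t; apply: is_derive_eq; rewrite /GRing.scale/=; ring.
have d3 t : is_derive t (1:R) (fun y => (y ^+ 2 - 1) * psi y) ((3 * t - t ^+ 3) * psi t).
  by have d := d1 t; apply: is_derive_eq; rewrite /GRing.scale/=; ring.
have M3 t : `|(3 * t - t ^+ 3) * psi t| <= 32.
  rewrite normrM (ger0_norm (psi_ge0 t)).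
  have b : `|3 * t - t ^+ 3| <= 32 * (1 + t ^+ 4 / 8).
    have e2 := sqr_ge0 (t - 1); have e3 := sqr_ge0 (t + 1).
    have e4 := sqr_ge0 (t * (t - 1)); have e5 := sqr_ge0 (t * (t + 1)).
    by rewrite ler_norml; apply/andP; split; nra.
  rewrite (le_trans (ler_wpM2r (psi_ge0 t) b))// -mulrA -[leRHS]mulr1 ler_pM2l//.
  exact: psi_decay.
have := taylor3 y h d1 d2 d3 M3.
congr (`|_| <= _); ring.
Qed.

(** [A psi (y A)] is the Gaussian density of variance [1 + s], and [(y ^ 2 - 1) psi] is
the second derivative of [psi]: this is the first order expansion of the heat flow at
time [s]. *)
Lemma heat_expansion y s A : 0 <= s <= 1 / 2 -> A = (Num.sqrt (1 + s))^-1 ->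
  `|A * psi (y * A) - psi y * (1 + (y ^+ 2 - 1) * s / 2)| <= 32 * s ^+ 2.
Proof.
move=> /andP[s0 s1] AE.
have A0 : 0 < A by rewrite AE invr_gt0 sqrtr_gt0; lra.
have A2 : A ^+ 2 * (1 + s) = 1.
  have s1' : 0 < 1 + s by lra.
  by rewrite AE exprVn sqr_sqrtr ?mulVf ?gt_eqF// ltW.
have A1 : A <= 1 by rewrite leNgt; apply/negP => h; nra.
have A21 : A ^+ 2 <= 1 by nra.
have Alb : 1 - s / 2 <= A.
  rewrite leNgt; apply/negP => h.
  have h2 : A ^+ 2 < (1 - s / 2) ^+ 2 by rewrite ltr_pXn2r// nnegrE; lra.
  have : (1 - s / 2) ^+ 2 * (1 + s) <= 1 by nra.
  by nra.
have Aub : A <= 1 - s / 2 + s ^+ 2.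
  rewrite leNgt; apply/negP => h.
  have h2 : (1 - s / 2 + s ^+ 2) ^+ 2 < A ^+ 2 by rewrite ltr_pXn2r// nnegrE; nra.
  have : 1 <= (1 - s / 2 + s ^+ 2) ^+ 2 * (1 + s).
    have : 0 <= s ^+ 2 * (5 / 4 + 5 / 4 * s + s ^+ 2 * s).
      by rewrite mulr_ge0 ?sqr_ge0// addr_ge0 ?mulr_ge0 ?sqr_ge0//; lra.
    rewrite -subr_ge0 => h3; rewrite -subr_ge0; apply: (le_trans h3).
    rewrite le_eqVlt; apply/orP; left; apply/eqP.
    by field.
  by nra.
(* [psi (y A) = psi y * exp x], with [x] close to [y ^ 2 s / 2] *)
pose x := y ^+ 2 * s * A ^+ 2 / 2.
have y2 := sqr_ge0 y.
have A20 := sqr_ge0 A.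
have x0 : 0 <= x by apply: divr_ge0 => //; apply: mulr_ge0 => //; exact: mulr_ge0.
have psiA : psi (y * A) = psi y * expR x.
  rewrite /psi -expRD; congr expR; rewrite /x.
  have -> : (y * A) ^+ 2 = y ^+ 2 * A ^+ 2 by rewrite exprMn.
  have A2s : A ^+ 2 = 1 - A ^+ 2 * s by rewrite -A2; ring.
  rewrite [in LHS]A2s.
  by field.
have xE : y ^+ 2 * s / 2 - x = y ^+ 2 * s / 2 * (A ^+ 2 * s).
  have A2s : A ^+ 2 * s = 1 - A ^+ 2 by move: A2; rewrite mulrDr mulr1; lra.
  by rewrite A2s /x; field.
clearbody x.
have ys0 : 0 <= y ^+ 2 * s by rewrite mulr_ge0//.
have xs : 0 <= y ^+ 2 * s / 2 - x by rewrite xE; apply: mulr_ge0; [exact: divr_ge0|exact: mulr_ge0].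
have xs2 : y ^+ 2 * s / 2 - x <= y ^+ 2 * s ^+ 2 / 2.
  rewrite xE [leRHS](_ : _ = y ^+ 2 * s / 2 * s); last by field.
  by rewrite ler_wpM2l ?divr_ge0// -[leRHS]mul1r ler_wpM2r.
have x4 : x <= y ^+ 2 / 4 by nra.
have x2 : x ^+ 2 <= y ^+ 4 * s ^+ 2 / 4.
  rewrite [leRHS](_ : _ = (y ^+ 2 * s / 2) ^+ 2); last by field.
  by rewrite ler_pXn2r ?nnegrE//; lra.
have e1 : 1 + x <= expR x by exact: expR_ge1Dx.
have E0 := expR_ge0 x.
have e2 : expR x - 1 - x <= x ^+ 2 * expR x.
  have : expR x * (1 - x) <= 1.
    by have := ler_wpM2l (expR_ge0 x) (expR_ge1Dx (- x)); rewrite -expRD subrr expR0.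
  move=> h; have x1 : 0 <= 1 + x by lra.
  have := ler_wpM2l x1 h; rewrite mulr1 => h2.
  by move: h2; rewrite (_ : (1 + x) * (expR x * (1 - x)) = expR x - x ^+ 2 * expR x); [lra|ring].
rewrite psiA mulrCA -mulrBr normrM (ger0_norm (psi_ge0 y)).
have key : `|A * expR x - (1 + (y ^+ 2 - 1) * s / 2)| <=
    s ^+ 2 * (1 + y ^+ 2 + y ^+ 4 / 4) * expR x.
  pose a := A - (1 - s / 2); pose b := expR x - 1 - x; pose c := y ^+ 2 * s / 2 - x.
  have -> : A * expR x - (1 + (y ^+ 2 - 1) * s / 2) =
      a * expR x + (1 - s / 2) * b - ((1 - s / 2) * c + y ^+ 2 * s ^+ 2 / 4).
    by rewrite /a /b /c; field.
  have aE : 0 <= a * expR x <= s ^+ 2 * expR x.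
    by rewrite mulr_ge0//= ?ler_wpM2r// /a; lra.
  have bE : 0 <= (1 - s / 2) * b <= s ^+ 2 * (y ^+ 4 / 4) * expR x.
    apply/andP; split; first by rewrite mulr_ge0// /b; lra.
    have b0 : 0 <= b by rewrite /b; lra.
    have : (1 - s / 2) * b <= b by nra.
    move=> /le_trans; apply; apply: (le_trans e2); rewrite ler_wpM2r//.
    by apply: (le_trans x2); rewrite le_eqVlt; apply/orP; left; apply/eqP; field.
  have cE : 0 <= (1 - s / 2) * c + y ^+ 2 * s ^+ 2 / 4 <= s ^+ 2 * y ^+ 2 * expR x.
    have y2s2 : 0 <= y ^+ 2 * s ^+ 2 by rewrite mulr_ge0 ?sqr_ge0//.
    apply/andP; split; first by rewrite addr_ge0 ?divr_ge0// mulr_ge0//; lra.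
    have : (1 - s / 2) * c <= c by rewrite /c; nra.
    have : y ^+ 2 * s ^+ 2 <= y ^+ 2 * s ^+ 2 * expR x.
      by rewrite -[leLHS]mulr1 ler_wpM2l//; lra.
    by rewrite -/c in xs2; lra.
  move: aE bE cE => /andP[? ?] /andP[? ?] /andP[? ?].
  by rewrite ler_norml; apply/andP; split; lra.
apply: (le_trans (ler_wpM2l (psi_ge0 y) key)).
have y40 : 0 <= y ^+ 2 / 4 by rewrite divr_ge0.
have := expR_ge1Dxn 1 y40; rewrite (_ : 2`! = 2)// => e.
have b : 1 + y ^+ 2 + y ^+ 4 / 4 <= 32 * expR (y ^+ 2 / 4).
  apply: (@le_trans _ _ (32 * (1 + (y ^+ 2 / 4) ^+ 2 / 2))); last by rewrite ler_pM2l.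
  rewrite [leRHS](_ : _ = 32 + y ^+ 4); last by field.
  have : y ^+ 4 = (y ^+ 2) ^+ 2 by ring.
  by move=> ->; nra.
have psix : psi y * expR x <= expR (- (y ^+ 2 / 4)).
  by rewrite /psi -expRD ler_expR; lra.
rewrite (mulrC _ (expR x)) mulrA.
have s20 := sqr_ge0 s.
have poly0 : 0 <= s ^+ 2 * (1 + y ^+ 2 + y ^+ 4 / 4).
  rewrite mulr_ge0// !addr_ge0// divr_ge0// (_ : y ^+ 4 = (y ^+ 2) ^+ 2) ?sqr_ge0//; ring.
apply: (le_trans (ler_wpM2r poly0 psix)).
have eE : expR (- (y ^+ 2 / 4)) * expR (y ^+ 2 / 4) = 1 by rewrite -expRD addNr expR0.
have := ler_wpM2l (mulr_ge0 (expR_ge0 (- (y ^+ 2 / 4))) s20) b.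
rewrite -mulrA => /le_trans; apply.
rewrite [leLHS](_ : _ = 32 * s ^+ 2 * (expR (- (y ^+ 2 / 4)) * expR (y ^+ 2 / 4))); last by ring.
by rewrite eE mulr1.
Qed.

Lemma measurable_psi : measurable_fun setT psi.
Proof.
apply: measurableT_comp => //; apply: measurableT_comp => //.
by apply: measurable_funM => //; exact: measurable_funX.
Qed.

Lemma psi_le1 y : psi y <= 1.
Proof. by rewrite -expR0 /psi ler_expR oppr_le0 divr_ge0// sqr_ge0. Qed.

(** A centred exponential variable has the mean and the variance of a standard Gaussian
one, so adding [b (e - 1)] or a Gaussian of variance [b ^ 2] has the same effect up to
the second order. *)
Lemma psi_step_lower (y b : R) A : b ^+ 2 <= 1 / 2 ->
  A = (Num.sqrt (1 + b ^+ 2))^-1 ->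
  ((A * psi (y * A))%:E <= \int[Q]_e (psi (y + b * (e - 1)))%:E + (192 * `|b| ^+ 3)%:E)%E.
Proof.
move=> b12 AE.
have b0 := normr_ge0 b.
have b2 : `|b| ^+ 2 <= 1 / 2 by rewrite -normrX ger0_norm ?sqr_ge0.
have b1 : `|b| <= 1 by rewrite leNgt; apply/negP => h; nra.
(* the Taylor polynomial of [psi (y + b (e - 1))], as a polynomial in [e] *)
pose c i := match i with 0 => psi y * (1 + y * b + (y ^+ 2 - 1) * b ^+ 2 / 2)
  | 1 => - psi y * (y * b + (y ^+ 2 - 1) * b ^+ 2) | _ => psi y * ((y ^+ 2 - 1) * b ^+ 2 / 2) end.
have [ic vc] := expo_poly 3 c.
(* [32 |b (e - 1)| ^ 3] is at most [16 |b| ^ 3 ((e - 1) ^ 2 + (e - 1) ^ 4)], expanded in [e];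
   its mean is [16 |b| ^ 3 (1 + 9)] *)
pose d (i : nat) : R := 16 * `|b| ^+ 3 *
  match i with 0 => 2 | 1 => -6 | 2 => 7 | 3 => -4 | _ => 1 end.
have [id vd] := expo_poly 5 d.
have ipsi : Q.-integrable setT (fun e => (psi (y + b * (e - 1)))%:E).
  apply: (@le_integrable _ _ _ _ _ _ _ (EFin \o cst 1)) => //.
  - apply/measurable_EFinP; apply: (measurableT_comp measurable_psi).
    by apply: measurable_funD => //; apply: measurable_funM => //; exact: measurable_funB.
  - move=> e _ /=; rewrite normr1 lee_fin ger0_norm ?psi_ge0//; exact: psi_le1.
  - exact: finite_measure_integrable_cst.
have h e : \sum_(i < 3) c i * e ^+ i <= psi (y + b * (e - 1)) + \sum_(i < 5) d i * e ^+ i.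
  have := psi_taylor y (b * (e - 1)); set T := psi y * _; rewrite ler_norml => /andP[+ _].
  have -> : \sum_(i < 3) c i * e ^+ i = T.
    by rewrite !big_ord_recl big_ord0 /= /T; field.
  have -> : \sum_(i < 5) d i * e ^+ i = 16 * `|b| ^+ 3 * ((e - 1) ^+ 2 + (e - 1) ^+ 4).
    by rewrite !big_ord_recl big_ord0 /= /d /bump/=; ring.
  have -> : `|b * (e - 1)| ^+ 3 = `|b| ^+ 3 * `|e - 1| ^+ 3 by rewrite normrM exprMn.
  have : `|b| ^+ 3 * `|e - 1| ^+ 3 <= `|b| ^+ 3 * (((e - 1) ^+ 2 + (e - 1) ^+ 4) / 2).
    rewrite ler_wpM2l ?exprn_ge0//.
    have -> : (e - 1) ^+ 2 = `|e - 1| ^+ 2 by rewrite -normrX ger0_norm ?sqr_ge0.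
    have -> : (e - 1) ^+ 4 = `|e - 1| ^+ 4.
      by rewrite -normrX ger0_norm// (exprM _ 2 2) sqr_ge0.
    by have := sqr_ge0 (`|e - 1| - `|e - 1| ^+ 2); lra.
  by lra.
have sumI : (\int[Q]_e (\sum_(i < 3) c i * e ^+ i)%:E <=
    \int[Q]_e (psi (y + b * (e - 1)))%:E + \int[Q]_e (\sum_(i < 5) d i * e ^+ i)%:E)%E.
  rewrite -integralD//; apply: le_integral => //; first exact: integrableD.
  by move=> e _; rewrite -EFinD lee_fin.
move: sumI; rewrite vc vd.
have -> : \sum_(i < 3) c i * i`!%:R = psi y * (1 + (y ^+ 2 - 1) * b ^+ 2 / 2).
  by rewrite !big_ord_recl big_ord0 /= /bump /= !factS fact0; field.
have -> : \sum_(i < 5) d i * i`!%:R = 160 * `|b| ^+ 3.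
  by rewrite !big_ord_recl big_ord0 /= /d /bump /= !factS fact0; ring.
have := @heat_expansion y (b ^+ 2) A; rewrite sqr_ge0 b12 => /(_ isT AE).
rewrite ler_norml => /andP[_ hh].
have b43 : (b ^+ 2) ^+ 2 <= `|b| ^+ 3.
  rewrite (_ : b ^+ 2 = `|b| ^+ 2); last by rewrite -normrX ger0_norm ?sqr_ge0.
  rewrite (_ : (`|b| ^+ 2) ^+ 2 = `|b| ^+ 3 * `|b|); last by ring.
  by rewrite ler_piMr// exprn_ge0.
have hA : A * psi (y * A) <= psi y * (1 + (y ^+ 2 - 1) * b ^+ 2 / 2) + 32 * `|b| ^+ 3 by lra.
move=> I; have : ((A * psi (y * A))%:E <= (psi y * (1 + (y ^+ 2 - 1) * b ^+ 2 / 2))%:E +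
  (32 * `|b| ^+ 3)%:E)%E.
  by rewrite -EFinD lee_fin.
move=> /le_trans; apply; apply: (le_trans (leeD I (lexx _))).
by rewrite -addeA -EFinD leeD2l// lee_fin; lra.
Qed.

(** The centred Gaussian density of standard deviation [r], up to the factor
[1 / sqrt (2 pi)]. *)
Definition bell (r x : R) := psi (x / r) / r.

Lemma bell_ge0 r x : 0 <= r -> 0 <= bell r x.
Proof. by move=> r0; rewrite divr_ge0// psi_ge0. Qed.

Lemma measurable_bell r : measurable_fun setT (bell r).
Proof.
apply: measurable_funM => //; apply: (measurableT_comp measurable_psi).
exact: measurable_funM.
Qed.

(** The previous comparison, rescaled by [r]. The error is uniform in [r >= delta]:
this is why a small Gaussian noise is put in before the first variable. *)
Lemma bell_step (delta r x a : R) : 0 < delta -> delta <= r -> a ^+ 2 <= delta ^+ 2 / 2 ->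
  ((bell (Num.sqrt (r ^+ 2 + a ^+ 2)) x)%:E <=
   \int[Q]_e (bell r (x + a * (e - 1)))%:E + (192 / delta ^+ 4 * `|a| ^+ 3)%:E)%E.
Proof.
move=> d0 dr a2; have r0 : 0 < r by apply: lt_le_trans dr.
have rne : r != 0 by rewrite gt_eqF.
have dr2 : delta ^+ 2 <= r ^+ 2 by rewrite ler_pXn2r// nnegrE ltW.
have bb : (a / r) ^+ 2 <= 1 / 2.
  rewrite expr_div_n ler_pdivrMr ?exprn_gt0//; lra.
have := psi_step_lower (x / r) bb erefl; set A := (Num.sqrt _)^-1.
have AE : A / r = (Num.sqrt (r ^+ 2 + a ^+ 2))^-1.
  have -> : r ^+ 2 + a ^+ 2 = (r ^+ 2) * (1 + (a / r) ^+ 2) by field.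
  by rewrite sqrtrM ?sqr_ge0// sqrtr_sqr (gtr0_norm r0) invfM mulrC.
have ri : (0 <= r^-1%:E)%E by rewrite lee_fin invr_ge0 ltW.
move=> /(lee_wpmul2l ri); rewrite muleDr//; last first.
  by rewrite ge0_adde_def// inE ?integral_ge0// => *; rewrite ?lee_fin ?psi_ge0 ?mulr_ge0.
rewrite -!EFinM -ge0_integralZl//; last 2 first.
- apply/measurable_EFinP; apply: (measurableT_comp measurable_psi).
  by apply: measurable_funD => //; apply: measurable_funM => //; exact: measurable_funB.
- by move=> e _; rewrite lee_fin psi_ge0.
have -> : r^-1 * (A * psi (x / r * A)) = bell (Num.sqrt (r ^+ 2 + a ^+ 2)) x.
  by rewrite /bell -AE -(mulrC A) mulrCA (mulrC (psi _)) mulrA; congr (_ * psi _); ring.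
move=> /le_trans; apply; apply: leeD.
  apply: ge0_le_integral => //.
  - by move=> e _; rewrite mule_ge0// lee_fin psi_ge0.
  - apply: emeasurable_funM => //; apply/measurable_EFinP; apply: (measurableT_comp measurable_psi).
    by apply: measurable_funD => //; apply: measurable_funM => //; exact: measurable_funB.
  - apply/measurable_EFinP; apply: (measurableT_comp (measurable_bell r)).
    by apply: measurable_funD => //; apply: measurable_funM => //; exact: measurable_funB.
  - by move=> e _; rewrite -EFinM lee_fin /bell mulrC (_ : x / r + _ = (x + a * (e - 1)) / r)//;
    field.
rewrite lee_fin normrM exprMn normfV (gtr0_norm r0).
rewrite (_ : r^-1 * _ = 192 * `|a| ^+ 3 * (r ^+ 4)^-1); last by field.
rewrite [leRHS]mulrAC ler_wpM2l ?mulr_ge0 ?exprn_ge0// lef_pV2 ?posrE ?exprn_gt0//.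
by rewrite ler_pXn2r// nnegrE ltW.
Qed.

(** The variances add up, and so do the errors of the single steps. *)
Lemma bell_clin (delta : R) (a : nat -> R) k x : 0 < delta ->
  (forall j, (1 <= j <= k)%N -> a j ^+ 2 <= delta ^+ 2 / 2) ->
  ((bell (Num.sqrt (delta ^+ 2 + \sum_(1 <= j < k.+1) a j ^+ 2)) x)%:E <=
   \int[omegaP k]_w (bell delta (x + clin a w))%:E +
   (192 / delta ^+ 4 * \sum_(1 <= j < k.+1) `|a j| ^+ 3)%:E)%E.
Proof.
move=> d0; have d0' := ltW d0.
have mb j y : measurable_fun setT (fun w : omega j => (bell delta (y + clin a w))%:E).
  apply/measurable_EFinP; apply: (measurableT_comp (measurable_bell delta)).
  by apply: measurable_funD => //; exact: measurable_clin.
have b0 j y (w : omega j) : (0 <= (bell delta (y + clin a w))%:E)%E by rewrite lee_fin bell_ge0.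
elim: k x => [|k IH] x small.
  by rewrite integral_omega0 clin0 !big_geq// mulr0 adde0 !addr0 sqrtr_sqr gtr0_norm.
have sm j : (1 <= j <= k)%N -> a j ^+ 2 <= delta ^+ 2 / 2.
  by move=> /andP[j1 jk]; apply: small; rewrite j1 ltnW.
set s := \sum_(1 <= j < k.+1) a j ^+ 2; set t := \sum_(1 <= j < k.+1) `|a j| ^+ 3.
rewrite !(big_nat_recr k.+1)//= -/s -/t.
have s0 : 0 <= s by apply: sumr_ge0 => j _; exact: sqr_ge0.
have t0 : 0 <= t by apply: sumr_ge0 => j _; exact: exprn_ge0.
set r := Num.sqrt (delta ^+ 2 + s) in IH *.
have r2 : r ^+ 2 = delta ^+ 2 + s by rewrite sqr_sqrtr// addr_ge0// sqr_ge0.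
have dr : delta <= r.
  rewrite -(ler_pXn2r (n:=2))// ?nnegrE ?sqrtr_ge0// r2; lra.
have K0 : 0 <= 192 / delta ^+ 4 by rewrite divr_ge0// exprn_ge0.
rewrite addrA -r2 mulrDr EFinD addeA.
apply: (le_trans (bell_step x d0 dr (small k.+1 _))); first by rewrite leqnn.
apply: leeD => //.
rewrite integral_omegaS//.
apply: (@le_trans _ _ (\int[Q]_e (\int[omegaP k]_w (bell delta (x + @clin _ a k.+1 (e, w)))%:E +
    (192 / delta ^+ 4 * t)%:E))%E).
  apply: ge0_le_integral => //.
  - by move=> e _; rewrite lee_fin bell_ge0// sqrtr_ge0.
  - apply/measurable_EFinP; apply: (measurableT_comp (measurable_bell r)).
    by apply: measurable_funD => //; apply: measurable_funM => //; exact: measurable_funB.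
  - apply: emeasurable_funD => //.
    exact: (measurable_fun_fubini_tonelli_F (m2 := omegaP k) _ (mb k.+1 x)).
  - move=> e _; have := IH (x + a k.+1 * (e - 1)) sm.
    move=> /le_trans; apply; apply: leeD => //.
    by under eq_integral do rewrite -addrA; under [leRHS]eq_integral do rewrite clinS/=.
rewrite ge0_integralD//.
- by rewrite integral_prob_cst.
- by move=> e _; exact: integral_ge0.
- exact: (measurable_fun_fubini_tonelli_F (m2 := omegaP k) _ (mb k.+1 x)).
- by move=> e _; rewrite lee_fin mulr_ge0.
Qed.

End gaussian_step.

(** * Normal limit of linear forms *)

Section gaussian_limit.
Context {R : realType}.
Local Notation Q := (expo R).
Local Notation mu := (@lebesgue_measure R).
Local Notation N := (normal_prob (0 : R) 1).
Local Notation k := (normal_peak (1 : R)).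

Lemma bellN r x : bell r (- x) = bell r x :> R.
Proof. by rewrite /bell /psi mulNr sqrrN. Qed.

Lemma normal_density (g : R -> \bar R) :
  measurable_fun setT g -> (forall x, 0 <= g x)%E ->
  (\int[N]_z g z = \int[mu]_z (g z * (normal_pdf 0 1 z)%:E))%E.
Proof.
move=> mg g0; apply: ge0_integral_density => //.
- exact: measurable_normal_pdf.
- by move=> x _; exact: normal_pdf_ge0.
- by move=> A mA; rewrite setIT.
Qed.

Lemma normal_bell (g : R -> \bar R) (b r : R) : 0 < r ->
  measurable_fun setT g -> (forall x, 0 <= g x)%E ->
  (\int[N]_z g (b + r * z)%R = \int[mu]_c (g c * (k * bell r (c - b))%:E))%E.
Proof.
move=> r0 mg g0; have r0' := ltW r0; have k0 := @normal_peak_ge0 R 1.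
have maff : measurable_fun setT (fun z : R => b + r * z).
  by apply: measurable_funD => //; exact: measurable_funM.
have mgr : measurable_fun setT (fun z => g (b + r * z)) by exact: (measurableT_comp mg).
rewrite (@ge0_integral_affine _ r b r0 (fun c => g c * (k * bell r (c - b))%:E)%E); last 2 first.
- apply: emeasurable_funM => //; apply/measurable_EFinP; apply: measurable_funM => //.
  by apply: (measurableT_comp (measurable_bell r)); exact: measurable_funB.
- by move=> x; rewrite mule_ge0// lee_fin mulr_ge0// bell_ge0.
rewrite normal_density//.
rewrite -ge0_integralZl//; last 2 first.
- apply: emeasurable_funM; first by apply: (measurableT_comp mg); under eq_fun do rewrite addrC.
  apply/measurable_EFinP; apply: measurable_funM => //;
    apply: (measurableT_comp (measurable_bell r)).
  by apply: measurable_funB => //; apply: measurable_funD => //; exact: measurable_funM.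
- by move=> x _; rewrite mule_ge0// lee_fin mulr_ge0// bell_ge0.
apply: eq_integral => z _.
rewrite muleCA [(r * z + b)%R]addrC -EFinM; congr (_ * _%:E)%E.
rewrite normal_pdfE ?oner_eq0// /normal_fun /bell /psi addrAC subrr add0r.
rewrite subr0 expr1n (_ : r * z / r = z); last by rewrite mulrAC divff ?mul1r// gt_eqF.
by rewrite mulNr; field; rewrite gt_eqF.
Qed.

(** From [|x| <= exp (x ^ 2 / 4)], the integrand is at most twice the Gaussian density
of variance 2. *)
Lemma normal_abs_moment : (\int[N]_z (`|z|)%:E <= 2%:E)%E.
Proof.
have k0 := @normal_peak_ge0 R 1.
have s0 : 0 < Num.sqrt 2 :> R by rewrite sqrtr_gt0.
have s2 : Num.sqrt 2 ^+ 2 = 2 :> R by rewrite sqr_sqrtr.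
have s1 : Num.sqrt 2 <= 2 :> R.
  by rewrite -(ler_pXn2r (n:=2))// ?nnegrE ?sqrtr_ge0// s2; lra.
have mab : measurable_fun setT (fun z : R => `|z|%:E).
  by apply/measurable_EFinP; exact: normr_measurable.
have := @normal_bell (fun z => `|z|%:E) 0 1 ltr01 mab (fun=> normr_ge0 _).
under eq_integral do rewrite add0r mul1r.
move=> ->.
apply: (@le_trans _ _ (\int[mu]_c (2%:E * (k * bell (Num.sqrt 2) (c - 0))%:E))%E).
  apply: ge0_le_integral => //.
  - by move=> x _; rewrite -EFinM lee_fin; apply: mulr_ge0 => //; apply: mulr_ge0 => //;
    exact: bell_ge0.
  - apply: emeasurable_funM => //; apply/measurable_EFinP; apply: measurable_funM => //.
    by apply: (measurableT_comp (measurable_bell 1)); exact: measurable_funB.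
  - apply: emeasurable_funM => //; apply/measurable_EFinP; apply: measurable_funM => //.
    by apply: (measurableT_comp (measurable_bell _)); exact: measurable_funB.
  - move=> x _; rewrite -!EFinM lee_fin subr0 mulrCA [leRHS]mulrCA ler_wpM2l// /bell !divr1.
    apply: (@le_trans _ _ (psi (x / Num.sqrt 2))); last first.
      by rewrite mulrA ler_pdivlMr// mulrC ler_wpM2r ?psi_ge0.
    have e : `|x| <= expR (x ^+ 2 / 4).
      apply: le_trans (expR_ge1Dx _).
      by have := sqr_ge0 (`|x| - 2); rewrite -(ger0_norm (sqr_ge0 x)) normrX; lra.
    apply: (le_trans (ler_wpM2r (psi_ge0 _) e)); rewrite /psi -expRD ler_expR.
    by rewrite expr_div_n s2; lra.
have m2 : measurable_fun setT ((fun=> 2%:E) : R -> \bar R) by [].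
have := @normal_bell (fun=> 2%:E) 0 (Num.sqrt 2) s0 m2 (fun=> ler0n _ _).
by move=> <-; rewrite integral_prob_cst.
Qed.

Definition lipschitz_le (L : R) (f : R -> R) := forall x y, `|f x - f y| <= L * `|x - y|.

Lemma lipschitz_le_continuous L f : lipschitz_le L f -> continuous f.
Proof.
move=> fL x; apply/cvgrPdist_le => e e0; near=> y.
rewrite (le_trans (fL x y))//.
have L0 : 0 < `|L| + 1 by rewrite ltr_wpDl.
apply: (@le_trans _ _ ((`|L| + 1) * `|x - y|)).
  by rewrite ler_wpM2r// (le_trans (ler_norm L))// lerDl.
rewrite mulrC -ler_pdivlMr//; near: y.
by apply: (@cvgr_dist_le _ _ _ _ (nbhs_filter x) id x cvg_id); rewrite divr_gt0.
Unshelve. all: by end_near. Qed.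

Section lower.
Variables (f : R -> R) (L M : R).
Hypotheses (L0 : 0 <= L) (fL : lipschitz_le L f) (f0 : forall x, 0 <= f x)
  (fM : forall x, f x <= M).

Let mf : measurable_fun setT f.
Proof. by apply: continuous_measurable_fun; exact: lipschitz_le_continuous fL. Qed.

Let mfaff b r : measurable_fun setT (fun z : R => (f (b + r * z))%:E).
Proof.
apply/measurable_EFinP; apply: (measurableT_comp mf).
by apply: measurable_funD => //; exact: measurable_funM.
Qed.

Let mabs (c : R) : measurable_fun setT (fun z : R => (c * `|z|)%:E).
Proof. by apply/measurable_EFinP; apply: measurable_funM => //; exact: normr_measurable. Qed.

(** The increment of [f] is at most [L c |z|], and [E |z| <= 2]. *)
Lemma normal_lipschitz (b b' r r' c : R) : 0 <= c ->
  (forall z, `|(b + r * z) - (b' + r' * z)| <= c * `|z|) ->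
  (\int[N]_z (f (b + r * z))%:E <= \int[N]_z (f (b' + r' * z))%:E + (2 * L * c)%:E)%E.
Proof.
move=> c0 h; have Lc0 : 0 <= L * c by rewrite mulr_ge0.
apply: (@le_trans _ _ (\int[N]_z ((f (b' + r' * z))%:E + (L * c * `|z|)%:E))%E).
  apply: ge0_le_integral => //.
  - by move=> z _; rewrite lee_fin.
  - exact: mfaff.
  - by apply: emeasurable_funD; [exact: mfaff|exact: mabs].
  - move=> z _; rewrite -EFinD lee_fin.
    have := fL (b + r * z) (b' + r' * z); rewrite ler_norml => /andP[_].
    have : L * `|b + r * z - (b' + r' * z)| <= L * (c * `|z|) by rewrite ler_wpM2l.
    by rewrite mulrA; lra.
rewrite ge0_integralD//; last 4 first.
- by move=> z _; rewrite lee_fin.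
- exact: mfaff.
- by move=> z _; rewrite lee_fin mulr_ge0.
- exact: mabs.
apply: leeD => //.
under eq_integral do rewrite EFinM.
rewrite ge0_integralZl//; last by apply/measurable_EFinP; exact: normr_measurable.
apply: (le_trans (lee_wpmul2l _ normal_abs_moment)); first by rewrite lee_fin.
by rewrite -EFinM lee_fin; lra.
Qed.

Let k0 := @normal_peak_ge0 R 1.

Let mbell r b : measurable_fun setT (fun c : R => (k * bell r (c - b))%:E).
Proof.
apply/measurable_EFinP; apply: measurable_funM => //.
by apply: (measurableT_comp (measurable_bell r)); exact: measurable_funB.
Qed.

Let bell0 r x : 0 < r -> (0 <= (k * bell r x)%:E)%E.
Proof. by move=> r0; rewrite lee_fin mulr_ge0// bell_ge0// ltW. Qed.

Let mbellclin delta n (a : nat -> R) :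
  measurable_fun setT (fun z : measurableTypeR R * omega n =>
    (k * bell delta (z.1 - clin a z.2))%:E).
Proof.
apply/measurable_EFinP; apply: measurable_funM => //.
apply: (measurableT_comp (measurable_bell delta)); apply: measurable_funB => //.
apply: (@measurableT_comp _ _ _ _ _ _ _ _ _ (@measurable_clin R a n)).
exact: measurable_snd.
Qed.

(** The left side is the expectation of [f] at the linear form perturbed by an
independent Gaussian of standard deviation [delta], written as an integral over the
value [c] of the perturbed form. *)
Let smooth_upper delta n (a : nat -> R) : 0 < delta ->
  (\int[mu]_c ((f c)%:E * \int[omegaP n]_w (k * bell delta (c - clin a w))%:E) <=
   \int[omegaP n]_w (f (clin a w))%:E + (2 * L * delta)%:E)%E.
Proof.
move=> d0; have d0' := ltW d0.
have mfc : measurable_fun setT (fun c : R => (f c)%:E) by exact/measurable_EFinP.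
have mF : measurable_fun setT (fun z : measurableTypeR R * omega n =>
    ((f z.1)%:E * (k * bell delta (z.1 - clin a z.2))%:E)%E).
  apply: emeasurable_funM; last exact: mbellclin.
  by apply: (measurableT_comp mfc); exact: measurable_fst.
have F0 (z : measurableTypeR R * omega n) :
    (0 <= ((f z.1)%:E * (k * bell delta (z.1 - clin a z.2))%:E)%E)%E.
  by rewrite mule_ge0 ?bell0// lee_fin.
have -> : (\int[mu]_c ((f c)%:E * \int[omegaP n]_w (k * bell delta (c - clin a w))%:E) =
    \int[mu]_c \int[omegaP n]_w ((f c)%:E * (k * bell delta (c - clin a w))%:E))%E.
  apply: eq_integral => c _; rewrite -ge0_integralZl//.
  - exact: (@measurableT_comp _ _ _ _ _ _ _ _ _ (@mbellclin delta n a)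
      (pair1_measurable (c : measurableTypeR R))).
  - by move=> w _; rewrite bell0.
  - by rewrite lee_fin.
have /= fub := fubini_tonelli (m1 := mu) (m2 := omegaP n) _ mF F0; rewrite {}fub.
apply: (@le_trans _ _ (\int[omegaP n]_w ((f (clin a w))%:E + (2 * L * delta)%:E))%E).
  apply: ge0_le_integral => //.
  - by move=> w _; apply: integral_ge0 => c _; exact: (F0 (c, w)).
  - exact: (@measurable_fun_fubini_tonelli_G _ _ (measurableTypeR R) (omega n) R mu _ mF F0).
  - apply: emeasurable_funD => //; apply: (measurableT_comp mfc); exact: measurable_clin.
  - move=> w _ /=; rewrite -(normal_bell _ d0 mfc)//.
    have := @normal_lipschitz (clin a w) (clin a w) delta 0 delta d0'.
    move=> /(_ (fun z => _)) h; apply: (le_trans (h _)).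
      by move=> z; rewrite mul0r addr0 addrAC subrr add0r normrM gtr0_norm.
    by under eq_integral do rewrite mul0r addr0; rewrite integral_prob_cst.
rewrite ge0_integralD//; last 3 first.
- by move=> w _; rewrite lee_fin.
- by apply: (measurableT_comp mfc); exact: measurable_clin.
- by move=> w _; rewrite lee_fin !mulr_ge0.
by rewrite integral_prob_cst.
Qed.

(** Perturb both sides by a Gaussian of standard deviation [delta], at the price of
[2 L delta] each. The densities of the perturbed laws are compared pointwise by
[bell_clin] for [|c| <= B]; elsewhere [f <= M] and [1 <= |c| / B], so that Markov's
inequality bounds the contribution of the normal law. *)
Let gauss_lower_explicit delta B n (a : nat -> R) : 0 < delta -> 0 < B ->
  \sum_(1 <= j < n.+1) a j ^+ 2 = 1 ->
  (forall j, (1 <= j <= n)%N -> a j ^+ 2 <= delta ^+ 2 / 2) ->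
  (\int[N]_z (f z)%:E <= \int[omegaP n]_w (f (clin a w))%:E +
    (4 * L * delta + 2 * (1 + delta) * M / B +
     2 * B * M * k * (192 / delta ^+ 4 * \sum_(1 <= j < n.+1) `|a j| ^+ 3))%:E)%E.
Proof.
move=> d0 B0 a1 asmall; have d0' := ltW d0.
have M0 : 0 <= M by apply: le_trans (fM 0).
pose r := Num.sqrt (delta ^+ 2 + 1).
have r2 : r ^+ 2 = delta ^+ 2 + 1 by rewrite sqr_sqrtr// addr_ge0// sqr_ge0.
have r1 : 1 <= r by rewrite -(ler_pXn2r (n:=2))// ?nnegrE ?sqrtr_ge0// r2 expr1n;
  have := sqr_ge0 delta; lra.
have rd : r <= 1 + delta.
  by rewrite -(ler_pXn2r (n:=2))// ?nnegrE ?sqrtr_ge0 ?addr_ge0// r2; nra.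
have r0 : 0 < r by apply: lt_le_trans r1.
set tau := 192 / delta ^+ 4 * _.
have tau0 : 0 <= tau.
  by rewrite mulr_ge0 ?divr_ge0 ?exprn_ge0// sumr_ge0// => j _; rewrite exprn_ge0.
have mfc : measurable_fun setT (fun c : R => (f c)%:E) by exact/measurable_EFinP.
have step1 := @normal_lipschitz 0 0 1 r delta d0'.
have {}step1 : (\int[N]_z (f z)%:E <= \int[N]_z (f (0 + r * z))%:E + (2 * L * delta)%:E)%E.
  apply: le_trans (step1 _); first by under [leRHS]eq_integral do rewrite add0r mul1r.
  move=> z; rewrite !add0r -mulrBl normrM ler_wpM2r// ler_norml.
  by apply/andP; split; lra.
apply: (le_trans step1).
rewrite (@normal_bell (fun c => (f c)%:E) 0 r r0 mfc)//.
pose g c : \bar R := (\int[omegaP n]_w (k * bell delta (c - clin a w))%:E)%E.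
have mbc c : measurable_fun setT (fun w : omega n => (k * bell delta (c - clin a w))%:E).
  exact: (@measurableT_comp _ _ _ _ _ _ _ _ _ (@mbellclin delta n a)
    (pair1_measurable (c : measurableTypeR R))).
have mg : measurable_fun setT g.
  apply: (@measurable_fun_fubini_tonelli_F _ _ (measurableTypeR R) (omega n) R (omegaP n) _
    (@mbellclin delta n a)).
  by move=> z; rewrite bell0.
have g0 c : (0 <= g c)%E by apply: integral_ge0 => w _; rewrite bell0.
have low c : ((k * bell r c)%:E <= g c + (k * tau)%:E)%E.
  have := @bell_clin R delta a n (- c) d0 asmall; rewrite a1 -/r bellN -/tau => h.
  have ke : (0 <= k%:E)%E by rewrite lee_fin.
  have mb : measurable_fun setT (fun w : omega n => (bell delta (- c + clin a w))%:E).
    apply/measurable_EFinP; apply: (measurableT_comp (measurable_bell delta)).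
    by apply: measurable_funD => //; exact: measurable_clin.
  have b0 (w : omega n) : (0 <= (bell delta (- c + clin a w))%:E)%E by rewrite lee_fin bell_ge0.
  move: (lee_wpmul2l ke h); rewrite muleDr//; last first.
    by rewrite ge0_adde_def// inE ?integral_ge0// lee_fin.
  rewrite -!EFinM -ge0_integralZl//.
  move=> /le_trans; apply; apply: leeD => //; rewrite /g le_eqVlt; apply/orP; left; apply/eqP.
  by apply: eq_integral => w _; rewrite -EFinM -bellN opprD opprK.
pose U c : \bar R := ((f c)%:E * g c)%E.
pose V c : \bar R := ((M * (k * tau))%:E * (\1_(`[- B, B]%classic : set R) c : R)%:E)%E.
pose W c : \bar R := ((M / B)%:E * (`|c|%:E * (k * bell r (c - 0))%:E))%E.
have mU : measurable_fun setT U by exact: emeasurable_funM.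
have mV : measurable_fun setT V.
  apply: emeasurable_funM => //; apply/measurable_EFinP; apply: measurable_indic.
  exact: measurable_itv.
have mab : measurable_fun setT (fun c : R => `|c|%:E).
  by apply/measurable_EFinP; exact: normr_measurable.
have mW : measurable_fun setT W.
  by apply: emeasurable_funM => //; apply: emeasurable_funM => //; exact: mbell.
have U0 c : (0 <= U c)%E by rewrite mule_ge0// lee_fin.
have V0 c : (0 <= V c)%E.
  by rewrite mule_ge0// lee_fin; apply: mulr_ge0 => //; exact: mulr_ge0.
have W0 c : (0 <= W c)%E.
  by rewrite mule_ge0// ?mule_ge0 ?bell0// lee_fin divr_ge0// ltW.
have pw c : ((f c)%:E * (k * bell r (c - 0))%:E <= U c + (V c + W c))%E.
  have [cB|cB] := boolP (c \in (`[- B, B]%classic : set R)).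
    apply: (@le_trans _ _ (U c + V c)%E); last by rewrite leeD2l// leeDl.
    rewrite /V indicE cB mule1 subr0.
    apply: (le_trans (lee_wpmul2l _ (low c))); first by rewrite lee_fin.
    rewrite muleDr//; last by rewrite ge0_adde_def// inE// lee_fin mulr_ge0.
    by rewrite leeD2l// -EFinM lee_fin ler_wpM2r// mulr_ge0.
  apply: (@le_trans _ _ (W c)); last by rewrite addeA leeDr// adde_ge0.
  rewrite /W -!EFinM lee_fin mulrA ler_wpM2r//.
    by have := bell0 (c - 0) r0; rewrite lee_fin.
  rewrite (le_trans (fM c))//; rewrite mulrAC ler_pdivlMr// ler_wpM2l//.
  move: cB; rewrite mem_setE in_itv/= -ler_norml -ltNge => /ltW; exact.
apply: (@le_trans _ _ (\int[mu]_c (U c + (V c + W c)) + (2 * L * delta)%:E)%E).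
  apply: leeD => //; apply: ge0_le_integral => //.
  - by move=> c _; rewrite mule_ge0 ?bell0// lee_fin.
  - by apply: emeasurable_funM => //; exact: mbell.
  - by apply: emeasurable_funD => //; exact: emeasurable_funD.
have VW0 c : (0 <= V c + W c)%E by rewrite adde_ge0.
have mVW : measurable_fun setT (fun c => V c + W c)%E by exact: emeasurable_funD.
rewrite ge0_integralD// ge0_integralD//.
have IU : (\int[mu]_c U c <= \int[omegaP n]_w (f (clin a w))%:E + (2 * L * delta)%:E)%E.
  exact: smooth_upper.
have IV : (\int[mu]_c V c = (2 * B * M * k * tau)%:E)%E.
  have mI : measurable_fun setT (fun c : R => (\1_(`[- B, B]%classic : set R) c : R)%:E).
    by apply/measurable_EFinP; apply: measurable_indic; exact: measurable_itv.
  have c0 : (0 <= (M * (k * tau))%:E)%E.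
    by rewrite lee_fin; apply: mulr_ge0 => //; exact: mulr_ge0.
  rewrite /V ge0_integralZl//.
  rewrite integral_indic//.
  rewrite setIT [X in (_ * X)%E](_ : _ = (2 * B)%:E); first by rewrite -EFinM; congr EFin; ring.
  rewrite [LHS]lebesgue_measure_itv/= lte_fin ifT; last by rewrite gtrN.
  by rewrite -EFinD; congr EFin; ring.
have IW : (\int[mu]_c W c <= (2 * (1 + delta) * M / B)%:E)%E.
  have mI : measurable_fun setT (fun c : R => (`|c|%:E * (k * bell r (c - 0))%:E)%E).
    by apply: emeasurable_funM => //; exact: mbell.
  have I0 (c : R) : (0 <= `|c|%:E * (k * bell r (c - 0))%:E)%E by rewrite mule_ge0 ?bell0.
  have c0 : (0 <= (M / B)%:E)%E by rewrite lee_fin divr_ge0// ltW.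
  rewrite /W ge0_integralZl//.
  rewrite -(normal_bell 0 r0 mab)//.
  under eq_integral do rewrite add0r normrM (gtr0_norm r0) EFinM.
  rewrite ge0_integralZl//; last by rewrite lee_fin ltW.
  apply: (@le_trans _ _ ((M / B)%:E * (r%:E * 2%:E))%E).
    apply: lee_wpmul2l; first by rewrite lee_fin divr_ge0// ltW.
    by apply: lee_wpmul2l; [rewrite lee_fin ltW|exact: normal_abs_moment].
  rewrite -!EFinM lee_fin.
  have : r * (M / B) <= (1 + delta) * (M / B) by rewrite ler_wpM2r// divr_ge0// ltW.
  lra.
apply: (@le_trans _ _ ((\int[omegaP n]_w (f (clin a w))%:E + (2 * L * delta)%:E) +
   ((2 * B * M * k * tau)%:E + (2 * (1 + delta) * M / B)%:E) + (2 * L * delta)%:E)%E).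
  by apply: leeD => //; apply: leeD => //; rewrite IV leeD2l.
rewrite [leLHS](_ : _ = \int[omegaP n]_w (f (clin a w))%:E +
  (2 * L * delta + (2 * B * M * k * tau + 2 * (1 + delta) * M / B) + 2 * L * delta)%:E)%E.
  by apply: leeD => //; rewrite lee_fin; lra.
by rewrite !EFinD !addeA.
Qed.

(** The three errors are made small by choosing [delta], then [B], then [eta]; the sum
of the cubes is at most [sqrt eta] because the squares sum to 1. *)
Lemma gauss_lower eps : 0 < eps -> exists2 eta, 0 < eta & forall n (a : nat -> R),
  \sum_(1 <= j < n.+1) a j ^+ 2 = 1 ->
  (forall j, (1 <= j <= n)%N -> a j ^+ 2 <= eta) ->
  (\int[N]_z (f z)%:E <= \int[omegaP n]_w (f (clin a w))%:E + eps%:E)%E.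
Proof.
move=> e0; have M0 : 0 <= M by apply: le_trans (fM 0).
have L10 : 0 < 16 * (L + 1) by rewrite mulr_gt0// ltr_wpDl.
pose delta := Num.min 1 (eps / (16 * (L + 1))).
have d0 : 0 < delta by rewrite lt_min ltr01 divr_gt0.
have d1 : delta <= 1 by rewrite ge_min lexx.
have dL : 4 * L * delta <= eps / 4.
  have : delta <= eps / (16 * (L + 1)) by rewrite ge_min lexx orbT.
  by rewrite ler_pdivlMr//; have := mulr_ge0 L0 (ltW d0); lra.
pose B := 16 * (M + 1) / eps.
have M10 : 0 < M + 1 by rewrite ltr_wpDl.
have B0 : 0 < B by rewrite divr_gt0// mulr_gt0.
have dB : 2 * (1 + delta) * M / B <= eps / 4.
  rewrite ler_pdivrMr// /B.
  rewrite (_ : eps / 4 * _ = 4 * (M + 1)); last by field; rewrite gt_eqF.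
  have : (1 + delta) * M <= 2 * M by rewrite ler_wpM2r//; lra.
  lra.
pose C := 2 * B * M * k * (192 / delta ^+ 4).
have C0 : 0 <= C.
  by rewrite /C !mulr_ge0 ?invr_ge0 ?exprn_ge0// ltW.
pose t := eps / (4 * (C + 1)).
have t0 : 0 < t by rewrite divr_gt0// mulr_gt0// ltr_wpDl.
exists (Num.min (delta ^+ 2 / 2) (t ^+ 2)).
  by rewrite lt_min divr_gt0// exprn_gt0.
move=> n a a1 asmall.
apply: (le_trans (@gauss_lower_explicit delta B n a d0 B0 a1 _)).
  by move=> j jn; apply: (le_trans (asmall j jn)); rewrite ge_min lexx.
rewrite leeD2l// lee_fin mulrA -/C.
have a3 : \sum_(1 <= j < n.+1) `|a j| ^+ 3 <= t.
  rewrite -[leRHS]mulr1 -a1 mulr_sumr big_nat [leRHS]big_nat; apply: ler_sum => j.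
  rewrite ltnS => jn; rewrite exprS -normrX (ger0_norm (sqr_ge0 _)) ler_wpM2r ?sqr_ge0//.
  rewrite -(ler_pXn2r (n:=2))// ?nnegrE ?(ltW t0)// -normrX ger0_norm ?sqr_ge0//.
  by apply: (le_trans (asmall j jn)); rewrite ge_min lexx orbT.
have : C * \sum_(1 <= j < n.+1) `|a j| ^+ 3 <= eps / 4.
  apply: (@le_trans _ _ (C * t)); first by rewrite ler_wpM2l.
  rewrite /t mulrA ler_pdivrMr ?mulr_gt0 ?ltr_wpDl//.
  by have := mulr_ge0 C0 (ltW e0); lra.
lra.
Qed.

End lower.

End gaussian_limit.

(** * From Lipschitz to bounded continuous test functions *)

Section weak_limit.
Context {R : realType}.
Local Notation N := (normal_prob (0 : R) 1).

Lemma integrable_bounded d (T : measurableType d) (P : probability T R) (f : T -> R) M :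
  measurable_fun setT f -> (forall x, `|f x| <= M) -> P.-integrable setT (EFin \o f).
Proof.
move=> mf fM; apply: (@le_integrable _ _ _ _ _ _ _ (EFin \o cst M)) => //.
- exact/measurable_EFinP.
- by move=> x _ /=; rewrite lee_fin (le_trans (fM x))// ler_norm.
- exact: finite_measure_integrable_cst.
Qed.

Section inf_convolution.
Variables (f : R -> R) (M : R).
Hypotheses (cf : continuous f) (f0 : forall x, 0 <= f x) (fM : forall x, f x <= M).

(** The largest function below [f] that is Lipschitz with constant [L]. *)
Definition inf_conv (L x : R) := inf [set f y + L * `|x - y| | y in [set: R]].

Let lb L x : 0 <= L -> lbound [set f y + L * `|x - y| | y in [set: R]] 0.
Proof. by move=> L0 _ [y _ <-]; rewrite addr_ge0// mulr_ge0. Qed.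

Let nonempty L x : [set f y + L * `|x - y| | y in [set: R]] !=set0.
Proof. by exists (f x + L * `|x - x|), x. Qed.

Lemma inf_conv_le L x y : 0 <= L -> inf_conv L x <= f y + L * `|x - y|.
Proof.
move=> L0; apply: ge_inf; last by exists y.
by exists 0; exact: lb.
Qed.

Lemma inf_conv_ge L x c : (forall y, c <= f y + L * `|x - y|) -> c <= inf_conv L x.
Proof. by move=> h; apply: lb_le_inf => // _ [y _ <-]. Qed.

Lemma inf_conv_lipschitz L : 0 <= L -> lipschitz_le L (inf_conv L).
Proof.
move=> L0.
have h x x' : inf_conv L x - L * `|x - x'| <= inf_conv L x'.
  apply: inf_conv_ge => y; have := inf_conv_le x y L0.
  have : L * `|x - y| <= L * (`|x - x'| + `|x' - y|) by rewrite ler_wpM2l// ler_distD.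
  by lra.
move=> x x'; have := h x x'; have := h x' x; rewrite (distrC x' x).
by rewrite ler_norml => *; apply/andP; split; lra.
Qed.

Lemma inf_conv_ge0 L x : 0 <= L -> 0 <= inf_conv L x.
Proof. by move=> L0; apply: inf_conv_ge => y; rewrite addr_ge0// mulr_ge0. Qed.

Lemma inf_conv_le_self L x : 0 <= L -> inf_conv L x <= f x.
Proof. by move=> L0; have := inf_conv_le x x L0; rewrite subrr normr0 mulr0 addr0. Qed.

(** The points [y] far from [x] are excluded once [L |x - y|] exceeds the bound of
[f], and near [x] continuity applies. *)
Lemma inf_conv_cvg x : inf_conv n%:R x @[n --> \oo] --> f x.
Proof.
apply/cvgrPdist_le => e e0.
have /cvgrPdist_le/(_ e e0)/nbhs_ballP[d /= d0 hd] := cf (x := x).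
near=> n.
have n0 : 0 <= n%:R :> R by [].
rewrite ger0_norm ?subr_ge0 ?inf_conv_le_self//.
rewrite lerBlDr -lerBlDl; apply: inf_conv_ge => y.
have [xy|xy] := ltP `|x - y| d.
  have := hd y; rewrite /ball/= => /(_ xy); rewrite ler_norml => /andP[_].
  have : 0 <= n%:R * `|x - y| by rewrite mulr_ge0.
  by lra.
have : M <= n%:R * d.
  rewrite -ler_pdivrMr//; near: n.
  exact: nbhs_infty_ger.
have : n%:R * d <= n%:R * `|x - y| by rewrite ler_wpM2l.
have := fM x; have := f0 y; lra.
Unshelve. all: by end_near. Qed.

Lemma lipschitz_minorant (P : probability (measurableTypeR R) R) eps : 0 < eps ->
  exists L, exists g : R -> R, [/\ 0 <= L, lipschitz_le L g, forall x, 0 <= g x <= f x &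
    (\int[P]_x (f x)%:E <= \int[P]_x (g x)%:E + eps%:E)%E].
Proof.
move=> e0.
have mf : measurable_fun setT f by exact: continuous_measurable_fun.
have mg n : measurable_fun setT (inf_conv n%:R).
  by apply: continuous_measurable_fun;
    exact: lipschitz_le_continuous (inf_conv_lipschitz (ler0n _ n)).
have g0 n x : 0 <= inf_conv n%:R x by exact: inf_conv_ge0.
have gf n x : inf_conv n%:R x <= f x by exact: inf_conv_le_self.
have gM n x : `|inf_conv n%:R x| <= M by rewrite ger0_norm// (le_trans (gf n x)).
have fM' x : `|f x| <= M by rewrite ger0_norm.
have mgE n : measurable_fun setT (fun x => (inf_conv n%:R x)%:E) by exact/measurable_EFinP.
have mfE : measurable_fun setT (EFin \o f) by exact/measurable_EFinP.
have cvgE : {ae P, forall x, setT x -> (inf_conv n%:R x)%:E @[n --> \oo] --> (EFin \o f) x}.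
  apply: aeW => x _; apply: cvg_EFin; first by near=> n.
  exact: inf_conv_cvg.
have bE : {ae P, forall x, forall n : nat, setT x ->
    (`|(inf_conv n%:R x)%:E| <= (EFin \o cst M) x)%E}.
  by apply: aeW => x n _; rewrite /= lee_fin.
have iM : P.-integrable setT (EFin \o cst M) by exact: finite_measure_integrable_cst.
have [_ _ cvI] := @dominated_convergence _
  (measurableTypeR R) R P setT measurableT _ _ _ mgE mfE cvgE iM bE.
have fin (h : R -> R) : measurable_fun setT h -> (forall x, `|h x| <= M) ->
    (\int[P]_x (h x)%:E)%E \is a fin_num.
  by move=> mh hM; apply: integrable_fin_num => //;
    exact: (@integrable_bounded _ (measurableTypeR R) P h M mh hM).
move: cvI; rewrite -[X in _ --> X](fineK (fin f mf fM')) => /fine_cvg/cvgrPdist_le/(_ eps e0)[n _].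
move=> /(_ n (leqnn n)) /=; rewrite ler_norml => /andP[_ h].
exists n%:R, (inf_conv n%:R); split => //; first exact: inf_conv_lipschitz.
  by move=> x; rewrite g0 gf.
rewrite -[leLHS](fineK (fin f mf fM')) -[X in (_ <= X + _)%E](fineK (fin _ (mg n) (gM n))).
by rewrite -EFinD lee_fin -lerBlDl.
Unshelve. all: by end_near. Qed.

End inf_convolution.

Section continuous_lower.
Variables (f : R -> R) (M : R).
Hypotheses (cf : continuous f) (f0 : forall x, 0 <= f x) (fM : forall x, f x <= M).

(** A Lipschitz minorant [g] of [f] has almost the same Gaussian integral, and
replacing [clin a] by a variable that is close to it in L1 changes the expectation of
[g] by at most the Lipschitz constant times the distance. *)
Lemma continuous_lower eps : 0 < eps -> exists2 eta, 0 < eta &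
  forall n (a : nat -> R) (X : omega n -> R), measurable_fun setT X ->
  \sum_(1 <= j < n.+1) a j ^+ 2 = 1 ->
  (forall j, (1 <= j <= n)%N -> a j ^+ 2 <= eta) ->
  (\int[omegaP n]_w (`|X w - clin a w|)%:E <= eta%:E)%E ->
  (\int[N]_z (f z)%:E <= \int[omegaP n]_w (f (X w))%:E + eps%:E)%E.
Proof.
move=> e0; have e3 : 0 < eps / 3 by rewrite divr_gt0.
have [L [g [L0 gL g0f Ig]]] := lipschitz_minorant cf f0 fM N e3.
have g0 x : 0 <= g x by have /andP[] := g0f x.
have gf x : g x <= f x by have /andP[] := g0f x.
have gM x : g x <= M by apply: le_trans (fM x).
have [eta eta0 hg] := gauss_lower L0 gL g0 gM e3.
have mf : measurable_fun setT f by exact: continuous_measurable_fun.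
have mg : measurable_fun setT g by apply: continuous_measurable_fun;
  exact: lipschitz_le_continuous gL.
have L1 : 0 < L + 1 by rewrite ltr_wpDl.
exists (Num.min eta (eps / 3 / (L + 1))); first by rewrite lt_min eta0 divr_gt0.
move=> n a X mX a1 asmall XE.
apply: (le_trans Ig).
have {}hg : (\int[N]_z (g z)%:E <= \int[omegaP n]_w (g (clin a w))%:E + (eps / 3)%:E)%E.
  by apply: hg => // j jn; apply: (le_trans (asmall j jn)); rewrite ge_min lexx.
have mfX : measurable_fun setT (fun w => (f (X w))%:E).
  by apply/measurable_EFinP; exact: measurableT_comp.
have mdX : measurable_fun setT (fun w => (`|X w - clin a w|)%:E).
  apply/measurable_EFinP; apply: measurableT_comp => //.
  by apply: measurable_funB => //; exact: measurable_clin.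
have step : (\int[omegaP n]_w (g (clin a w))%:E <=
    \int[omegaP n]_w (f (X w))%:E + (eps / 3)%:E)%E.
  apply: (@le_trans _ _ (\int[omegaP n]_w ((f (X w))%:E + L%:E * (`|X w - clin a w|)%:E))%E).
    apply: ge0_le_integral => //.
    - by move=> w _; rewrite lee_fin.
    - by apply/measurable_EFinP; apply: (measurableT_comp mg); exact: measurable_clin.
    - by apply: emeasurable_funD => //; exact: emeasurable_funM.
    - move=> w _; rewrite -EFinM -EFinD lee_fin.
      have := gL (X w) (clin a w); rewrite ler_norml => /andP[+ _].
      by have := gf (X w); lra.
  rewrite ge0_integralD//; last 3 first.
  - by move=> w _; rewrite lee_fin.
  - by move=> w _; rewrite -EFinM lee_fin mulr_ge0.
  - exact: emeasurable_funM.
  rewrite ge0_integralZl//.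
  apply: leeD => //; apply: (le_trans (lee_wpmul2l _ XE)); first by rewrite lee_fin.
  rewrite -EFinM lee_fin.
  have : Num.min eta (eps / 3 / (L + 1)) <= eps / 3 / (L + 1) by rewrite ge_min lexx orbT.
  move=> /(ler_wpM2l L0)/le_trans; apply.
  by rewrite mulrA ler_pdivrMr// [leRHS]mulrC ler_wpM2r ?(ltW e3)// lerDl.
apply: (le_trans (leeD hg (lexx _))); apply: (le_trans (leeD (leeD step (lexx _)) (lexx _))).
rewrite [leLHS](_ : _ = \int[omegaP n]_w (f (X w))%:E + (eps / 3 + eps / 3 + eps / 3)%:E)%E.
  by apply: leeD => //; rewrite lee_fin; lra.
by rewrite !EFinD !addeA.
Qed.

End continuous_lower.

Lemma integral_bounded_shift d (T : measurableType d) (P : probability T R)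
    (g : T -> R) (M c s : R) : measurable_fun setT g -> (forall x, `|g x| <= M) ->
  (\int[P]_x (c + s * g x)%:E = c%:E + s%:E * \int[P]_x (g x)%:E)%E.
Proof.
move=> mg gM; have ig := integrable_bounded P mg gM.
transitivity (\int[P]_x ((EFin \o cst c) x + s%:E * (EFin \o g) x))%E; first exact: eq_integral.
rewrite integralD//; last 2 first.
- exact: finite_measure_integrable_cst.
- exact: integrableZl.
by rewrite integralZl//; congr (_ + _)%E; rewrite -[RHS](integral_prob_cst P).
Qed.

(** A lower bound for all nonnegative test functions suffices: it is applied to
[B + f] and to [B - f]. *)
Theorem gaussian_limit (f : R -> R) : continuous f -> bounded_fun f ->
  forall eps, 0 < eps -> exists2 eta, 0 < eta &
  forall n (a : nat -> R) (X : omega n -> R), measurable_fun setT X ->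
  \sum_(1 <= j < n.+1) a j ^+ 2 = 1 ->
  (forall j, (1 <= j <= n)%N -> a j ^+ 2 <= eta) ->
  (\int[omegaP n]_w (`|X w - clin a w|)%:E <= eta%:E)%E ->
  `|fine (\int[omegaP n]_w (f (X w))%:E) - fine (\int[N]_z (f z)%:E)| <= eps.
Proof.
move=> cf [M [_ /(_ (M + 1))]]; rewrite ltrDl => /(_ ltr01) /=.
set B := M + 1 => fB' eps e0.
have {fB'}fB x : `|f x| <= B by exact: fB'.
have mf : measurable_fun setT f by exact: continuous_measurable_fun.
have cs s : continuous (fun x => B + s * f x).
  move=> x; apply: cvgD; first exact: cvg_cst.
  by apply: cvgM; [exact: cvg_cst|exact: cf].
have b1 x : 0 <= B + 1 * f x /\ B + 1 * f x <= 2 * B.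
  by have := fB x; rewrite ler_norml => /andP[? ?]; split; lra.
have b2 x : 0 <= B + -1 * f x /\ B + -1 * f x <= 2 * B.
  by have := fB x; rewrite ler_norml => /andP[? ?]; split; lra.
have [eta1 eta10 h1] := continuous_lower (cs 1) (fun x => (b1 x).1) (fun x => (b1 x).2) e0.
have [eta2 eta20 h2] := continuous_lower (cs (-1)) (fun x => (b2 x).1) (fun x => (b2 x).2) e0.
exists (Num.min eta1 eta2); first by rewrite lt_min eta10.
move=> n a X mX a1 asmall XE.
have mfX : measurable_fun setT (fun w => f (X w)) by exact: measurableT_comp.
have small1 j : (1 <= j <= n)%N -> a j ^+ 2 <= eta1.
  by move=> jn; apply: (le_trans (asmall j jn)); rewrite ge_min lexx.
have small2 j : (1 <= j <= n)%N -> a j ^+ 2 <= eta2.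
  by move=> jn; apply: (le_trans (asmall j jn)); rewrite ge_min lexx orbT.
have {}h1 := h1 n a X mX a1 small1 (le_trans XE _).
have {}h2 := h2 n a X mX a1 small2 (le_trans XE _).
move: h1; rewrite lee_fin ge_min lexx => /(_ isT).
move: h2; rewrite lee_fin ge_min lexx orbT => /(_ isT).
rewrite (@integral_bounded_shift _ _ N f B B _ mf fB) (@integral_bounded_shift _ _ N f B B _ mf fB).
rewrite (@integral_bounded_shift _ _ (omegaP n) (f \o X) B B _ mfX (fun w => fB (X w))).
rewrite (@integral_bounded_shift _ _ (omegaP n) (f \o X) B B _ mfX (fun w => fB (X w))).
have finN : (\int[N]_z (f z)%:E)%E \is a fin_num.
  by apply: integrable_fin_num => //;
    exact: (@integrable_bounded _ (measurableTypeR R) N f B mf fB).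
have finX : (\int[omegaP n]_w ((f \o X) w)%:E)%E \is a fin_num.
  apply: integrable_fin_num => //.
  exact: (@integrable_bounded _ _ (omegaP n) (f \o X) B mfX (fun w => fB (X w))).
rewrite -(fineK finN) -(fineK finX) -!EFinM -!EFinD !lee_fin /= => h2 h1.
by rewrite ler_norml; apply/andP; split; lra.
Qed.

End weak_limit.

(** * Mean and variance of the times of choice *)

Local Ltac nonneg := repeat first [assumption | exact: ler0n | exact: sqr_ge0 |
  exact: powR_ge0 | exact: normr_ge0 | (apply: ltW; assumption) |
  (rewrite exprn_even_ge0 //; fail) | rewrite invr_ge0 | apply: addr_ge0 | apply: mulr_ge0].

Section harmonic.
Context {R : realType}.

Lemma recip2_ge0 m j : 0 <= recip2 m j :> R.
Proof. by rewrite /recip2; case: ifP. Qed.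

(** The mean and the variance of [lin (recip2 m)] over [omega n]. *)
Definition mean n m : R := \sum_(1 <= j < n.+1) recip2 m j.
Definition var n m : R := \sum_(1 <= j < n.+1) recip2 m j ^+ 2.

Lemma mean_ge n m : (1 <= m <= n)%N -> (m%:R ^+ 2)^-1 <= mean n m.
Proof.
move=> /andP[m1 mn]; rewrite /mean (bigD1_seq m)/= ?iota_uniq ?mem_index_iota ?m1//.
rewrite /recip2 leqnn natrX lerDl sumr_ge0// => j _.
by case: ifP.
Qed.

Lemma mean_gt0 n m : (1 <= m <= n)%N -> 0 < mean n m.
Proof.
move=> h; apply: lt_le_trans (mean_ge h); case/andP: h => m1 _.
by rewrite invr_gt0 exprn_gt0// ltr0n.
Qed.

Lemma mean_small n m : (n < m)%N -> mean n m = 0.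
Proof.
move=> nm; rewrite /mean big_nat big1// => j /andP[_ jn].
by rewrite /recip2 leqNgt (leq_ltn_trans _ nm).
Qed.

Lemma meanS n m : mean n.+1 m = mean n m + recip2 m n.+1.
Proof. by rewrite /mean big_nat_recr. Qed.

(** Comparison of [1 / j ^ 2] with [1 / j - 1 / (j + 1)]. *)
Lemma mean_lower n m : (1 <= m <= n.+1)%N -> m%:R^-1 - n.+1%:R^-1 <= mean n m :> R.
Proof.
move=> /andP[m1]; elim: n => [|n IH] mn.
  have -> : m = 1%N by apply/eqP; rewrite eqn_leq mn.
  by rewrite subrr sumr_ge0// => j _; exact: recip2_ge0.
move: mn; rewrite leq_eqVlt => /predU1P[->|mn].
  by rewrite subrr sumr_ge0// => j _; exact: recip2_ge0.
rewrite meanS /recip2 -ltnS mn natrX.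
have := IH mn; rewrite -(natr1 n.+1).
set x : R := n.+1%:R; have x0 : 0 < x by rewrite ltr0n.
have : x^-1 - (x + 1)^-1 <= (x ^+ 2)^-1.
  have -> : x^-1 - (x + 1)^-1 = (x * (x + 1))^-1 by field; rewrite !gt_eqF//; lra.
  by rewrite lef_pV2 ?posrE ?mulr_gt0// ?expr2 ?ler_wpM2l ?ltW//; lra.
move: (x^-1) ((x + 1)^-1) ((x ^+ 2)^-1) (m%:R^-1 : R) (mean n m) => *; lra.
Qed.

(** Comparison of [1 / j ^ 2] with [1 / (j - 1) - 1 / j], for all terms but the
first. *)
Lemma mean_upper_sharp n m : (1 <= m <= n)%N ->
  mean n m <= (m%:R ^+ 2)^-1 + m%:R^-1 - n%:R^-1 :> R.
Proof.
move=> /andP[m1]; elim: n => [|n IH]; first by rewrite leqn0 => /eqP m0; rewrite m0 in m1.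
rewrite leq_eqVlt => /predU1P[mE|].
  by rewrite meanS mean_small ?mE// add0r /recip2 leqnn natrX addrK.
rewrite ltnS => mn; rewrite meanS /recip2 (leq_trans mn)// natrX.
have n0 : (0 < n)%N by apply: leq_trans mn.
have := IH mn; rewrite -(natr1 n).
set x : R := n%:R; have x0 : 0 < x by rewrite ltr0n.
have : ((x + 1) ^+ 2)^-1 <= x^-1 - (x + 1)^-1.
  have -> : x^-1 - (x + 1)^-1 = (x * (x + 1))^-1 by field; rewrite !gt_eqF//; lra.
  have x10 : 0 < x + 1 by lra.
  by rewrite lef_pV2 ?posrE ?mulr_gt0 ?exprn_gt0// expr2 ler_wpM2r ?(ltW x10)//; lra.
move: (x^-1) ((x + 1)^-1) (((x + 1) ^+ 2)^-1) ((m%:R ^+ 2)^-1 : R) (m%:R^-1 : R) (mean n m) =>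
  *; lra.
Qed.

Lemma mean_upper n m : (1 <= m)%N -> mean n m <= 2 / m%:R.
Proof.
move=> m1; have [nm|mn] := ltnP n m; first by rewrite mean_small// divr_ge0.
have mn' : (1 <= m <= n)%N by rewrite m1.
apply: (le_trans (mean_upper_sharp mn')).
have n0 : 0 <= n%:R^-1 :> R by rewrite invr_ge0.
have : (m%:R ^+ 2)^-1 <= m%:R^-1 :> R.
  by rewrite expr2 invfM ler_piMl ?invr_ge0// invf_le1 ?ltr0n// ler1n.
lra.
Qed.

Lemma var_le n m : (1 <= m)%N -> var n m <= mean n m / m%:R ^+ 2.
Proof.
move=> m1; rewrite /mean mulr_suml; apply: ler_sum => j _.
rewrite expr2 ler_wpM2l ?recip2_ge0// /recip2.
case: ifPn => mj; last by rewrite invr_ge0 exprn_ge0.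
rewrite natrX lef_pV2 ?posrE ?exprn_gt0 ?ltr0n// ?ler_pXn2r ?nnegrE// ?ler_nat//.
exact: leq_trans mj.
Qed.

Lemma var_ge0 n m : 0 <= var n m.
Proof. by apply: sumr_ge0 => j _; exact: sqr_ge0. Qed.

(** The sum is compared with the integral of [x ^ (- a)] on the interval from 0 to [n];
each step is the concavity of [x ^ (1 - a)]. *)
Lemma sum_powR_le (a : R) n : 0 < a < 1 ->
  \sum_(1 <= m < n.+1) m%:R `^ (- a) <= n%:R `^ (1 - a) / (1 - a).
Proof.
move=> /andP[a0 a1]; have c0 : 0 < 1 - a by rewrite subr_gt0.
elim: n => [|n IH].
  by rewrite big_geq// divr_ge0 ?powR_ge0// ltW.
rewrite big_nat_recr//=; apply: (le_trans (lerD IH (lexx _))).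
rewrite ler_pdivlMr// mulrDl divfK ?gt_eqF//.
set x : R := n.+1%:R; have x0 : 0 < x by rewrite ltr0n.
have nx : n%:R = x * (n%:R / x) by rewrite mulrCA divff ?mulr1 ?gt_eqF.
have y0 : 0 <= n%:R / x by rewrite divr_ge0// ltW.
have t : (n%:R / x) `^ (1 - a) <= 1 + (1 - a) * (n%:R / x - 1).
  by apply: powR_tangent => //; apply/andP; split; lra.
rewrite nx powRM ?(ltW x0)//.
have -> : x `^ (- a) = x `^ (1 - a) / x.
  by rewrite -[X in _ / X]powRr1 ?(ltW x0)// -powRN -powRD ?(gt_eqF x0) ?implybT//;
    congr (_ `^ _); ring.
have nx1 : n%:R = x - 1 by rewrite /x -natr1 addrK.
have := ler_wpM2l (powR_ge0 x (1 - a)) t; rewrite nx1.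
have -> : (x - 1) / x - 1 = - x^-1 by field; rewrite gt_eqF.
move: (x `^ (1 - a)) (x^-1) (((x - 1) / x) `^ (1 - a)) => *; lra.
Qed.

End harmonic.

(** * Linearisation of the cost *)

Section second_moment.
Context {R : realType}.

Lemma weighted_cauchy_schwarz (x c : nat -> R) n : (forall m, (1 <= m <= n)%N -> 0 < c m) ->
  (\sum_(1 <= m < n.+1) x m) ^+ 2 <=
  (\sum_(1 <= m < n.+1) c m) * \sum_(1 <= m < n.+1) x m ^+ 2 / c m.
Proof.
elim: n => [|n IH] c0; first by rewrite !big_geq// expr0n mul0r.
have c0n m : (1 <= m <= n)%N -> 0 < c m.
  by move=> /andP[m1 mn]; apply: c0; rewrite m1 ltnW.
have cn : 0 < c n.+1 by apply: c0; rewrite leqnn.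
have := IH c0n; rewrite !(big_nat_recr n.+1)//=.
have : 0 <= \sum_(1 <= m < n.+1) c m.
  by rewrite big_nat sumr_ge0// => m; rewrite ltnS => /c0n/ltW.
have : 0 <= \sum_(1 <= m < n.+1) x m ^+ 2 / c m.
  by rewrite big_nat sumr_ge0// => m; rewrite ltnS => /c0n/ltW cm; rewrite divr_ge0// sqr_ge0.
move: (\sum_(1 <= m < n.+1) c m) (\sum_(1 <= m < n.+1) x m) => C X.
move: (\sum_(1 <= m < n.+1) _) (x n.+1) => S y S0.
rewrite le_eqVlt => /predU1P[<-|C0 XS].
  rewrite mul0r => X2; have -> : X = 0.
    by apply/eqP; rewrite -sqrf_eq0 eq_le X2 sqr_ge0.
  by rewrite !add0r mulrDr mulrCA divff ?gt_eqF// mulr1 lerDr mulr_ge0// ltW.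
have S1 : X ^+ 2 / C <= S by rewrite ler_pdivrMr// mulrC.
have Cc : 0 <= C + c n.+1 by rewrite addr_ge0// ltW.
apply: (@le_trans _ _ ((C + c n.+1) * (X ^+ 2 / C + y ^+ 2 / c n.+1))); last first.
  by rewrite ler_wpM2l// lerD2r.
rewrite -subr_ge0 (_ : _ - _ = (c n.+1 * X - C * y) ^+ 2 / (C * c n.+1)).
  by rewrite divr_ge0 ?sqr_ge0// mulr_ge0// ltW.
by field; rewrite !gt_eqF.
Qed.

(** The triangle inequality in L2, for variables with norms of order [c m], by the
Cauchy-Schwarz inequality with weights [c m]. *)
Lemma integral_sum_square d (T : measurableType d) (P : probability T R)
    (x : nat -> T -> R) (c : nat -> R) n K :
  (forall m, measurable_fun setT (x m)) -> (forall m, 0 <= c m) ->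
  (forall m, (1 <= m <= n)%N -> 0 < c m) ->
  (forall m, (1 <= m <= n)%N -> (\int[P]_t (x m t ^+ 2)%:E <= (K * c m ^+ 2)%:E)%E) ->
  (\int[P]_t ((\sum_(1 <= m < n.+1) x m t) ^+ 2)%:E <=
   (K * (\sum_(1 <= m < n.+1) c m) ^+ 2)%:E)%E.
Proof.
move=> mx c00 c0 xK; set C := \sum_(1 <= m < n.+1) c m.
have C0 : (0 <= C%:E)%E by rewrite lee_fin sumr_ge0.
have mx2 m : measurable_fun setT (fun t => (x m t ^+ 2)%:E).
  by apply/measurable_EFinP; exact: measurable_funX.
have mx2c m : measurable_fun setT (fun t => ((c m)^-1%:E * (x m t ^+ 2)%:E)%E).
  exact: emeasurable_funM.
have x2 m t : (0 <= (x m t ^+ 2)%:E)%E by rewrite lee_fin sqr_ge0.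
have ci m : (0 <= (c m)^-1%:E)%E by rewrite lee_fin invr_ge0.
have x2c m t : (0 <= (c m)^-1%:E * (x m t ^+ 2)%:E)%E by rewrite mule_ge0.
have msum : measurable_fun setT (fun t => \sum_(1 <= m < n.+1) ((c m)^-1%:E * (x m t ^+ 2)%:E))%E.
  exact: emeasurable_sum.
have sum0 t : (0 <= \sum_(1 <= m < n.+1) ((c m)^-1%:E * (x m t ^+ 2)%:E))%E.
  by apply: sume_ge0.
apply: (@le_trans _ _ (\int[P]_t (C%:E * \sum_(1 <= m < n.+1) ((c m)^-1%:E * (x m t ^+ 2)%:E)))%E).
  apply: ge0_le_integral => //.
  - by move=> t _; rewrite lee_fin sqr_ge0.
  - by apply/measurable_EFinP; apply: measurable_funX; exact: measurable_sum.
  - exact: emeasurable_funM.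
  - move=> t _; have -> : (\sum_(1 <= m < n.+1) ((c m)^-1%:E * (x m t ^+ 2)%:E) =
        (\sum_(1 <= m < n.+1) x m t ^+ 2 / c m)%:E)%E.
      by rewrite -sumEFin; apply: eq_bigr => m _; rewrite -EFinM mulrC.
    by rewrite -EFinM lee_fin; exact: weighted_cauchy_schwarz.
rewrite ge0_integralZl// ge0_integral_sum//.
have -> : K * C ^+ 2 = C * (K * C) by ring.
rewrite [leRHS]EFinM; apply: lee_wpmul2l => //.
apply: (@le_trans _ _ (\sum_(1 <= m < n.+1) (K * c m)%:E)%E); last first.
  by rewrite sumEFin lee_fin -mulr_sumr.
rewrite big_nat [leRHS]big_nat; apply: lee_sum => m; rewrite ltnS => mn.
rewrite ge0_integralZl//; apply: (le_trans (lee_wpmul2l _ (xK m mn))) => //.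
by rewrite -EFinM lee_fin mulrCA expr2 mulKf// gt_eqF// c0.
Qed.

Lemma lin_sum (c : nat -> R) (f : nat -> nat -> R) (r : seq nat) k (w : omega k) :
  lin (fun j => \sum_(m <- r) c m * f m j) w = \sum_(m <- r) c m * lin (f m) w.
Proof.
elim: k w => [|k IH] w /=; first by rewrite big1// => m _; rewrite mulr0.
rewrite IH mulr_suml -big_split /=; apply: eq_bigr => m _.
by rewrite mulrDr mulrA.
Qed.

Lemma linB (f g : nat -> R) k (w : omega k) :
  lin (fun j => f j - g j) w = lin f w - lin g w.
Proof. by elim: k w => [|k IH] w /=; [rewrite subrr|rewrite IH; ring]. Qed.

Lemma clin_sum (c : nat -> R) (f : nat -> nat -> R) (r : seq nat) k (w : omega k) :
  clin (fun j => \sum_(m <- r) c m * f m j) w = \sum_(m <- r) c m * clin (f m) w.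
Proof.
rewrite /clin lin_sum exchange_big -sumrB; apply: eq_bigr => m _.
by rewrite -mulr_sumr mulrBr.
Qed.

(** The negative part of [y + lin a w] has integral zero for each [y >= 0], by
induction on the number of variables. *)
Lemma omega_lin_ge0 (a : nat -> R) k : (forall j, 0 <= a j) ->
  {ae omegaP k, forall w, 0 <= lin a w}.
Proof.
move=> a0.
have mneg j y : measurable_fun setT (fun w : omega j => (Num.max 0 (- (y + lin a w)))%:E).
  apply/measurable_EFinP; apply: measurable_maxr => //; apply: measurableT_comp => //.
  by apply: measurable_funD => //; exact: measurable_lin.
have neg0 j y (w : omega j) : (0 <= (Num.max 0 (- (y + lin a w)))%:E)%E.
  by rewrite lee_fin le_max lexx.
have I y : 0 <= y -> (\int[omegaP k]_w (Num.max 0 (- (y + lin a w)))%:E = 0)%E.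
  elim: k y => [|k IH] y y0.
    by rewrite integral_omega0/= addr0 max_l// oppr_le0.
  rewrite integral_omegaS//.
  have mF : measurable_fun setT (fun e : measurableTypeR R =>
      \int[omegaP k]_w (Num.max 0 (- (y + @lin _ a k.+1 (e, w))))%:E)%E.
    exact: (measurable_fun_fubini_tonelli_F (m2 := omegaP k) _ (mneg k.+1 y)).
  transitivity (\int[expo R]_e (0%E : \bar R))%E; last exact: integral0.
  apply: ae_eq_integral => //.
  have [N [mN N0 NS]] := @expo_ge0 R; exists N; split => //.
  apply: subset_trans NS => e nh e0; apply: nh => _.
  under eq_integral do rewrite /= addrA.
  by rewrite IH// addr_ge0// mulr_ge0.
have : (\int[omegaP k]_w `|(Num.max 0 (- (0 + lin a w)))%:E| = 0)%E.
  rewrite -[RHS](I 0 (lexx _)); apply: eq_integral => w _.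
  by rewrite gee0_abs.
move=> /(ae_eq_integral_abs (omegaP k) measurableT (mneg k 0)).
apply: filterS => w /= /(_ Logic.I) [].
by rewrite add0r => h; rewrite -oppr_le0 -h le_max lexx orbT.
Qed.

End second_moment.

Section approximation.
Context {R : realType}.
Variables (G : R -> R) (p a K u0 : R).
Hypotheses (p01 : 0 < p < 1) (a01 : 0 < a < 1) (K0 : 0 < K) (u00 : 0 < u0).
Hypotheses (mG : measurable_fun setT G) (G0 : forall u, 0 <= G u)
  (G_nd : forall u v, u <= v -> G u <= G v).
Hypothesis Gnear0 : forall u, 0 < u <= u0 -> `|G u - u `^ p| <= K * u `^ a.
Hypothesis G00 : G 0 = 0.
Hypothesis G4 : (\int[expo R]_u (G u ^+ 4)%:E < +oo)%E.

Let J := fine (\int[expo R]_u (G u ^+ 4)%:E).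

(** The linear approximation is that of the power [u ^ p], to which [G] is close near
0. *)
Definition taylor_error s D := G (s + D) - (s `^ p + p * (s `^ p / s) * D).

Let c1 := 2 / u0 ^+ 2 + u0^-1.

(** Below [u0], the error is the second order term of the power plus the difference
[K (s + D) ^ a] between [G] and the power. Above [u0], [G] is only known to be at most
[G1], which will be its value at the last time; there [G1 ^ 2] is bounded by
[G1 ^ 4 / M ^ 2 + M ^ 2] and the indicator of [s + D > u0] is bounded by
[(s + D) ^ 4 / u0 ^ 4]. Since [s + D] will be of order [1 / M], both terms are then of
order [1 / M ^ 2]. *)
Lemma taylor_error_le (s D G1 M : R) : 0 < s -> 0 < M -> 0 <= s + D -> G (s + D) <= G1 ->
  taylor_error s D ^+ 2 <= 3 * ((s `^ p / s ^+ 2) ^+ 2 * D ^+ 4) +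
   4 * K ^+ 2 * ((s `^ a) ^+ 2 + (s `^ a / s) ^+ 2 * D ^+ 2) +
   2 * (G1 ^+ 4 / M ^+ 2 + M ^+ 2 * (s + D) ^+ 4 / u0 ^+ 4) + 3 * c1 ^+ 2 * (s + D) ^+ 4.
Proof.
move=> s0 M0; set S := s + D => S0 GG1.
have /andP[p0 p1] := p01; have /andP[a0 a1] := a01.
have sne : s != 0 by rewrite gt_eqF.
have Ss : S / s - 1 = D / s by rewrite /S; field.
have y0 : 0 <= S / s by rewrite divr_ge0// ltW.
have SE : S = s * (S / s) by rewrite mulrCA divff ?mulr1.
(* second order expansion of the power *)
pose A := s `^ p / s ^+ 2 * D ^+ 2.
have A0 : 0 <= A by rewrite mulr_ge0 ?sqr_ge0// divr_ge0 ?powR_ge0// sqr_ge0.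
have hA : `|S `^ p - (s `^ p + p * (s `^ p / s) * D)| <= A.
  have t := @powR_tangent_error R p _ (ltac:(by rewrite !ltW)) y0.
  rewrite SE powRM ?(ltW s0)//.
  rewrite (_ : _ - _ = s `^ p * ((S / s) `^ p - (1 + p * (S / s - 1)))); last by rewrite Ss; field.
  rewrite normrM ger0_norm ?powR_ge0//; apply: (le_trans (ler_wpM2l (powR_ge0 _ _) t)).
  by rewrite Ss /A le_eqVlt; apply/orP; left; apply/eqP; field.
have A2 : A ^+ 2 = (s `^ p / s ^+ 2) ^+ 2 * D ^+ 4 by rewrite /A exprMn -exprM.
have G10 : 0 <= G1 by apply: le_trans GG1.
have S4 : 0 <= S ^+ 4 by rewrite exprn_ge0.
have q1 : 0 <= 4 * K ^+ 2 * ((s `^ a) ^+ 2 + (s `^ a / s) ^+ 2 * D ^+ 2).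
  apply: mulr_ge0; first by apply: mulr_ge0 => //; exact: sqr_ge0.
  by apply: addr_ge0; [exact: sqr_ge0|apply: mulr_ge0; exact: sqr_ge0].
have q2 : 0 <= 2 * (G1 ^+ 4 / M ^+ 2 + M ^+ 2 * S ^+ 4 / u0 ^+ 4).
  apply: mulr_ge0 => //; apply: addr_ge0; apply: divr_ge0;
    rewrite ?exprn_ge0 ?(ltW M0) ?(ltW u00)//.
  by apply: mulr_ge0 => //; exact: sqr_ge0.
have q3 : 0 <= 3 * c1 ^+ 2 * S ^+ 4.
  by apply: mulr_ge0 => //; apply: mulr_ge0 => //; exact: sqr_ge0.
have [B [B0 hB B2]] : exists B, [/\ 0 <= B, `|G S - S `^ p| <= B & (A + B) ^+ 2 <= 3 * A ^+ 2 +
    (4 * K ^+ 2 * ((s `^ a) ^+ 2 + (s `^ a / s) ^+ 2 * D ^+ 2) +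
     2 * (G1 ^+ 4 / M ^+ 2 + M ^+ 2 * S ^+ 4 / u0 ^+ 4) + 3 * c1 ^+ 2 * S ^+ 4)].
  (* near 0, or beyond the range of the approximation of [G] by a power *)
  have [Su|Su] := leP S u0.
    exists (K * (s `^ a + s `^ a / s * `|D|)).
    have b0 : 0 <= K * (s `^ a + s `^ a / s * `|D|).
      by rewrite mulr_ge0 ?(ltW K0)// addr_ge0 ?mulr_ge0 ?invr_ge0 ?powR_ge0 ?(ltW s0).
    split => //.
      have [SS|SS] := ltP 0 S; last first.
        have -> : S = 0 by apply/eqP; rewrite eq_le SS.
        by rewrite G00 powR0 ?gt_eqF// subrr normr0.
      apply: (le_trans (Gnear0 _)); first by rewrite SS.
      rewrite ler_wpM2l ?(ltW K0)//.
      have t := @powR_sub1_le R a _ (ltac:(by rewrite !ltW)) y0.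
      rewrite {1}SE powRM ?(ltW s0)//.
      rewrite [leRHS](_ : _ = s `^ a * (1 + `|D / s|)); last first.
        by rewrite normrM normfV (gtr0_norm s0); field.
      rewrite ler_wpM2l ?powR_ge0//; move: t; rewrite Ss ler_norml => /andP[_]; lra.
    have B2 : (K * (s `^ a + s `^ a / s * `|D|)) ^+ 2 <=
        2 * K ^+ 2 * ((s `^ a) ^+ 2 + (s `^ a / s) ^+ 2 * D ^+ 2).
      pose y := s `^ a / s * `|D|.
      have -> : (s `^ a / s) ^+ 2 * D ^+ 2 = y ^+ 2 by rewrite /y [RHS]exprMn real_normK ?num_real.
      rewrite -/y; have := mulr_ge0 (sqr_ge0 K) (sqr_ge0 (s `^ a - y)); move: (s `^ a) y => x y;
        lra.
    set B := K * _ in b0 B2 *; have := sqr_ge0 (A - B); nra.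
  exists (G1 + c1 * S ^+ 2).
  have SS : 0 < S by apply: lt_trans Su.
  have c10 : 0 <= c1 by rewrite addr_ge0 ?divr_ge0 ?invr_ge0 ?sqr_ge0// ltW.
  have hS : S `^ p <= c1 * S ^+ 2.
    have := @powR_sub1_le R p S (ltac:(by rewrite !ltW)) S0; rewrite ler_norml => /andP[_ t].
    have t2 : `|S - 1| <= S + 1 by rewrite ler_norml; apply/andP; split; lra.
    have r1 : 1 <= S / u0 by rewrite ler_pdivlMr// mul1r ltW.
    have : S <= S * (S / u0) by rewrite ler_peMr.
    have : 1 <= (S / u0) * (S / u0) by rewrite -[leLHS]mul1r ler_pM.
    have -> : c1 * S ^+ 2 = 2 * ((S / u0) * (S / u0)) + S * (S / u0) by rewrite /c1; field;
      rewrite gt_eqF.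
    lra.
  split.
  - by rewrite addr_ge0// mulr_ge0// sqr_ge0.
  - rewrite ler_norml; apply/andP; split; have := G0 S; have := powR_ge0 S p; lra.
  have G12 : G1 ^+ 2 <= (G1 ^+ 4 / M ^+ 2 + M ^+ 2 * S ^+ 4 / u0 ^+ 4) / 2.
    apply: (@le_trans _ _ ((G1 ^+ 4 / M ^+ 2 + M ^+ 2) / 2)).
      have := sqr_ge0 (G1 ^+ 2 / M - M).
      rewrite sqrrB expr_div_n -exprM (_ : G1 ^+ 2 / M * M = G1 ^+ 2) ?divfK ?gt_eqF//; lra.
    rewrite ler_wpM2r// lerD2l -mulrA ler_peMr ?sqr_ge0// ler_pdivlMr ?exprn_gt0// mul1r.
    by rewrite ler_pXn2r ?nnegrE ?ltW.
  have -> : 3 * c1 ^+ 2 * S ^+ 4 = 3 * (c1 * S ^+ 2) ^+ 2 by ring.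
  move: q1 q2 G12; set q := G1 ^+ 4 / M ^+ 2 + _; set q' := 4 * K ^+ 2 * _; set E := c1 * S ^+ 2.
  clearbody q q' E A => q1 q2 G12.
  have := sqr_ge0 (A - G1); have := sqr_ge0 (A - E); have := sqr_ge0 (G1 - E); lra.
rewrite -A2 /taylor_error -/S.
have h : `|G S - (s `^ p + p * (s `^ p / s) * D)| <= A + B.
  rewrite (_ : _ - _ = (S `^ p - (s `^ p + p * (s `^ p / s) * D)) + (G S - S `^ p)); last by ring.
  by rewrite (le_trans (ler_normD _ _))// lerD.
rewrite -(real_normK (num_real (G S - _))).
apply: (@le_trans _ _ ((A + B) ^+ 2)); last by rewrite -!addrA addrA -!addrA in B2 *; lra.
by rewrite ler_pXn2r ?nnegrE// addr_ge0.
Qed.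

(** The order of magnitude of the L2 norm of the error made on the edge number [m]
from the end. The second term comes from the first edges chosen: there the mean
[s_m ~ 1 / m - 1 / n] is small, and the power is far from linear. *)
Definition weight n m : R := m%:R `^ (- a) + (n.+1 - m)%:R `^ (- a).

Lemma weight_ge0 n m : 0 <= weight n m.
Proof. by rewrite addr_ge0 ?powR_ge0. Qed.

Let inv_le_powR (k : nat) : (0 < k)%N -> k%:R^-1 <= k%:R `^ (- a) :> R.
Proof.
move=> k0; rewrite -powR_inv1// ler_powR ?ler1n//.
by have /andP[_ a1] := a01; rewrite lerN2 ltW.
Qed.

Lemma weight_gt0 n m : (1 <= m <= n)%N -> 0 < weight n m.
Proof.
by move=> /andP[m1 _]; rewrite ltr_pwDl ?powR_ge0// powR_gt0// ltr0n.
Qed.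

(** With [M = m] and [k = n + 1 - m], the mean is at least [k / (M (M + k))], and
[(M + k) / (k M) = 1 / M + 1 / k]. *)
Lemma inv_mean_le n m : (1 <= m <= n)%N ->
  (mean n m)^-1 / m%:R ^+ 2 <= weight n m.
Proof.
move=> mn; have /andP[m1 mn'] := mn.
have l : m%:R^-1 - n.+1%:R^-1 <= mean n m :> R.
  by apply: mean_lower; rewrite m1 ltnW.
have nm0 : (0 < n.+1 - m)%N by rewrite subn_gt0.
apply: (@le_trans _ _ (m%:R^-1 + (n.+1 - m)%:R^-1)); last by rewrite lerD// inv_le_powR.
have nE : n.+1%:R = m%:R + (n.+1 - m)%:R :> R by rewrite -natrD subnKC// ltnW.
move: l; rewrite nE; set M : R := m%:R; set k : R := (_ - _)%:R.
have M0 : 0 < M by rewrite ltr0n.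
have k0 : 0 < k by rewrite ltr0n.
have -> : M^-1 - (M + k)^-1 = k / (M * (M + k)) by field; rewrite !gt_eqF//; lra.
move=> l; have l0 : 0 < k / (M * (M + k)) by rewrite divr_gt0// mulr_gt0//; lra.
have -> : M^-1 + k^-1 = (k / (M * (M + k)))^-1 / M ^+ 2 by field; rewrite !gt_eqF//; lra.
rewrite ler_wpM2r ?invr_ge0 ?sqr_ge0// lef_pV2// posrE//.
exact: lt_le_trans l.
Qed.

Definition error_cst := 32 * K ^+ 2 + 156 + 1088 / u0 ^+ 4 + 1632 * c1 ^+ 2 + 4 * J.

Let J0 : 0 <= J.
Proof.
by rewrite fine_ge0// integral_ge0// => u _; rewrite lee_fin exprn_even_ge0.
Qed.

(** The expectation of the bound of [taylor_error_le], where [D] has variance [v] and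
fourth moment at most [13 v ^ 2]. Since [v <= s / m ^ 2], the relative variance
[v / s ^ 2] is at most [1 / (s m ^ 2)], which [inv_mean_le] compares with the weight;
all other terms are at most a constant times [m ^ (- 2 a)]. *)
Lemma moment_bound n m s v M : (1 <= m <= n)%N ->
  s = mean n m -> v = var n m -> M = m%:R ->
  4 * K ^+ 2 * ((s `^ a) ^+ 2 + (s `^ a / s) ^+ 2 * v) + 39 * (s `^ p / s ^+ 2) ^+ 2 * v ^+ 2
  + 8 * (2 * M ^+ 2 / u0 ^+ 4 + 3 * c1 ^+ 2) * (s ^+ 4 + 13 * v ^+ 2) + 4 * J / M ^+ 2
  <= error_cst * weight n m ^+ 2.
Proof.
move=> mn sE vE ME; have /andP[m1 mn'] := mn.
have /andP[p0 p1] := p01; have /andP[a0 a1] := a01.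
have s0 : 0 < s by rewrite sE mean_gt0.
have sM2 : (M ^+ 2)^-1 <= s by rewrite sE ME mean_ge.
have s2M : s <= 2 / M by rewrite sE ME mean_upper.
have vs : v <= s / M ^+ 2 by rewrite sE vE ME var_le.
have v0 : 0 <= v by rewrite vE var_ge0.
have M1 : 1 <= M by rewrite ME ler1n.
have M0 : 0 < M by lra.
have W := inv_mean_le mn; rewrite -sE -ME in W.
set w := weight n m in W *; have w0 : 0 <= w by exact: weight_ge0.
have Mw : M^-1 <= w by rewrite ME (le_trans (inv_le_powR _))// lerDl powR_ge0.
have Maw : M `^ (- a) <= w by rewrite ME lerDl powR_ge0.
have M20 : 0 < M ^+ 2 by rewrite exprn_gt0.
have M2w : (M ^+ 2)^-1 <= w ^+ 2.
  by rewrite -exprVn ler_pXn2r ?nnegrE// invr_ge0 ltW.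
have s2 : s <= 2.
  by rewrite (le_trans s2M)// ler_pdivrMr//; lra.
have sa : s `^ a <= 2 * w.
  apply: (@le_trans _ _ ((2 / M) `^ a)).
    by rewrite ge0_ler_powR ?nnegrE ?(ltW a0) ?(ltW s0) ?divr_ge0 ?(ltW M0).
  rewrite powRM ?invr_ge0 ?(ltW M0)// ler_pM ?powR_ge0//.
    by rewrite -[leRHS]powRr1// ler_powR ?ler1n// ltW.
  by rewrite -powR_inv1 ?(ltW M0)// -powRrM mulN1r.
have T1 : (s `^ a) ^+ 2 + (s `^ a / s) ^+ 2 * v <= 8 * w ^+ 2.
  have : (s `^ a / s) ^+ 2 * v <= (s `^ a) ^+ 2.
    rewrite expr_div_n -mulrA ler_piMr ?sqr_ge0//.
    rewrite mulrC ler_pdivrMr ?exprn_gt0// mul1r (le_trans vs)// expr2 ler_wpM2l// ltW//.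
  have : (s `^ a) ^+ 2 <= (2 * w) ^+ 2 by rewrite ler_pXn2r ?nnegrE ?powR_ge0 ?mulr_ge0.
  lra.
have T2 : (s `^ p / s ^+ 2) ^+ 2 * v ^+ 2 <= 4 * w ^+ 2.
  rewrite -exprMn (_ : 4 * w ^+ 2 = (2 * w) ^+ 2); last by ring.
  rewrite ler_pXn2r ?nnegrE ?mulr_ge0 ?invr_ge0 ?sqr_ge0 ?powR_ge0//.
  apply: (@le_trans _ _ (s `^ p * (s^-1 / M ^+ 2))).
    rewrite -mulrA ler_wpM2l ?powR_ge0// mulrC ler_pdivrMr ?exprn_gt0//.
    by apply: (le_trans vs); rewrite le_eqVlt; apply/orP; left; apply/eqP; field; rewrite !gt_eqF.
  rewrite ler_pM ?powR_ge0 ?mulr_ge0 ?invr_ge0 ?(ltW s0) ?(ltW M20)//.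
  apply: (@le_trans _ _ (2 `^ p)).
    by rewrite ge0_ler_powR ?nnegrE ?(ltW p0) ?(ltW s0).
  by rewrite -[leRHS]powRr1// ler_powR ?ler1n// ltW.
have T3 : (2 * M ^+ 2 / u0 ^+ 4 + 3 * c1 ^+ 2) * (s ^+ 4 + 13 * v ^+ 2) <=
    68 * (2 / u0 ^+ 4 + 3 * c1 ^+ 2) * w ^+ 2.
  have i0 : 0 <= (M ^+ 2)^-1 by rewrite invr_ge0 ltW.
  have i1 : (M ^+ 2)^-1 <= 1 by rewrite invf_le1// exprn_ege1.
  have h1 : s ^+ 4 <= 16 * (M ^+ 2)^-1 ^+ 2.
    rewrite [leRHS](_ : _ = (2 / M) ^+ 4); last by field; rewrite gt_eqF.
    by rewrite ler_pXn2r ?nnegrE ?divr_ge0 ?(ltW s0) ?(ltW M0).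
  have h2 : v ^+ 2 <= 4 * (M ^+ 2)^-1 ^+ 2.
    rewrite [leRHS](_ : _ = (2 / M ^+ 2) ^+ 2); last by field; rewrite gt_eqF.
    rewrite ler_pXn2r ?nnegrE ?divr_ge0 ?(ltW M20)// (le_trans vs)// ler_wpM2r//.
  have h3 : s ^+ 4 + 13 * v ^+ 2 <= 68 * (M ^+ 2)^-1 ^+ 2 by lra.
  have u4 : 0 <= u0 ^- 4 by rewrite invr_ge0 exprn_ge0// ltW.
  have L0 : 0 <= 2 * M ^+ 2 / u0 ^+ 4 + 3 * c1 ^+ 2.
    by nonneg.
  apply: (le_trans (ler_wpM2l L0 h3)).
  have -> : (2 * M ^+ 2 / u0 ^+ 4 + 3 * c1 ^+ 2) * (68 * (M ^+ 2)^-1 ^+ 2) =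
     68 * (2 / u0 ^+ 4 + 3 * c1 ^+ 2 * (M ^+ 2)^-1) * (M ^+ 2)^-1.
    by field; rewrite !gt_eqF// exprn_gt0.
  apply: ler_pM => //.
    by nonneg.
  by rewrite ler_pM2l// lerD2l ler_piMr//; apply: mulr_ge0 => //; exact: sqr_ge0.
have T4 : 4 * J / M ^+ 2 <= 4 * J * w ^+ 2 by rewrite ler_wpM2l// mulr_ge0.
have K20 := sqr_ge0 K.
rewrite /error_cst.
move: T1 => /(ler_wpM2l K20) T1.
move: T1 T2 T3 T4; move: (s `^ a ^+ 2 + _) ((s `^ p / s ^+ 2) ^+ 2) (2 * M ^+ 2 / u0 ^+ 4 + _)
  (s ^+ 4 + _) (4 * J / _) => x1 x2 x3 x4 x5.
rewrite [1088 / _](_ : _ = 544 * (2 / u0 ^+ 4)); last by ring.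
move: (2 / u0 ^+ 4) (v ^+ 2) (w ^+ 2) (K ^+ 2) (c1 ^+ 2) => y1 y2 y3 y4 y5 *; lra.
Qed.

(** The factor 2 in front of [k5] is the bound of [integral_lin_recip] on the density
of the last time. *)
Let taylor_majorant_integral n m (k0 k2 k4 k5 : R) : 0 <= k0 -> 0 <= k2 -> 0 <= k4 -> 0 <= k5 ->
  (0 < n)%N ->
  (\int[omegaP n]_w (k0%:E + (k2%:E * (clin (recip2 m) w ^+ 2)%:E +
    (k4%:E * (clin (recip2 m) w ^+ 4)%:E + k5%:E * (G (0 + lin (recip2 1) w) ^+ 4)%:E))) <=
  (k0 + (k2 * var n m + (13 * k4 * var n m ^+ 2 + 2 * k5 * J)))%:E)%E.
Proof.
move=> h0 h2 h4 h5 n0.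
have mD j : measurable_fun setT (fun w : omega n => (clin (recip2 m) w ^+ j)%:E).
  by apply/measurable_EFinP; apply: measurable_funX; exact: measurable_clin.
have mG4 : measurable_fun setT (fun u : R => (G u ^+ 4)%:E).
  by apply/measurable_EFinP; exact: measurable_funX.
have mGl : measurable_fun setT (fun w : omega n => (G (0 + lin (recip2 1) w) ^+ 4)%:E).
  by apply: (measurableT_comp mG4); apply: measurable_funD => //; exact: measurable_lin.
have D0 j (w : omega n) : ~~ odd j -> (0 <= (clin (recip2 m) w ^+ j)%:E)%E.
  by move=> oj; rewrite lee_fin exprn_even_ge0.
have D2 (w : omega n) : (0 <= (clin (recip2 m) w ^+ 2)%:E)%E by exact: D0.
have D4 (w : omega n) : (0 <= (clin (recip2 m) w ^+ 4)%:E)%E by exact: D0.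
have GG u : (0 <= (G u ^+ 4)%:E)%E by rewrite lee_fin exprn_ge0.
have e0 : (0 <= k0%:E)%E by rewrite lee_fin.
have e2 : (0 <= k2%:E)%E by rewrite lee_fin.
have e4 : (0 <= k4%:E)%E by rewrite lee_fin.
have e5 : (0 <= k5%:E)%E by rewrite lee_fin.
have t2 (w : omega n) : (0 <= k2%:E * (clin (recip2 m) w ^+ 2)%:E)%E by exact: mule_ge0.
have t4 (w : omega n) : (0 <= k4%:E * (clin (recip2 m) w ^+ 4)%:E)%E by exact: mule_ge0.
have t5 (w : omega n) : (0 <= k5%:E * (G (0 + lin (recip2 1) w) ^+ 4)%:E)%E by exact: mule_ge0.
have m2 : measurable_fun setT (fun w : omega n => k2%:E * (clin (recip2 m) w ^+ 2)%:E)%E.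
  exact: emeasurable_funM.
have m4 : measurable_fun setT (fun w : omega n => k4%:E * (clin (recip2 m) w ^+ 4)%:E)%E.
  exact: emeasurable_funM.
have m5 : measurable_fun setT (fun w : omega n => k5%:E * (G (0 + lin (recip2 1) w) ^+ 4)%:E)%E.
  exact: emeasurable_funM.
rewrite ge0_integralD//; last 2 first.
- by move=> w _; rewrite !adde_ge0.
- by apply: emeasurable_funD => //; exact: emeasurable_funD.
rewrite integral_prob_cst EFinD; apply: leeD => //.
rewrite ge0_integralD//; last 2 first.
- by move=> w _; rewrite !adde_ge0.
- exact: emeasurable_funD.
rewrite EFinD; apply: leeD.
  rewrite ge0_integralZl//.
  have := clin_square (@recip2 R m) 0 n.
  under [X in X = _ -> _]eq_integral do rewrite add0r.
  by move=> ->; rewrite expr0n add0r EFinM.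
rewrite ge0_integralD// EFinD; apply: leeD.
  rewrite ge0_integralZl//; apply: (le_trans (lee_wpmul2l e4 (clin_fourth _ _))).
  by rewrite -EFinM lee_fin -/(var n m) mulrCA mulrA.
rewrite ge0_integralZl//.
case: n n0 {mD D0 mGl D2 D4 t2 t4 t5 m2 m4 m5} => // n _.
have := integral_lin_recip n (lexx (0 : R)) mG4 GG.
move=> /(lee_wpmul2l e5)/le_trans; apply.
have finJ : (\int[expo R]_u (G u ^+ 4)%:E)%E \is a fin_num.
  by rewrite ge0_fin_numE// integral_ge0.
rewrite -(fineK finJ) -/J -!EFinM lee_fin expR0 mulr1.
rewrite (mulrC 2 k5) -!mulrA ler_wpM2l// ler_wpM2l// mulrA ler_piMl//.
by rewrite ler_pdivrMr// mul1r ler_nat.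
Qed.

Lemma taylor_error_integral n m : (1 <= m <= n)%N ->
  (\int[omegaP n]_w (taylor_error (mean n m) (clin (recip2 m) w) ^+ 2)%:E <=
   (error_cst * weight n m ^+ 2)%:E)%E.
Proof.
move=> mn; have /andP[m1 mn'] := mn.
set s := mean n m; set M : R := m%:R.
have s0 : 0 < s by exact: mean_gt0.
have M0 : 0 < M by rewrite ltr0n.
pose L := 2 * M ^+ 2 / u0 ^+ 4 + 3 * c1 ^+ 2;
  have LE : L = 2 * M ^+ 2 / u0 ^+ 4 + 3 * c1 ^+ 2 by [].
have L0 : 0 <= L.
  by rewrite /L; nonneg.
pose k0 := 4 * K ^+ 2 * (s `^ a) ^+ 2 + 8 * L * s ^+ 4.
pose k2 := 4 * K ^+ 2 * (s `^ a / s) ^+ 2.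
pose k4 := 3 * (s `^ p / s ^+ 2) ^+ 2 + 8 * L.
pose k5 := 2 / M ^+ 2.
clearbody L.
have k00 : 0 <= k0 by rewrite /k0; nonneg.
have k20 : 0 <= k2 by rewrite /k2; nonneg.
have k40 : 0 <= k4 by rewrite /k4; nonneg.
have k50 : 0 <= k5 by rewrite divr_ge0// sqr_ge0.
have n0 : (0 < n)%N by exact: leq_trans mn'.
have mcl : measurable_fun setT (fun w : omega n => clin (@recip2 R m) w) by exact: measurable_clin.
have mG4 : measurable_fun setT (fun u : R => (G u ^+ 4)%:E).
  by apply/measurable_EFinP; exact: measurable_funX.
apply: le_trans; last first.
  have := moment_bound mn erefl erefl erefl; rewrite -/s -/M -LE -lee_fin; apply: le_trans.
  apply: le_trans (taylor_majorant_integral m k00 k20 k40 k50 n0) _.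
  rewrite lee_fin /k0 /k2 /k4 /k5 le_eqVlt; apply/orP; left; apply/eqP; ring.
apply: ae_ge0_le_integral => //.
- by move=> w _; rewrite lee_fin sqr_ge0.
- apply/measurable_EFinP; apply: measurable_funX; rewrite /taylor_error; apply: measurable_funB.
    by apply: (measurableT_comp mG); exact: measurable_funD.
  by apply: measurable_funD => //; exact: measurable_funM.
- by move=> w _; rewrite -!EFinM -!EFinD lee_fin; nonneg.
- apply: emeasurable_funD => //; apply: emeasurable_funD.
    by apply: emeasurable_funM => //; apply/measurable_EFinP; exact: measurable_funX.
  apply: emeasurable_funD.
    by apply: emeasurable_funM => //; apply/measurable_EFinP; exact: measurable_funX.
  apply: emeasurable_funM => //; apply: (measurableT_comp mG4).
  by apply: measurable_funD => //; exact: measurable_lin.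
(* almost surely all times are nonnegative and at most the last one *)
have r1 := @omega_lin_ge0 R (recip2 m) n (recip2_ge0 m).
have r21 j : 0 <= recip2 1 j - recip2 m j :> R.
  rewrite subr_ge0 /recip2; case: ifPn => mj; last by case: ifP.
  by rewrite (leq_trans m1 mj).
have r2 := @omega_lin_ge0 R (fun j => recip2 1 j - recip2 m j) n r21.
apply: filterS2 r1 r2 => w; rewrite linB => S0 S1 _.
have SE : s + clin (recip2 m) w = lin (recip2 m) w by rewrite /clin addrC subrK.
have Sge0 : 0 <= s + clin (recip2 m) w by rewrite SE.
have G1 : G (s + clin (recip2 m) w) <= G (0 + lin (recip2 1) w).
  by apply: G_nd; rewrite SE add0r -subr_ge0.
rewrite -!EFinM -!EFinD lee_fin.
apply: (le_trans (taylor_error_le s0 M0 Sge0 G1)).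
set D := clin (recip2 m) w.
have S4 : (s + D) ^+ 4 <= 8 * (s ^+ 4 + D ^+ 4).
  have := sqr_ge0 (s ^+ 2 - D ^+ 2); have : (s + D) ^+ 2 <= 2 * (s ^+ 2 + D ^+ 2).
    by have := sqr_ge0 (s - D); lra.
  move=> h1; have : ((s + D) ^+ 2) ^+ 2 <= (2 * (s ^+ 2 + D ^+ 2)) ^+ 2.
    by rewrite ler_pXn2r ?nnegrE//; nonneg.
  by move: (s) (D) => x y; lra.
have LS : L * (s + D) ^+ 4 <= L * (8 * (s ^+ 4 + D ^+ 4)) by rewrite ler_wpM2l.
rewrite [leLHS](_ : _ = 3 * ((s `^ p / s ^+ 2) ^+ 2 * D ^+ 4) +
   4 * K ^+ 2 * ((s `^ a) ^+ 2 + (s `^ a / s) ^+ 2 * D ^+ 2) +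
   k5 * G (0 + lin (recip2 1) w) ^+ 4 + L * (s + D) ^+ 4); last by rewrite LE /k5; ring.
rewrite /k0 /k2 /k4; move: LS (k5 * _) ((s `^ p / s ^+ 2) ^+ 2) ((s `^ a / s) ^+ 2) ((s `^ a) ^+ 2).
move: (L) (L * (s + D) ^+ 4) (s ^+ 4) (D ^+ 4) (D ^+ 2) (K ^+ 2) => *; lra.
Qed.

Definition cost_center n : R := \sum_(1 <= m < n.+1) mean n m `^ p.

(** The coefficient of the variable of index [j] in the linearised cost. *)
Definition coef n j : R :=
  \sum_(1 <= m < n.+1) p * (mean n m `^ p / mean n m) * recip2 m j.

(** Up to a constant, the linear approximations of all the terms add up to one linear
form in the exponential variables. *)
Lemma cost_linearization n (w : omega n) :
  cost G 0 w - (cost_center n + clin (coef n) w) =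
  \sum_(1 <= m < n.+1) taylor_error (mean n m) (clin (recip2 m) w).
Proof.
rewrite costE /coef clin_sum /cost_center -big_split -sumrB.
apply: eq_bigr => m _ /=; rewrite /taylor_error.
by congr (G _ - _); rewrite /clin add0r addrC subrK.
Qed.

Theorem cost_approximation : exists2 C, 0 <= C & forall n, (0 < n)%N ->
  (\int[omegaP n]_w ((cost G 0 w - (cost_center n + clin (coef n) w)) ^+ 2)%:E <=
   (C * (n%:R `^ (1 - a)) ^+ 2)%:E)%E.
Proof.
have /andP[a0 a1] := a01; have a10 : 0 < 1 - a by rewrite subr_gt0.
have E0 : 0 <= error_cst.
  have u4 : 0 <= u0 ^- 4 by rewrite invr_ge0 exprn_ge0// ltW.
  by rewrite /error_cst; nonneg.
exists (error_cst * 4 / (1 - a) ^+ 2); first by nonneg.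
move=> n n0.
under eq_integral do rewrite cost_linearization.
apply: (@le_trans _ _ (error_cst * (\sum_(1 <= m < n.+1) weight n m) ^+ 2)%:E).
  apply: integral_sum_square => //.
  - move=> m; have mcl : measurable_fun setT (fun w : omega n =>
    clin (@recip2 R m) w) by exact: measurable_clin.
    rewrite /taylor_error; apply: measurable_funB.
      by apply: (measurableT_comp mG); exact: measurable_funD.
    by apply: measurable_funD => //; exact: measurable_funM.
  - by move=> m; exact: weight_ge0.
  - by move=> m; exact: weight_gt0.
  - by move=> m; exact: taylor_error_integral.
rewrite lee_fin -!mulrA ler_wpM2l//.
rewrite [leRHS](_ : _ = (2 * (n%:R `^ (1 - a) / (1 - a))) ^+ 2); last by field; rewrite gt_eqF.
rewrite ler_pXn2r ?nnegrE//; last 2 first.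
- by rewrite sumr_ge0// => m _; exact: weight_ge0.
- by nonneg.
rewrite /weight big_split/=.
have -> : \sum_(1 <= m < n.+1) (n.+1 - m)%:R `^ (- a) = \sum_(1 <= m < n.+1) m%:R `^ (- a) :> R.
  rewrite [RHS]big_nat_rev/=; apply: eq_big_nat => m /andP[m1 mn].
  by rewrite add1n subSS.
by rewrite mulr2n mulrDl mul1r lerD// sum_powR_le.
Qed.

End approximation.

(** * Sums over integers as integrals of step functions *)

Section staircase.
Context {R : realType}.
Local Notation mu := (@lebesgue_measure R).
Local Notation I := (`]0%R, 1%R[%classic : set R).

(** The number [m] of the interval from [(m - 1) / n] to [m / n], closed on the right,
that contains [x]. A sum over [m] of [g m], divided by [n], is the integral of
[g (step n x)] and limits of such sums follow from the convergence theorems for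
integrals. *)
Definition step n (x : R) : nat := `|Num.ceil (n%:R * x)|%N.

Lemma step_bounds n x : 0 <= x -> n%:R * x <= (step n x)%:R < n%:R * x + 1.
Proof.
move=> x0; have nx0 : 0 <= n%:R * x by rewrite mulr_ge0.
have c0 : 0 <= Num.ceil (n%:R * x).
  by rewrite ceil_ge0 (lt_le_trans _ nx0)// ltrN10.
have /andP[h1 h2] := ceil_itv (n%:R * x).
have E : (step n x)%:R = (Num.ceil (n%:R * x))%:~R :> R.
  by rewrite /step natr_absz ger0_norm.
by rewrite E h2 -ltrBlDr -(rmorphB _ _ 1)/= ?rmorph1.
Qed.

Lemma step_range n x : (0 < n)%N -> 0 < x -> x <= 1 -> (1 <= step n x <= n)%N.
Proof.
move=> n0 x0 x1; have /andP[h1 h2] := step_bounds n (ltW x0).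
have n0' : 0 < n%:R :> R by rewrite ltr0n.
have nx0 : 0 < n%:R * x by rewrite mulr_gt0.
apply/andP; split; first by rewrite -(ltr0n R) (lt_le_trans nx0).
rewrite -ltnS -(ltr_nat R) (lt_le_trans h2)// -natr1 lerD2r.
by rewrite ler_piMr// ltW.
Qed.

Lemma step_unique n x m : (0 < m)%N -> 0 <= x -> m%:R - 1 < n%:R * x <= m%:R -> step n x = m.
Proof.
move=> m0 x0 h; rewrite /step.
have -> : Num.ceil (n%:R * x) = m%:Z :> int.
  by apply: ceil_def; rewrite rmorphB/= rmorph1.
by [].
Qed.

Lemma step_indic n (g : nat -> R) x : (0 < n)%N -> 0 < x -> x <= 1 ->
  g (step n x) =
  \sum_(1 <= m < n.+1) g m * \1_(`](m%:R - 1) / n%:R, m%:R / n%:R]%classic : set R) x.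
Proof.
move=> n0 x0 x1; have /andP[s1 sn] := step_range n0 x0 x1.
have n0' : 0 < n%:R :> R by rewrite ltr0n.
have /andP[h1 h2] := step_bounds n (ltW x0).
rewrite (bigD1_seq (step n x))/= ?iota_uniq ?mem_index_iota ?s1//.
rewrite indicE mem_set ?mulr1 /=; last first.
  by rewrite in_itv/= ltr_pdivrMr// ler_pdivlMr// !(mulrC x) h1 ltrBlDr h2.
rewrite big_nat_cond big1 ?addr0// => m /andP[/andP[m1 mn] mx].
rewrite indicE memNset ?mulr0//= in_itv/= ltr_pdivrMr// ler_pdivlMr// !(mulrC x) => h.
by move/eqP: mx; apply; rewrite (step_unique m1 (ltW x0) h).
Qed.

Lemma measurable_step n (g : nat -> R) : measurable_fun I (fun x => g (step n x)).
Proof.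
have [->|n0] := posnP n.
  rewrite (_ : (fun x => _) = cst (g 0%N)) //; last by apply/funext => x; rewrite /step mul0r ceil0.
apply: (eq_measurable_fun (fun x => \sum_(1 <= m < n.+1)
    g m * \1_(`](m%:R - 1) / n%:R, m%:R / n%:R]%classic : set R) x)).
  by move=> x; rewrite inE/= in_itv/= => /andP[x0 x1]; rewrite -step_indic// ltW.
apply: measurable_funTS; apply: measurable_sum => m; apply: measurable_funM => //.
Qed.

Lemma integral_step n (g : nat -> R) : (0 < n)%N -> (forall m, 0 <= g m) ->
  (\int[mu]_(x in I) (g (step n x))%:E = (n%:R^-1 * \sum_(1 <= m < n.+1) g m)%:E)%E.
Proof.
move=> n0 g0; have n0' : 0 < n%:R :> R by rewrite ltr0n.
pose J m := (`](m%:R - 1) / n%:R, m%:R / n%:R]%classic : set R).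
transitivity (\int[mu]_(x in (`]0%R, 1%R]%classic : set R))
    (\sum_(1 <= m < n.+1) (g m)%:E * (\1_(J m) x)%:E))%E.
  transitivity (\int[mu]_(x in I) (\sum_(1 <= m < n.+1) (g m)%:E * (\1_(J m) x)%:E))%E.
    apply: eq_integral => x; rewrite inE/= in_itv/= => /andP[x0 x1].
    rewrite (step_indic g n0 x0 (ltW x1)) -sumEFin.
    by apply: eq_bigr => m _; rewrite EFinM.
  apply: integral_itv_bndo_bndc.
  apply: measurable_funTS; apply: emeasurable_sum => m; apply: emeasurable_funM => //.
  by apply/measurable_EFinP; apply: measurable_indic; exact: measurable_itv.
have mJ m : measurable_fun (`]0%R, 1%R]%classic : set R) (fun x : R =>
  (g m)%:E * (\1_(J m) x : R)%:E)%E.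
  apply: measurable_funTS; apply: emeasurable_funM => //.
  by apply/measurable_EFinP; apply: measurable_indic; exact: measurable_itv.
have mI : measurable (`]0%R, 1%R]%classic : set R) by exact: measurable_itv.
rewrite ge0_integral_sum//; last first.
  by move=> m x _; rewrite -EFinM lee_fin mulr_ge0.
rewrite mulr_sumr -sumEFin big_nat [RHS]big_nat; apply: eq_bigr => m /andP[m1 mn].
have mJ1 : measurable_fun (`]0%R, 1%R]%classic : set R) (fun x : R => (\1_(J m) x : R)%:E).
  apply: measurable_funTS; apply/measurable_EFinP; apply: measurable_indic; exact: measurable_itv.
have gm : (0 <= (g m)%:E)%E by rewrite lee_fin.
rewrite ge0_integralZl// integral_indic//.
rewrite classical_sets.setIidl; last first.
  apply: subset_itv => /=; rewrite bnd_simp.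
    by rewrite divr_ge0// ?subr_ge0 ?ler1n// ltW.
  by rewrite ler_pdivrMr// mul1r ler_nat.
rewrite [X in (_ * X)%E](_ : _ = (n%:R^-1)%:E); first by rewrite -EFinM mulrC.
have lt : (m%:R - 1) / n%:R < m%:R / n%:R :> R by rewrite ltr_pM2r ?invr_gt0// ltrBlDr ltrDl.
rewrite [LHS]lebesgue_measure_itv/= lte_fin lt -EFinD; congr EFin.
by rewrite -mulrBl opprB addrC subrK mul1r.
exact: measurable_itv.
Qed.

(** Fatou's lemma: bounds on Riemann sums pass to the integral of the limit. It serves
to prove the integrability of the dominating functions below. *)
Lemma integral_step_limit_le (g : nat -> nat -> R) (f : R -> R) (C : R) :
  (forall n m, 0 <= g n m) ->
  (forall x, 0 < x < 1 -> g n (step n x) @[n --> \oo] --> f x) ->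
  (forall n, (0 < n)%N -> n%:R^-1 * \sum_(1 <= m < n.+1) g n m <= C) ->
  (\int[mu]_(x in I) (f x)%:E <= C%:E)%E.
Proof.
move=> g0 gf gC.
have mI : measurable I by exact: measurable_itv.
pose h n x : \bar R := (g n.+1 (step n.+1 x))%:E.
have mh n : measurable_fun I (h n) by apply/measurable_EFinP; exact: measurable_step.
have h0 n x : I x -> (0 <= h n x)%E by rewrite lee_fin.
have hf x : I x -> h ^~ x @ \oo --> (f x)%:E.
  rewrite /= in_itv/= => x01; apply: cvg_EFin; first by near=> n.
  by have := gf x x01; rewrite -(cvg_shiftS (fun n => g n (step n x))).
apply: (@le_trans _ _ (\int[mu]_(x in I) limn_einf (h ^~ x))%E).
  rewrite le_eqVlt; apply/orP; left; apply/eqP; apply: eq_integral => x; rewrite inE => Ix.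
  by rewrite (cvg_limn_einf_sup (hf x Ix)).1.
apply: (le_trans (fatou mu mI mh h0)).
rewrite limn_einf_lim; apply: lime_le; first exact: is_cvg_einfs.
apply: nearW => n; apply: (@le_trans _ _ (\int[mu]_(x in I) h n x)%E).
  by apply: ereal_inf_lbound; exists n => /=.
by rewrite /h integral_step// lee_fin gC.
Unshelve. all: by end_near. Qed.

(** Dominated convergence. *)
Lemma integral_step_cvg (g : nat -> nat -> R) (f k : R -> R) :
  (forall n m, 0 <= g n m) ->
  (forall x, 0 < x < 1 -> g n (step n x) @[n --> \oo] --> f x) ->
  (forall n x, 0 < x < 1 -> (0 < n)%N -> g n (step n x) <= k x) ->
  mu.-integrable I (EFin \o k) ->
  n%:R^-1 * (\sum_(1 <= m < n.+1) g n m) @[n --> \oo] --> fine (\int[mu]_(x in I) (f x)%:E)%E.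
Proof.
move=> g0 gf gk ik.
have mI : measurable I by exact: measurable_itv.
pose h n x : \bar R := (g n.+1 (step n.+1 x))%:E.
have mh n : measurable_fun I (h n) by apply/measurable_EFinP; exact: measurable_step.
have hf x : I x -> h ^~ x @ \oo --> (f x)%:E.
  rewrite /= in_itv/= => x01; apply: cvg_EFin; first by near=> n.
  by have := gf x x01; rewrite -(cvg_shiftS (fun n => g n (step n x))).
have mf : measurable_fun I (EFin \o f) by apply: (@emeasurable_fun_cvg _ _ _ I h).
have ae1 : {ae mu, forall x, I x -> h n x @[n --> \oo] --> (EFin \o f) x}.
  by apply: aeW => x; exact: hf.
have ae2 : {ae mu, forall x, forall n : nat, I x -> (`|h n x| <= (EFin \o k) x)%E}.
  apply: aeW => x n; rewrite /= in_itv/= => x01; rewrite ger0_norm// lee_fin gk//.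
have [fi _ cvgh] := @dominated_convergence _ _ R mu I mI h (EFin \o f) (EFin \o k) mh mf ae1 ik ae2.
rewrite -(cvg_shiftS (fun n => n%:R^-1 * (\sum_(1 <= m < n.+1) g n m))).
have fn : (\int[mu]_(x in I) (EFin \o f) x)%E \is a fin_num by exact: integrable_fin_num.
rewrite -(fineK fn) in cvgh.
apply: cvg_trans (fine_cvg cvgh); apply: near_eq_cvg; near=> n => /=.
by rewrite integral_step.
Unshelve. all: by end_near. Qed.

Lemma step_cvg x : 0 <= x -> (step n x)%:R / n%:R @[n --> \oo] --> x.
Proof.
move=> x0; apply/cvgrPdist_le => e e0; near=> n.
have n0 : 0 < n%:R :> R by rewrite ltr0n; near: n; exact: nbhs_infty_gt.
have /andP[h1 h2] := step_bounds n x0.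
have ne : 1 <= e * n%:R.
  by rewrite mulrC -ler_pdivrMr//; near: n; exact: nbhs_infty_ger.
have -> : x - (step n x)%:R / n%:R = (n%:R * x - (step n x)%:R) / n%:R by field; rewrite gt_eqF.
rewrite normrM normfV (gtr0_norm n0) ler_pdivrMr// (le_trans _ ne)//.
by rewrite ler_norml; apply/andP; split; lra.
Unshelve. all: by end_near. Qed.

Lemma cvg_powR (u : nat -> R) (l a : R) : 0 < l -> u n @[n --> \oo] --> l ->
  u n `^ a @[n --> \oo] --> l `^ a.
Proof.
move=> l0 ul; have : {for l, continuous (fun y : R => y `^ a)}.
  apply: differentiable_continuous; apply/derivable1_diffP.
  by apply: derivable_powR; rewrite in_itv/= l0.
by move=> /continuous_cvg; apply.
Qed.

Let measurable_powR_comp (f : R -> R) (a : R) : measurable_fun I f ->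
  measurable_fun I (fun x => f x `^ a).
Proof. by move=> mf; apply: (measurableT_comp (measurable_powR a)). Qed.

Let integrable_ge0 (f : R -> R) (C : R) : measurable_fun I f -> (forall x, 0 <= f x) ->
  (\int[mu]_(x in I) (f x)%:E <= C%:E)%E -> mu.-integrable I (EFin \o f).
Proof.
move=> mf f0 fC; apply/integrableP; split; first exact/measurable_EFinP.
apply: (le_lt_trans _ (ltry C)); apply: le_trans fC.
by rewrite le_eqVlt; apply/orP; left; apply/eqP; apply: eq_integral => x _ /=; rewrite ger0_norm.
Qed.

Let riemann_powR (a : R) n : 0 < a < 1 -> (0 < n)%N ->
  n%:R^-1 * \sum_(1 <= m < n.+1) (m%:R / n%:R) `^ (- a) <= (1 - a)^-1.
Proof.
move=> a01 n0; have n0' : 0 < n%:R :> R by rewrite ltr0n.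
have -> : \sum_(1 <= m < n.+1) (m%:R / n%:R) `^ (- a) =
    (n%:R `^ a) * \sum_(1 <= m < n.+1) m%:R `^ (- a) :> R.
  rewrite mulr_sumr; apply: eq_bigr => m _; rewrite powRM ?invr_ge0// mulrC.
  by congr (_ * _); rewrite -powR_inv1// -powRrM mulrNN mul1r.
apply: (@le_trans _ _ (n%:R^-1 * (n%:R `^ a * (n%:R `^ (1 - a) / (1 - a))))).
  by rewrite ler_wpM2l ?invr_ge0// ler_wpM2l ?powR_ge0// sum_powR_le.
rewrite !mulrA -(mulrA n%:R^-1) -powRD ?(gt_eqF n0') ?implybT// addrC subrK powRr1//.
by rewrite mulVf ?mul1r// gt_eqF.
Qed.

Lemma integrable_powR (a : R) : 0 < a < 1 -> mu.-integrable I (fun x => (x `^ (- a))%:E).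
Proof.
move=> a01; apply: (@integrable_ge0 (fun x => x `^ (- a)) (1 - a)^-1) => //.
- exact: measurable_powR_comp.
- by move=> x; exact: powR_ge0.
apply: (@integral_step_limit_le (fun n m => (m%:R / n%:R) `^ (- a))).
- by move=> n m; exact: powR_ge0.
- by move=> x /andP[x0 _]; apply: cvg_powR => //; apply: step_cvg; exact: ltW.
- by move=> n n0; exact: riemann_powR.
Qed.

Lemma integrable_powR_onem (a : R) : 0 < a < 1 ->
  mu.-integrable I (fun x => ((1 - x) `^ (- a))%:E).
Proof.
move=> a01; apply: (@integrable_ge0 (fun x => (1 - x) `^ (- a)) (1 - a)^-1) => //.
- by apply: measurable_powR_comp; exact: measurable_funB.
- by move=> x; exact: powR_ge0.
apply: (@integral_step_limit_le (fun n m => ((n.+1 - m)%:R / n%:R) `^ (- a))).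
- by move=> n m; exact: powR_ge0.
- move=> x /andP[x0 x1]; apply: cvg_powR; first by rewrite subr_gt0.
  have c1 : 1 + n%:R^-1 - (step n x)%:R / n%:R @[n --> \oo] --> 1 + 0 - x.
    apply: cvgB; last by apply: step_cvg; exact: ltW.
    apply: cvgD; first exact: cvg_cst.
    by rewrite -(cvg_shiftS (fun n => n%:R^-1 : R)); exact: cvg_harmonic.
  rewrite addr0 in c1; apply: cvg_trans c1; apply: near_eq_cvg; near=> n.
  have n0 : (0 < n)%N by near: n; exact: nbhs_infty_gt.
  have /andP[_ sn] := step_range n0 x0 (ltW x1).
  rewrite natrB; last exact: leqW.
  by rewrite -natr1; field; rewrite pnatr_eq0 -lt0n.
- move=> n n0; have := riemann_powR a01 n0; rewrite big_nat_rev/=.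
  apply: le_trans; rewrite le_eqVlt; apply/orP; left; apply/eqP; congr (_ * _).
Unshelve. all: by end_near. Qed.

End staircase.

(** * Asymptotic variance of the linear part *)

Section variance.
Context {R : realType}.
Local Notation mu := (@lebesgue_measure R).
Local Notation I := (`]0%R, 1%R[%classic : set R).
Variable p : R.
Hypothesis p0 : 0 < p.
Hypothesis p12 : p < 1 / 2.
Local Notation q := (1 - p).

Let q0 : 0 < q. Proof. by move: p0 p12 => ? ?; lra. Qed.
Let q1 : q < 1. Proof. by move: p0 p12 => ? ?; lra. Qed.

(** The variance of the linearised cost. *)
Definition sigma2 n : R := \sum_(1 <= j < n.+1) coef p n j ^+ 2.

Lemma coefE n j : (1 <= j <= n)%N ->
  coef p n j = p / j%:R ^+ 2 * \sum_(1 <= m < j.+1) mean n m `^ (- q).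
Proof.
move=> /andP[j1 jn]; rewrite /coef (big_cat_nat (n := j.+1))//=.
rewrite [X in _ + X]big_nat_cond [X in _ + X]big1 ?addr0; last first.
  by move=> m /andP[/andP[jm _] _]; rewrite /recip2 leqNgt jm mulr0.
rewrite mulr_sumr; apply: eq_big_nat => m /andP[m1 mj].
have s0 : 0 < mean n m :> R by rewrite mean_gt0// m1 (leq_trans _ jn).
rewrite /recip2 -ltnS mj natrX mulrAC; congr (_ * _).
rewrite opprB -[X in _ / X]powRr1 ?(ltW s0)// -powR_inv1 ?powR_ge0// -powRrM mulrN1.
by rewrite -powRD// (gt_eqF s0) implybT.
Qed.

Lemma le_mean j n m : (j <= n)%N -> mean j m <= mean n m :> R.
Proof.
move=> jn; rewrite /mean (big_cat_nat (n := j.+1) (p := n.+1))//= lerDl.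
by rewrite sumr_ge0// => k _; exact: recip2_ge0.
Qed.

Lemma coef_ge0 n j : 0 <= coef p n j.
Proof.
rewrite sumr_ge0// => m _; rewrite mulr_ge0 ?recip2_ge0// mulr_ge0 ?(ltW p0)//.
by rewrite divr_ge0 ?powR_ge0// sumr_ge0// => k _; exact: recip2_ge0.
Qed.

(** The sum over [m] is dominated by the terms close to [j]: the mean is at least
[(j + 1 - m) / (2 j ^ 2)] and the exponent [- q] is integrable at 0. *)
Lemma coef_upper n j : (1 <= j <= n)%N -> coef p n j <= 2 * j%:R `^ (- p).
Proof.
move=> jn; rewrite coefE//; have /andP[j1 jn'] := jn.
set x : R := j%:R; have x1 : 1 <= x by rewrite ler1n.
have x0 : 0 < x by lra.
have xx0 : 0 < 2 * x ^+ 2 by rewrite mulr_gt0// exprn_gt0.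
have h m : (1 <= m < j.+1)%N -> mean n m `^ (- q) <= (2 * x ^+ 2) `^ q * (j.+1 - m)%:R `^ (- q).
  move=> /andP[m1 mj]; have mj' : (m <= j)%N by [].
  set k : R := (j.+1 - m)%:R; have k0 : 0 < k by rewrite ltr0n subn_gt0.
  have jE : x + 1 = m%:R + k by rewrite natr1 -natrD subnKC// ltnW.
  have m0 : 0 < m%:R :> R by rewrite ltr0n.
  have lb : k / (2 * x ^+ 2) <= mean n m.
    apply: le_trans (le_mean m jn'); apply: le_trans (mean_lower _); last by rewrite m1 ltnW.
    rewrite -(natr1 j) -/x (_ : m%:R^-1 - (x + 1)^-1 = k / (m%:R * (x + 1))); last first.
      have -> : k = x + 1 - m%:R by lra.
      by field; rewrite !gt_eqF//; lra.
    rewrite ler_wpM2l ?(ltW k0)// lef_pV2 ?posrE ?mulr_gt0//; last by lra.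
    have mx : m%:R <= x by rewrite ler_nat.
    have : m%:R * (x + 1) <= x * (x + 1) by rewrite ler_wpM2r//; lra.
    have : x * (x + 1) <= x * (x + x) by rewrite ler_wpM2l//; lra.
    lra.
  have s0 : 0 < mean n m :> R by apply: lt_le_trans lb; rewrite divr_gt0.
  have -> : (2 * x ^+ 2) `^ q * k `^ (- q) = (k / (2 * x ^+ 2)) `^ (- q).
    rewrite [RHS]powRM ?invr_ge0 ?(ltW k0) ?(ltW xx0)// [RHS]mulrC; congr (_ * _).
    by rewrite -powR_inv1 ?(ltW xx0)// -powRrM mulrNN mul1r.
  rewrite !powRN lef_pV2 ?posrE ?powR_gt0 ?divr_gt0//.
  by rewrite ge0_ler_powR ?nnegrE ?(ltW q0) ?(ltW s0)// divr_ge0// ltW.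
have S : \sum_(1 <= m < j.+1) mean n m `^ (- q) <= (2 * x ^+ 2) `^ q * (x `^ p / p).
  apply: (@le_trans _ _ (\sum_(1 <= m < j.+1) (2 * x ^+ 2) `^ q * (j.+1 - m)%:R `^ (- q))).
    by rewrite big_nat [leRHS]big_nat; apply: ler_sum => m; exact: h.
  rewrite -mulr_sumr ler_wpM2l ?powR_ge0//.
  have -> : \sum_(1 <= m < j.+1) (j.+1 - m)%:R `^ (- q) = \sum_(1 <= m < j.+1) m%:R `^ (- q) :> R.
    by rewrite [RHS]big_nat_rev/=; apply: eq_big_nat => m _; rewrite add1n subSS.
  have := @sum_powR_le R q j; rewrite q0 q1 => /(_ isT).
  by rewrite -/x (_ : 1 - q = p); last by ring.
apply: (le_trans (ler_wpM2l _ S)); first by rewrite divr_ge0 ?(ltW p0)// sqr_ge0.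
have two : 2 `^ q <= 2 :> R by rewrite -[leRHS]powRr1// ler_powR ?ler1n// ltW.
have xq : (x ^+ 2) `^ q = x `^ q * x `^ q by rewrite expr2 powRM// ltW.
have xp : x `^ q * x `^ p = x.
  by rewrite -powRD ?(gt_eqF x0) ?implybT// subrK powRr1// ltW.
have xq' : x `^ q = x * x `^ (- p).
  by rewrite -[X in X * _]powRr1 ?(ltW x0)// -powRD ?(gt_eqF x0) ?implybT.
rewrite powRM ?sqr_ge0// xq.
have -> : p / x ^+ 2 * (2 `^ q * (x `^ q * x `^ q) * (x `^ p / p)) =
    2 `^ q * (x `^ q * (x `^ q * x `^ p)) / x ^+ 2 by field; rewrite !gt_eqF.
rewrite xp xq' (_ : 2 `^ q * (x * x `^ (- p) * x) / x ^+ 2 = 2 `^ q * x `^ (- p)).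
  by rewrite ler_wpM2r// powR_ge0.
by field; rewrite gt_eqF.
Qed.

(** Here [mean n m <= 2 / m] and the sum of the [m ^ q] is of order [j ^ (1 + q)]. *)
Lemma coef_lower n j : (1 <= j <= n)%N -> p / 4 * j%:R `^ (- p) <= coef p n j.
Proof.
move=> jn; rewrite coefE//; have /andP[j1 jn'] := jn.
set x : R := j%:R; have x1 : 1 <= x by rewrite ler1n.
have x0 : 0 < x by lra.
have h m : (1 <= m < j.+1)%N -> m%:R * (x `^ (- p) / 2) <= mean n m `^ (- q).
  move=> /andP[m1 mj]; have m0 : 0 < m%:R :> R by rewrite ltr0n.
  have s0 : 0 < mean n m :> R by rewrite mean_gt0// m1 (leq_trans _ jn').
  have : (2 / m%:R) `^ (- q) <= mean n m `^ (- q).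
    rewrite !powRN lef_pV2 ?posrE ?powR_gt0 ?divr_gt0//.
    by rewrite ge0_ler_powR ?nnegrE ?(ltW q0) ?(ltW s0) ?mean_upper// divr_ge0.
  apply: le_trans.
  have -> : (2 / m%:R) `^ (- q) = (m%:R * m%:R `^ (- p)) * 2 `^ (- q).
    rewrite powRM ?invr_ge0// mulrC; congr (_ * _).
    rewrite -powR_inv1// -powRrM mulrNN mul1r.
    by rewrite -[X in X * _]powRr1 ?(ltW m0)// -powRD ?(gt_eqF m0) ?implybT.
  rewrite -mulrA ler_wpM2l// ler_pM ?powR_ge0 ?invr_ge0//.
    rewrite !powRN lef_pV2 ?posrE ?powR_gt0//.
    by rewrite ge0_ler_powR ?nnegrE ?(ltW p0) ?(ltW x0) ?ler_nat.
  by rewrite -[leLHS]powR_inv1// ler_powR ?ler1n// lerN2 (ltW q1).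
have S : x ^+ 2 / 2 * (x `^ (- p) / 2) <= \sum_(1 <= m < j.+1) mean n m `^ (- q).
  apply: (@le_trans _ _ (\sum_(1 <= m < j.+1) m%:R * (x `^ (- p) / 2))); last first.
    by rewrite big_nat [leRHS]big_nat; apply: ler_sum => m; exact: h.
  rewrite -mulr_suml ler_wpM2r ?divr_ge0 ?powR_ge0//.
  rewrite /x; elim: (j) => [|k IH]; first by rewrite big_geq// expr0n mul0r.
  by rewrite big_nat_recr//= -natr1; have : 0 <= k%:R :> R by []; move: IH; nra.
apply: le_trans (ler_wpM2l _ S); last by rewrite divr_ge0 ?(ltW p0)// sqr_ge0.
by rewrite le_eqVlt; apply/orP; left; apply/eqP; field; rewrite gt_eqF.
Qed.

Lemma sigma2_lower n : (0 < n)%N -> (p / 4) ^+ 2 * n%:R `^ (1 - 2 * p) <= sigma2 n.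
Proof.
move=> n0; set x : R := n%:R; have x0 : 0 < x by rewrite ltr0n.
apply: (@le_trans _ _ (\sum_(1 <= j < n.+1) (p / 4 * x `^ (- p)) ^+ 2)); last first.
  rewrite big_nat [leRHS]big_nat; apply: ler_sum => j; rewrite ltnS => jn.
  have /andP[j1 jn'] := jn.
  have j0 : 0 < j%:R :> R by rewrite ltr0n.
  have c0 : 0 <= p / 4 by rewrite divr_ge0// ltW.
  rewrite ler_pXn2r ?nnegrE ?coef_ge0 ?mulr_ge0 ?powR_ge0 ?(ltW p0)//.
  apply: le_trans (coef_lower jn); rewrite ler_wpM2l//.
  rewrite !powRN lef_pV2 ?posrE ?powR_gt0//.
  by rewrite ge0_ler_powR ?nnegrE ?ler_nat ?(ltW p0) ?(ltW x0).
have -> : \sum_(1 <= j < n.+1) (p / 4 * x `^ (- p)) ^+ 2 = (p / 4) ^+ 2 * (x `^ (- p) ^+ 2 * x).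
  by rewrite sumr_const_nat subn1/= -[LHS]mulr_natr exprMn mulrA.
rewrite ler_wpM2l ?sqr_ge0// expr2 -powRD ?(gt_eqF x0) ?implybT//.
rewrite -[X in _ <= _ * X]powRr1 ?(ltW x0)// -powRD ?(gt_eqF x0) ?implybT//.
by rewrite le_eqVlt; apply/orP; left; apply/eqP; congr (_ `^ _); ring.
Qed.

Let cvgVn : n%:R^-1 @[n --> \oo] --> (0 : R).
Proof. by rewrite -(cvg_shiftS (fun n => n%:R^-1 : R)); exact: cvg_harmonic. Qed.

Let step_inv_cvg (u : R) : 0 < u -> n%:R / (step n u)%:R @[n --> \oo] --> u^-1.
Proof.
move=> u0; have : ((step n u)%:R / n%:R)^-1 @[n --> \oo] --> u^-1.
  by apply: cvgV; [rewrite gt_eqF|apply: step_cvg; exact: ltW].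
by under eq_fun do rewrite invf_div.
Qed.

Lemma mean_step_cvg (u : R) : 0 < u < 1 ->
  n%:R * mean n (step n u) @[n --> \oo] --> u^-1 - 1.
Proof.
move=> /andP[u0 u1]; have c := step_inv_cvg u0.
have cl : n%:R / (step n u)%:R - 1 @[n --> \oo] --> u^-1 - 1.
  by apply: cvgB => //; exact: cvg_cst.
have cu : n%:R / (step n u)%:R * (n%:R / (step n u)%:R) * n%:R^-1 +
    (n%:R / (step n u)%:R - 1) @[n --> \oo] --> u^-1 * u^-1 * 0 + (u^-1 - 1).
  by apply: cvgD => //; apply: cvgM => //; exact: cvgM.
rewrite mulr0 add0r in cu; apply: (squeeze_cvgr _ cl cu); near=> n.
have n0 : (0 < n)%N by near: n; exact: nbhs_infty_gt.
have s1n := step_range n0 u0 (ltW u1); have /andP[s1 sn] := s1n.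
set m := step n u in s1n s1 sn *.
have n0' : 0 < n%:R :> R by rewrite ltr0n.
have m0 : 0 < m%:R :> R by rewrite ltr0n.
apply/andP; split.
  have : m%:R^-1 - n.+1%:R^-1 <= mean n m :> R by apply: mean_lower; rewrite s1 leqW.
  move=> /(ler_wpM2l (ltW n0')); apply: le_trans.
  rewrite mulrBr lerD2l lerN2 ler_pdivrMr// mul1r ler_nat//.
have := @mean_upper_sharp R _ _ s1n; move=> /(ler_wpM2l (ltW n0')) /le_trans; apply.
by rewrite le_eqVlt; apply/orP; left; apply/eqP; field; rewrite !gt_eqF.
Unshelve. all: by end_near. Qed.

(** The limit of [n ^ (- 1 - q)] times the sum in [coefE] as [j / n] tends to [x]: the
mean is asymptotically [(1 / u - 1) / n] at [m = u n]. *)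
Definition profile (x : R) : R :=
  fine (\int[mu]_(u in I) (if u <= x then (u^-1 - 1) `^ (- q) else 0)%:E)%E.

Let partial_sum_cvg (x : R) : 0 < x < 1 ->
  n%:R^-1 * (\sum_(1 <= m < n.+1) if (m <= step n x)%N then (n%:R * mean n m) `^ (- q) else 0)
  @[n --> \oo] --> profile x.
Proof.
move=> /andP[x0 x1].
apply: (@integral_step_cvg _ (fun n m =>
  if (m <= step n x)%N then (n%:R * mean n m) `^ (- q) else 0)
   (fun u => if u <= x then (u^-1 - 1) `^ (- q) else 0) (fun u => 2 * (1 - u) `^ (- q))).
- by move=> n m; case: ifP => // _; exact: powR_ge0.
- move=> u /andP[u0 u1]; case: ifPn => [ux|].
    have sl n : (step n u <= step n x)%N.
      rewrite -(ler_nat R) /step !natr_absz !ger0_norm ?ceil_ge0; first last.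
      + by rewrite (lt_le_trans (ltrN10 _))// mulr_ge0// ltW.
      + by rewrite (lt_le_trans (ltrN10 _))// mulr_ge0// ltW.
      by rewrite ler_int le_ceil// ler_wpM2l.
    under eq_fun do rewrite sl.
    apply: cvg_powR; last by apply: mean_step_cvg; rewrite u0.
    by rewrite subr_gt0 invf_gt1.
  rewrite -ltNge => xu; apply: (@cvg_trans _ ((fun=> 0 : R) @ \oo)); last exact: cvg_cst.
  apply: near_eq_cvg; near=> n.
  rewrite ifN// -ltnNge -(ltr_nat R).
  have /andP[_ h1] := step_bounds n (ltW x0); have /andP[h2 _] := step_bounds n (ltW u0).
  apply: (lt_le_trans h1); apply: le_trans h2.
  rewrite -lerBrDl -mulrBr -ler_pdivrMr ?subr_gt0//; near: n; exact: nbhs_infty_ger.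
- move=> n u /andP[u0 u1] n0; case: ifPn => _; last by rewrite mulr_ge0// powR_ge0.
  have n0' : 0 < n%:R :> R by rewrite ltr0n.
  have s1n := step_range n0 u0 (ltW u1); have /andP[s1 sn] := s1n.
  have /andP[_ h1] := step_bounds n (ltW u0).
  set m := step n u in s1n s1 sn h1 *.
  have m0 : 0 < m%:R :> R by rewrite ltr0n.
  have lb : (1 - u) / 2 <= n%:R * mean n m.
    have : m%:R^-1 - n.+1%:R^-1 <= mean n m :> R by apply: mean_lower; rewrite s1 leqW.
    move=> /(ler_wpM2l (ltW n0')); apply: le_trans.
    have mn : m%:R <= n%:R :> R by rewrite ler_nat.
    have n1 : 1 <= n%:R :> R by rewrite ler1n.
    rewrite -natr1 (_ : n%:R * _ = n%:R * (n%:R + 1 - m%:R) / (m%:R * (n%:R + 1))); last first.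
      by field; rewrite !gt_eqF//; lra.
    have d0 : 0 < m%:R * (n%:R + 1) :> R by rewrite mulr_gt0//; lra.
    rewrite ler_pdivlMr//.
    apply: (@le_trans _ _ ((1 - u) / 2 * (n%:R * (n%:R + n%:R)))).
      rewrite ler_wpM2l//; first by rewrite divr_ge0//; lra.
      by rewrite ler_pM//; lra.
    rewrite [leLHS](_ : _ = n%:R * (n%:R * (1 - u))); last by field.
    by rewrite ler_wpM2l ?(ltW n0')//; lra.
  have u10 : 0 < 1 - u by lra.
  apply: (@le_trans _ _ (((1 - u) / 2) `^ (- q))).
    rewrite !powRN lef_pV2 ?posrE ?powR_gt0 ?divr_gt0//;
      last exact: lt_le_trans (divr_gt0 u10 _) lb.
    rewrite ge0_ler_powR ?nnegrE ?(ltW q0)// ?divr_ge0 ?(ltW u10)//.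
    by apply: le_trans lb; rewrite divr_ge0// ltW.
  rewrite powRM ?invr_ge0 ?(ltW u10)// mulrC ler_wpM2r ?powR_ge0//.
  by rewrite -powR_inv1// -powRrM mulrNN mul1r -[leRHS]powRr1// ler_powR ?ler1n// ltW.
- rewrite (_ : EFin \o _ = fun u => 2%:E * ((1 - u) `^ (- q))%:E)%E; last first.
    by apply/funext => u /=; rewrite EFinM.
  by apply: integrableZl; [exact: measurable_itv|apply: integrable_powR_onem; rewrite q0 q1].
Unshelve. all: by end_near. Qed.

Lemma coef_step_cvg (x : R) : 0 < x < 1 ->
  n%:R `^ p * coef p n (step n x) @[n --> \oo] --> p * (x^-1 * x^-1) * profile x.
Proof.
move=> x01; have /andP[x0 x1] := x01.
have c : p * (n%:R / (step n x)%:R * (n%:R / (step n x)%:R)) *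
    (n%:R^-1 * (\sum_(1 <= m < n.+1) if (m <= step n x)%N then (n%:R * mean n m) `^ (- q) else 0))
    @[n --> \oo] --> p * (x^-1 * x^-1) * profile x.
  apply: cvgM; last exact: partial_sum_cvg.
  by apply: cvgM; [exact: cvg_cst|apply: cvgM; exact: step_inv_cvg].
apply: cvg_trans c; apply: near_eq_cvg; near=> n.
have n0 : (0 < n)%N by near: n; exact: nbhs_infty_gt.
have s1n := step_range n0 x0 (ltW x1); have /andP[s1 sn] := s1n.
set m := step n x in s1n s1 sn *.
have n0' : 0 < n%:R :> R by rewrite ltr0n.
have m0 : 0 < m%:R :> R by rewrite ltr0n.
rewrite coefE//.
have -> : \sum_(1 <= k < n.+1) (if (k <= m)%N then (n%:R * mean n k) `^ (- q) else 0) =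
   n%:R `^ (- q) * \sum_(1 <= k < m.+1) mean n k `^ (- q) :> R.
  rewrite (big_cat_nat (n := m.+1))//= [X in _ + X]big_nat_cond [X in _ + X]big1 ?addr0; last first.
    by move=> k /andP[/andP[mk _] _]; rewrite leqNgt mk.
  rewrite mulr_sumr; apply: eq_big_nat => k /andP[k1 km].
  by rewrite -ltnS km powRM ?ler0n// ltW// mean_gt0// k1 (leq_trans _ sn).
have -> : n%:R `^ (- q) = n%:R `^ p / n%:R :> R.
  rewrite opprB powRD ?(gt_eqF n0') ?implybT//; congr (_ * _).
  by rewrite powR_inv1// ltW.
move: (\sum_(1 <= k < m.+1) _) (n%:R `^ p) => S N.
by field; rewrite !gt_eqF.
Unshelve. all: by end_near. Qed.

(** The terms [(n ^ p b_j) ^ 2] are dominated by [4 x ^ (- 2 p)], integrable since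
[p < 1 / 2]. The limit is positive by [sigma2_lower]. *)
Theorem sigma2_cvg : exists2 gamma : R, 0 < gamma &
  (n%:R `^ (1 - 2 * p))^-1 * sigma2 n @[n --> \oo] --> gamma.
Proof.
have c : n%:R^-1 * (\sum_(1 <= j < n.+1) (n%:R `^ p * coef p n j) ^+ 2) @[n --> \oo] -->
    fine (\int[mu]_(x in I) ((p * (x^-1 * x^-1) * profile x) ^+ 2)%:E)%E.
  apply: (@integral_step_cvg _ (fun n j => (n%:R `^ p * coef p n j) ^+ 2) _
    (fun x => 4 * x `^ (- (2 * p)))).
  - by move=> n m; exact: sqr_ge0.
  - move=> x x01; apply: cvgM; exact: coef_step_cvg.
  - move=> n x /andP[x0 x1] n0.
    have s1n := step_range n0 x0 (ltW x1); have /andP[s1 sn] := s1n.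
    have /andP[h1 _] := step_bounds n (ltW x0).
    set m := step n x in s1n s1 sn h1 *.
    have n0' : 0 < n%:R :> R by rewrite ltr0n.
    have m0 : 0 < m%:R :> R by rewrite ltr0n.
    have b : n%:R `^ p * coef p n m <= 2 * x `^ (- p).
      apply: (le_trans (ler_wpM2l (powR_ge0 _ _) (coef_upper s1n))).
      rewrite mulrCA ler_wpM2l// !powRN ler_pdivrMr ?powR_gt0// mulrC ler_pdivlMr ?powR_gt0//.
      by rewrite -powRM ?ler0n ?(ltW x0)// ge0_ler_powR ?nnegrE ?(ltW p0) ?mulr_ge0 ?(ltW x0).
    apply: (@le_trans _ _ ((2 * x `^ (- p)) ^+ 2)).
      by rewrite ler_pXn2r ?nnegrE ?mulr_ge0 ?powR_ge0 ?coef_ge0.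
    rewrite exprMn [X in _ * X]expr2 -powRD ?(gt_eqF x0) ?implybT//.
    rewrite le_eqVlt; apply/orP; left; apply/eqP; congr (_ * _ `^ _); [by ring|by ring].
  - rewrite (_ : EFin \o _ = fun u => 4%:E * (u `^ (- (2 * p)))%:E)%E; last first.
      by apply/funext => u /=; rewrite EFinM.
    apply: integrableZl; [exact: measurable_itv|apply: integrable_powR].
    by move: p0 p12 => ? ?; apply/andP; split; lra.
set gamma := fine _ in c.
have {}c : (n%:R `^ (1 - 2 * p))^-1 * sigma2 n @[n --> \oo] --> gamma.
  apply: cvg_trans c; apply: near_eq_cvg; near=> n.
  have n0 : (0 < n)%N by near: n; exact: nbhs_infty_gt.
  have n0' : 0 < n%:R :> R by rewrite ltr0n.
  rewrite /sigma2; under eq_bigr do rewrite exprMn.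
  rewrite -mulr_sumr mulrA; congr (_ * _).
  rewrite -powRN -powR_inv1 ?(ltW n0')// expr2 -!powRD ?(gt_eqF n0') ?implybT//.
  by congr (_ `^ _); ring.
exists gamma => //.
have c0 : 0 < (p / 4) ^+ 2 by rewrite exprn_gt0// divr_gt0.
apply: (lt_le_trans c0).
rewrite -(cvg_lim (@Rhausdorff R) c); apply: limr_ge; first by apply/cvg_ex; exists gamma.
near=> n.
have n0 : (0 < n)%N by near: n; exact: nbhs_infty_gt.
have n0' : 0 < n%:R :> R by rewrite ltr0n.
by rewrite [leRHS]mulrC ler_pdivlMr ?powR_gt0// sigma2_lower.
Unshelve. all: by end_near. Qed.

End variance.

(** * Perturbations that are small in L2 *)

Section perturbation.
Context {R : realType} d (T : measurableType d) (P : probability T R).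
Variables (Y L : T -> R) (c sigma rho : R).
Hypotheses (mY : measurable_fun setT Y) (mL : measurable_fun setT L).
Hypotheses (sigma0 : 0 < sigma) (rho0 : 0 < rho).
Hypothesis L2 : forall x, (\int[P]_t ((x + L t) ^+ 2)%:E = (x ^+ 2 + sigma ^+ 2)%:E)%E.
Hypothesis YL : (\int[P]_t ((Y t - (c + L t)) ^+ 2)%:E <= (rho ^+ 2)%:E)%E.

Local Notation eps := (rho / sigma).
Let m := fine (\int[P]_t (Y t)%:E)%E.
Let V := fine (\int[P]_t ((Y t - m) ^+ 2)%:E)%E.

Let eps0 : 0 < eps. Proof. exact: divr_gt0. Qed.

Let mR : measurable_fun setT (fun t => Y t - (c + L t)).
Proof. by apply: measurable_funB => //; exact: measurable_funD. Qed.

Let msq (f : T -> R) : measurable_fun setT f -> measurable_fun setT (fun t => (f t ^+ 2)%:E).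
Proof. by move=> mf; apply/measurable_EFinP; exact: measurable_funX. Qed.

Let sq0 (x : R) : (0 <= (x ^+ 2)%:E)%E. Proof. by rewrite lee_fin sqr_ge0. Qed.

Let icst (x : R) : P.-integrable setT (fun=> x%:E).
Proof. exact: finite_measure_integrable_cst. Qed.

(** The triangle inequality in L2, from
[(x + y) ^ 2 <= (1 + e) x ^ 2 + (1 + 1 / e) y ^ 2]. With [e = rho / sigma], the second
term is [(1 + e) rho sigma] when [y] has norm [rho], negligible against
[sigma ^ 2]. *)
Let l2_triangle (f g : T -> R) : measurable_fun setT f -> measurable_fun setT g ->
  (\int[P]_t ((f t + g t) ^+ 2)%:E <=
   (1 + eps)%:E * \int[P]_t (f t ^+ 2)%:E + (1 + eps^-1)%:E * \int[P]_t (g t ^+ 2)%:E)%E.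
Proof.
move=> mf mg.
have e1 : (0 <= (1 + eps)%:E)%E by rewrite lee_fin addr_ge0// ltW.
have e2 : (0 <= (1 + eps^-1)%:E)%E by rewrite lee_fin addr_ge0// invr_ge0 ltW.
rewrite -!ge0_integralZl//; [|exact: msq|exact: msq].
rewrite -ge0_integralD//; first last.
- by apply: emeasurable_funM => //; exact: msq.
- by move=> t _; rewrite mule_ge0// sq0.
- by apply: emeasurable_funM => //; exact: msq.
- by move=> t _; rewrite mule_ge0// sq0.
apply: ge0_le_integral => //.
- by apply: msq; exact: measurable_funD.
- by apply: emeasurable_funD; apply: emeasurable_funM => //; exact: msq.
- move=> t _; rewrite -!EFinM -EFinD lee_fin.
  rewrite -subr_ge0 (_ : _ - _ = (eps * f t - g t) ^+ 2 / eps).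
    by rewrite divr_ge0 ?sqr_ge0// ltW.
  by field; rewrite !gt_eqF.
Qed.

Let Yc : (\int[P]_t ((Y t - c) ^+ 2)%:E <= ((1 + eps) ^+ 2 * sigma ^+ 2)%:E)%E.
Proof.
have := l2_triangle mL mR.
have -> : (\int[P]_t ((L t + (Y t - (c + L t))) ^+ 2)%:E = \int[P]_t ((Y t - c) ^+ 2)%:E)%E.
  by apply: eq_integral => t _; congr (_ ^+ 2)%:E; ring.
have := L2 0; under eq_integral do rewrite add0r.
move=> -> /le_trans; apply.
have e2 : (0 <= (1 + eps^-1)%:E)%E by rewrite lee_fin addr_ge0// invr_ge0 ltW.
apply: le_trans (leeD (lexx _) (lee_wpmul2l e2 YL)) _.
rewrite -!EFinM -EFinD lee_fin le_eqVlt; apply/orP; left; apply/eqP.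
by rewrite expr0n/= add0r; field; rewrite !gt_eqF.
Qed.

Let iZ2 : P.-integrable setT (fun t => ((Y t - c) ^+ 2)%:E).
Proof.
apply/integrableP; split; first by apply: msq; exact: measurable_funB.
rewrite (eq_integral (fun t => ((Y t - c) ^+ 2)%:E)); last by move=> t _; rewrite gee0_abs// sq0.
exact: le_lt_trans Yc (ltry _).
Qed.

Let iZ : P.-integrable setT (fun t => (Y t - c)%:E).
Proof.
apply: (@le_integrable _ _ _ _ _ _ _ (fun t => (1 + (Y t - c) ^+ 2)%:E)) => //.
- by apply/measurable_EFinP; exact: measurable_funB.
- move=> t _; rewrite lee_fin [leRHS]ger0_norm ?addr_ge0 ?sqr_ge0//.
  have := sqr_ge0 (`|Y t - c| - 1); rewrite -[(Y t - c) ^+ 2]real_normK ?num_real//; nra.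
- exact: (integrableD measurableT (icst 1) iZ2).
Qed.

Lemma perturbation_integrable : P.-integrable setT (fun t => (Y t)%:E).
Proof.
rewrite (_ : (fun t => _) = (fun t => (Y t - c)%:E + c%:E)%E); last first.
  by apply/funext => t; rewrite -EFinD subrK.
exact: (integrableD measurableT iZ (icst c)).
Qed.

Lemma perturbation_mean : (\int[P]_t (Y t)%:E = m%:E)%E.
Proof.
by rewrite /m fineK//; apply: integrable_fin_num => //; exact: perturbation_integrable.
Qed.

(** The second moment about [c] is the variance plus the squared distance from [c] to
the mean. *)
Let variance_shift :
  (\int[P]_t ((Y t - m) ^+ 2)%:E + ((m - c) ^+ 2)%:E = \int[P]_t ((Y t - c) ^+ 2)%:E)%E.
Proof.
have Zm : (\int[P]_t (Y t - c)%:E = (m - c)%:E)%E.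
  under eq_integral do rewrite EFinB.
  rewrite (integralB measurableT perturbation_integrable (icst c)).
  by rewrite perturbation_mean integral_prob_cst.
have i1 : P.-integrable setT (fun t => ((-2 * (m - c))%:E * (Y t - c)%:E)%E).
  exact: (integrableZl measurableT _ iZ).
have i2 : P.-integrable setT (fun t => ((Y t - c) ^+ 2)%:E + (-2 * (m - c))%:E * (Y t - c)%:E)%E.
  exact: (integrableD measurableT iZ2 i1).
transitivity (\int[P]_t (((Y t - c) ^+ 2)%:E + (-2 * (m - c))%:E * (Y t - c)%:E + ((m - c) ^+ 2)%:E)
   + ((m - c) ^+ 2)%:E)%E.
  congr (_ + _)%E; apply: eq_integral => t _; rewrite -EFinM -!EFinD; congr EFin; ring.
rewrite (integralD measurableT i2 (icst _))
  (integralD measurableT iZ2 i1) integralZl// Zm integral_prob_cst.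
have fin : (\int[P]_t ((Y t - c) ^+ 2)%:E)%E \is a fin_num by exact: integrable_fin_num.
rewrite -(fineK fin) -!EFinM -!EFinD; congr EFin; ring.
Qed.

Lemma perturbation_variance : (\int[P]_t ((Y t - m) ^+ 2)%:E = V%:E)%E.
Proof.
rewrite /V fineK// ge0_fin_numE; last by apply: integral_ge0 => t _; exact: sq0.
apply: le_lt_trans (ltry ((1 + eps) ^+ 2 * sigma ^+ 2)); apply: le_trans Yc.
by rewrite -variance_shift leeDl// lee_fin sqr_ge0.
Qed.

Lemma perturbation_upper : V <= (1 + eps) ^+ 2 * sigma ^+ 2.
Proof.
rewrite -lee_fin -perturbation_variance; apply: le_trans Yc.
by rewrite -variance_shift leeDl// lee_fin sqr_ge0.
Qed.

(** The roles of [Y] and [L] are exchanged: the second moment of [L], shifted by the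
difference of the centres, is bounded by that of [Y]. The term [(c - m) ^ 2] on the left
also shows that the centres are close. *)
Lemma perturbation_lower :
  sigma ^+ 2 + (c - m) ^+ 2 <= (1 + eps) * V + (eps + eps ^+ 2) * sigma ^+ 2.
Proof.
have mYm : measurable_fun setT (fun t => Y t - m) by exact: measurable_funB.
have mR' : measurable_fun setT (fun t => - (Y t - (c + L t))) by exact: measurableT_comp.
have := l2_triangle mYm mR'.
have -> : (\int[P]_t ((Y t - m - (Y t - (c + L t))) ^+ 2)%:E = \int[P]_t ((c - m + L t) ^+ 2)%:E)%E.
  by apply: eq_integral => t _; congr (_ ^+ 2)%:E; ring.
rewrite L2 perturbation_variance.
under [X in (_ <= _ + _ * X)%E -> _]eq_integral do rewrite sqrrN.
have e2 : (0 <= (1 + eps^-1)%:E)%E by rewrite lee_fin addr_ge0// invr_ge0 ltW.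
move=> h; have := le_trans h (leeD (lexx _) (lee_wpmul2l e2 YL)).
rewrite -!EFinM -EFinD lee_fin addrC => /le_trans; apply.
by rewrite le_eqVlt; apply/orP; left; apply/eqP; field; rewrite !gt_eqF.
Qed.

Hypothesis eps4 : eps <= 1 / 4.

Let sigma20 : 0 < sigma ^+ 2. Proof. exact: exprn_gt0. Qed.

Lemma perturbation_variance_ge : (1 - 3 * eps) * sigma ^+ 2 <= V.
Proof.
have h := perturbation_lower; have e0 := eps0; have e4 := eps4.
have : 0 <= (c - m) ^+ 2 by exact: sqr_ge0.
have s0 := sigma20; have e1 : 0 < 1 + eps by lra.
move: (sigma ^+ 2) eps V ((c - m) ^+ 2) h e0 e4 s0 e1 => s e v x h e0 e4 s0 e1 x0.
rewrite -(ler_pM2l e1); have : 0 <= e * e * s by rewrite !mulr_ge0// ltW.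
have : 0 <= e * s by rewrite mulr_ge0// ltW.
nra.
Qed.

Let V0 : 0 < V.
Proof.
apply: lt_le_trans perturbation_variance_ge; rewrite mulr_gt0//.
by have := eps4; have := eps0; lra.
Qed.

Lemma perturbation_sd : `|Num.sqrt V / sigma - 1| <= 3 * eps.
Proof.
have e0 := eps0; have e4 := eps4.
have v0 : 0 < Num.sqrt V by rewrite sqrtr_gt0.
have v2 : Num.sqrt V ^+ 2 = V by rewrite sqr_sqrtr// ltW.
rewrite ler_norml; apply/andP; split.
  rewrite lerBrDr ler_pdivlMr// -(ler_pXn2r (n := 2))// ?nnegrE ?(ltW v0)//; last first.
    by rewrite mulr_ge0 ?(ltW sigma0)//; lra.
  rewrite v2 exprMn; apply: le_trans perturbation_variance_ge; rewrite ler_wpM2r ?(ltW sigma20)//.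
  nra.
rewrite lerBlDr ler_pdivrMr// -(ler_pXn2r (n := 2))// ?nnegrE ?(ltW v0)//; last first.
  by rewrite mulr_ge0 ?(ltW sigma0)//; lra.
rewrite v2 exprMn; apply: (le_trans perturbation_upper); rewrite ler_wpM2r ?(ltW sigma20)//.
nra.
Qed.

Let mean_close : `|c - m| / sigma <= 3 * Num.sqrt eps.
Proof.
have e0 := eps0; have e4 := eps4.
have s0 : 0 <= Num.sqrt eps by exact: sqrtr_ge0.
have s2 : Num.sqrt eps ^+ 2 = eps by rewrite sqr_sqrtr// ltW.
rewrite ler_pdivrMr// -(ler_pXn2r (n := 2))// ?nnegrE ?mulr_ge0 ?(ltW sigma0)//.
rewrite real_normK ?num_real// !exprMn s2.
have := perturbation_lower; have := perturbation_upper; have s20 := sigma20.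
move: (sigma ^+ 2) eps V ((c - m) ^+ 2) e0 e4 s20 => s e v x e0 e4 s20 h1 h2.
have : (1 + e) * v <= (1 + e) * ((1 + e) ^+ 2 * s) by rewrite ler_wpM2l//; lra.
have : 0 <= s * (9 * e + 1 - (1 + e) ^+ 3 - e - e ^+ 2).
  by rewrite mulr_ge0 ?(ltW s20)//; nra.
lra.
Qed.

(** The difference of the standardised variables is
[(1 - v / sigma) (Y - m) / v + (c - m) / sigma + (Y - c - L) / sigma], with [v] the
standard deviation of [Y]. The three terms have L1 norms at most [3 e], [3 sqrt e] and
[e], where [e = rho / sigma <= sqrt e]. *)
Lemma perturbation_standardized :
  (\int[P]_t (`|(Y t - m) / Num.sqrt V - L t / sigma|)%:E <= (7 * Num.sqrt eps)%:E)%E.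
Proof.
have e0 := eps0; have e4 := eps4.
set v := Num.sqrt V.
have v0 : 0 < v by rewrite sqrtr_gt0.
have v2 : v ^+ 2 = V by rewrite sqr_sqrtr// ltW.
have mYm : measurable_fun setT (fun t => Y t - m) by exact: measurable_funB.
pose k := `|v / sigma - 1|.
(* [|x| <= (x ^ 2 + 1) / 2] bounds first moments by second ones; [A], [B] and [C] collect
   the coefficients *)
pose A := k / (2 * v ^+ 2); pose B := (2 * rho * sigma)^-1.
pose C := k / 2 + rho / (2 * sigma) + `|c - m| / sigma.
have k0 : 0 <= k by exact: normr_ge0.
have A0 : (0 <= A%:E)%E by rewrite lee_fin divr_ge0// mulr_ge0// sqr_ge0.
have B0 : (0 <= B%:E)%E by rewrite lee_fin invr_ge0 !mulr_ge0// ltW.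
have C0 : (0 <= C%:E)%E.
  rewrite lee_fin !addr_ge0// ?divr_ge0 ?normr_ge0 ?mulr_ge0 ?(ltW rho0) ?(ltW sigma0)//.
apply: (@le_trans _ _ (\int[P]_t (A%:E * ((Y t - m) ^+ 2)%:E +
    (B%:E * ((Y t - (c + L t)) ^+ 2)%:E + C%:E)))%E).
  apply: ge0_le_integral => //.
  - apply/measurable_EFinP; apply: measurableT_comp => //; apply: measurable_funB;
    exact: measurable_funM.
  - apply: emeasurable_funD; first by apply: emeasurable_funM => //; exact: msq.
    by apply: emeasurable_funD => //; apply: emeasurable_funM => //; exact: msq.
  - move=> t _; rewrite -!EFinM -!EFinD lee_fin.
    set y := Y t - m; set r := Y t - (c + L t).
    have -> : y / v - L t / sigma = - (v / sigma - 1) * (y / v) + (c - m + r) / sigma.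
      by rewrite /y /r; field; rewrite !gt_eqF.
    apply: (le_trans (ler_normD _ _)).
    have h1 : `|- (v / sigma - 1) * (y / v)| <= A * y ^+ 2 + k / 2.
      rewrite normrM normrN -/k /A.
      have -> : k / (2 * v ^+ 2) * y ^+ 2 + k / 2 = k * (((y / v) ^+ 2 + 1) / 2).
        by field; rewrite gt_eqF.
      rewrite ler_wpM2l// -[(y / v) ^+ 2]real_normK ?num_real//.
      by have := sqr_ge0 (`|y / v| - 1); lra.
    have h2 : `|(c - m + r) / sigma| <= `|c - m| / sigma + (B * r ^+ 2 + rho / (2 * sigma)).
      rewrite normrM normfV (gtr0_norm sigma0).
      have -> : `|c - m| / sigma + (B * r ^+ 2 + rho / (2 * sigma)) =
          (`|c - m| + (r ^+ 2 / rho + rho) / 2) / sigma by rewrite /B; field; rewrite !gt_eqF.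
      rewrite ler_wpM2r ?invr_ge0 ?(ltW sigma0)//; apply: (le_trans (ler_normD _ _)).
      rewrite lerD2l ler_pdivlMr// -(ler_pM2r rho0) mulrDl divfK ?gt_eqF//.
      rewrite -[r ^+ 2]real_normK ?num_real//.
      by have := sqr_ge0 (`|r| - rho); lra.
    by rewrite /C; lra.
have iA (f : T -> R) (a : R) : (0 <= a%:E)%E -> measurable_fun setT f ->
    measurable_fun setT (fun t => a%:E * (f t ^+ 2)%:E)%E.
  by move=> _ mf; apply: emeasurable_funM => //; exact: msq.
rewrite ge0_integralD//; last 4 first.
- by move=> t _; rewrite mule_ge0// sq0.
- exact: iA.
- by move=> t _; rewrite adde_ge0// mule_ge0.
- by apply: emeasurable_funD => //; exact: iA.
rewrite ge0_integralD//; last 2 first.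
- by move=> t _; rewrite mule_ge0// sq0.
- exact: iA.
rewrite !ge0_integralZl//; [|exact: msq|exact: msq].
rewrite perturbation_variance integral_prob_cst.
apply: (le_trans (leeD (lexx _) (leeD (lee_wpmul2l B0 YL) (lexx _)))).
rewrite -!EFinM -!EFinD lee_fin -v2.
have -> : A * v ^+ 2 + (B * rho ^+ 2 + C) = k + eps + `|c - m| / sigma.
  by rewrite /A /B /C; field; rewrite !gt_eqF.
have := perturbation_sd; rewrite -/v -/k; have := mean_close.
have s0 : 0 <= Num.sqrt eps by exact: sqrtr_ge0.
have s2 : Num.sqrt eps ^+ 2 = eps by rewrite sqr_sqrtr// ltW.
have : eps <= Num.sqrt eps.
  rewrite -[leLHS]s2 expr2 ler_piMl//.
  by rewrite -(ler_pXn2r (n := 2))// ?nnegrE// s2 expr1n; lra.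
lra.
Qed.

End perturbation.

(** * The law of the stable cost *)

Section law.
Context {R : realType} {rho : R -> R} {mu : probability (measurableTypeR R) R}.
Hypothesis rho_density : is_density rho.
Hypothesis muE : forall A : set R, measurable A ->
  (mu A = \int[lebesgue_measure]_(x in A `&` `[0%R, +oo[) (rho x)%:E)%E.
Local Notation G := (quantile rho_density muE).

Context {n : nat} d (T : measurableType d) (P : probability T R).
Variable w : edge n -> {RV P >-> R}.
Hypothesis w_density : forall e, has_density P rho (w e).
Hypothesis w_independent : mutually_independent P w.

Let stable_cost_law_ge0 (h : R -> \bar R) : measurable_fun setT h -> (forall x, 0 <= h x)%E ->
  (\int[P]_t h (random_stable_cost P w t) = \int[omegaP n]_x h (cost G 0 x))%E.
Proof.
move=> mh h0.
have wC C : (forall e, measurable (C e)) ->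
    P (event (fun e => w e : T -> R) C) = (\prod_e mu (C e))%E.
  move=> mC; have := w_independent [set: edge n]%SET mC.
  rewrite (_ : \bigcap_(i in _) _ = event (fun e => w e : T -> R) C); last first.
    apply/seteqP; split => t /= ht e; last by move=> _; exact: ht.
    by apply: ht; rewrite /= finset.in_setT.
  move=> ->; apply: eq_big => [e|e _]; first by rewrite finset.in_setT.
  by rewrite muE//; exact: w_density.
have mcost : measurable_fun setT (fun t => stable_cost (fun e => w e t)).
  exact: (measurable_funPT (random_stable_cost P w)).
have := integral_stable_cost (fun e => measurable_funPT (w e)) wC mh h0
  (density_atomless muE) (density_positive rho_density muE) mcost.
move=> ->.
have G0 : G 0 = 0 by exact: quantile_le0.
rewrite -[X in chain _ _ _ X](G0).
rewrite (chain_cost (measurable_quantile rho_density muE) (quantile_le0 rho_density muE)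
  (quantile_incr rho_density muE) (quantile_law rho_density muE) mh h0)//.
rewrite mulr0 oppr0 expR0 mul1e; apply: eq_integral => x _.
by rewrite add0r.
Qed.

(** The equality is first proved for nonnegative functions, where [integral_stable_cost]
and [chain_cost] apply, and passes to the positive and negative parts. *)
Lemma stable_cost_law (g : R -> R) : measurable_fun setT g ->
  (\int[P]_t (g (random_stable_cost P w t))%:E = \int[omegaP n]_x (g (cost G 0 x))%:E)%E.
Proof.
move=> mg; have mgE : measurable_fun setT (EFin \o g) by exact/measurable_EFinP.
rewrite -[LHS]/(\int[P]_t ((EFin \o g) \o random_stable_cost P w) t)%E.
rewrite -[RHS]/(\int[omegaP n]_x ((EFin \o g) \o cost G 0 (k := n)) x)%E.
have mpos : measurable_fun setT (EFin \o g)^\+%E by exact: measurable_funepos.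
have mneg : measurable_fun setT (EFin \o g)^\-%E by exact: measurable_funeneg.
rewrite integralE [RHS]integralE.
rewrite (funepos_comp (EFin \o g) (random_stable_cost P w)).
rewrite (funeneg_comp (EFin \o g) (random_stable_cost P w)).
rewrite (funepos_comp (EFin \o g) (cost G 0 (k := n))).
rewrite (funeneg_comp (EFin \o g) (cost G 0 (k := n))).
congr (_ - _)%E.
  exact: (stable_cost_law_ge0 mpos (fun x => funepos_ge0 (EFin \o g) x)).
exact: (stable_cost_law_ge0 mneg (fun x => funeneg_ge0 (EFin \o g) x)).
Qed.

Lemma stable_cost_expectation :
  ('E_P[random_stable_cost P w] = \int[omegaP n]_x (cost G 0 x)%:E)%E.
Proof. by rewrite expectation.unlock (stable_cost_law (g := id)). Qed.

Lemma stable_cost_variance :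
  ('V_P[random_stable_cost P w] = \int[omegaP n]_x
     ((cost G 0 x - fine (\int[omegaP n]_x (cost G 0 x)%:E)) ^+ 2)%:E)%E.
Proof.
rewrite /variance covariance.unlock stable_cost_expectation; set m := fine _.
rewrite expectation.unlock; rewrite -(stable_cost_law (g := fun y => (y - m) ^+ 2)).
  by apply: eq_integral => t _; rewrite expr2.
by apply: measurable_funX; exact: measurable_funB.
Qed.

Lemma stable_cost_standardized (f : R -> R) : continuous f -> bounded_fun f ->
  let m := fine (\int[omegaP n]_x (cost G 0 x)%:E)%E in
  let V := fine (\int[omegaP n]_x ((cost G 0 x - m) ^+ 2)%:E)%E in
  (\int[distribution P (standardize P (random_stable_cost P w))]_x (f x)%:E =
   \int[omegaP n]_x (f ((cost G 0 x - m) / Num.sqrt V))%:E)%E.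
Proof.
move=> cf [M [_ /(_ (M + 1))]]; rewrite ltrDl => /(_ ltr01) fM m V.
have mf : measurable_fun setT f by exact: continuous_measurable_fun.
have mfs : measurable_fun setT (fun y : R => f ((y - m) / Num.sqrt V)).
  by apply: (measurableT_comp mf); apply: measurable_funM => //; exact: measurable_funB.
rewrite integral_pushforward//; last 2 first.
- exact/measurable_EFinP.
- apply: (@integrable_bounded _ _ _ P (f \o standardize P (random_stable_cost P w)) (M + 1)).
    by apply: (measurableT_comp mf).
  by move=> t; exact: fM.
rewrite -(stable_cost_law mfs) /=; apply: eq_integral => t _ /=.
by rewrite /standardize stable_cost_variance stable_cost_expectation.
Qed.

End law.

(** * Asymptotics of the cost *)

Section asymptotics.
Context {R : realType}.
Variables (G : R -> R) (p a K u0 : R).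
Hypotheses (p0 : 0 < p) (p12 : p < 1 / 2) (pa : 1 / 2 + p < a) (a1 : a < 1).
Hypotheses (K0 : 0 < K) (u00 : 0 < u0).
Hypotheses (mG : measurable_fun setT G) (G0 : forall u, 0 <= G u)
  (G_nd : forall u v, u <= v -> G u <= G v).
Hypothesis Gnear0 : forall u, 0 < u <= u0 -> `|G u - u `^ p| <= K * u `^ a.
Hypothesis G00 : G 0 = 0.
Hypothesis G4 : (\int[expo R]_u (G u ^+ 4)%:E < +oo)%E.

Definition cost_mean n : R := fine (\int[omegaP n]_x (cost G 0 x)%:E)%E.
Definition cost_variance n : R := fine (\int[omegaP n]_x ((cost G 0 x - cost_mean n) ^+ 2)%:E)%E.
Local Notation sd n := (Num.sqrt (sigma2 p n)).

Lemma clin_scale (b : nat -> R) (s : R) k (w : omega k) : clin (fun j => b j / s) w = clin b w / s.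
Proof.
have -> : (fun j => b j / s) = (fun j => \sum_(m <- [:: 0%N]) s^-1 * b j).
  by apply/funext => j; rewrite big_seq1 mulrC.
by rewrite (clin_sum (fun=> s^-1) (fun=> b)) big_seq1 mulrC.
Qed.

Lemma cvg_powRN (s : R) : 0 < s -> n%:R `^ (- s) @[n --> \oo] --> (0 : R).
Proof.
move=> s0; apply/cvgrPdist_le => e e0; near=> n.
have n0 : 0 < n%:R :> R by rewrite ltr0n; near: n; exact: nbhs_infty_gt.
rewrite sub0r normrN ger0_norm ?powR_ge0// powRN -[leRHS]invrK lef_pV2 ?posrE ?invr_gt0 ?powR_gt0//.
have ei0 : 0 <= e^-1 by rewrite invr_ge0 ltW.
have -> : e^-1 = (e^-1 `^ s^-1) `^ s by rewrite -powRrM mulVf ?powRr1// gt_eqF.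
rewrite ge0_ler_powR ?nnegrE ?powR_ge0 ?(ltW s0) ?(ltW n0)//.
near: n; exact: nbhs_infty_ger.
Unshelve. all: by end_near. Qed.

Let sd_gt0 n : (0 < n)%N -> 0 < sd n.
Proof.
move=> n0; rewrite sqrtr_gt0; apply: lt_le_trans (sigma2_lower p0 p12 n0).
by rewrite mulr_gt0 ?exprn_gt0 ?divr_gt0// powR_gt0// ltr0n.
Qed.

Let sd2 n : sd n ^+ 2 = sigma2 p n.
Proof. by rewrite sqr_sqrtr// sumr_ge0// => j _; exact: sqr_ge0. Qed.

(** The exponents compare as [1 - a < 1 / 2 - p]. *)
Lemma cost_perturbation : exists rho : nat -> R,
  [/\ forall n, (0 < n)%N -> 0 < rho n,
    forall n, (0 < n)%N ->
      (\int[omegaP n]_x ((cost G 0 x - (cost_center p n + clin (coef p n) x)) ^+ 2)%:E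
      <= (rho n ^+ 2)%:E)%E &
    rho n / sd n @[n --> \oo] --> 0].
Proof.
have p01 : 0 < p < 1 by move: p0 p12 => ? ?; apply/andP; split; lra.
have a01 : 0 < a < 1 by move: p0 p12 pa a1 => ? ? ? ?; apply/andP; split; lra.
have [C C0 hC] := cost_approximation p01 a01 K0 u00 mG G0 G_nd Gnear0 G00 G4.
have C1 : 0 < Num.sqrt (C + 1) by rewrite sqrtr_gt0 ltr_wpDl.
have C2 : Num.sqrt (C + 1) ^+ 2 = C + 1 by rewrite sqr_sqrtr// addr_ge0.
pose rho n : R := Num.sqrt (C + 1) * n%:R `^ (1 - a).
have rho0 n : (0 < n)%N -> 0 < rho n by move=> n0; rewrite mulr_gt0// powR_gt0// ltr0n.
exists rho; split => //.
  move=> n n0; apply: (le_trans (hC n n0)); rewrite lee_fin /rho exprMn C2.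
  by rewrite ler_wpM2r ?sqr_ge0// lerDl.
have lim0 : Num.sqrt (C + 1) / (p / 4) * n%:R `^ (- (a - (1 / 2 + p))) @[n --> \oo] -->
    Num.sqrt (C + 1) / (p / 4) * 0.
  by apply: cvgM; [exact: cvg_cst|apply: cvg_powRN; rewrite subr_gt0].
rewrite mulr0 in lim0; apply: (squeeze_cvgr _ (cvg_cst 0) lim0); near=> n.
have n0 : (0 < n)%N by near: n; exact: nbhs_infty_gt.
have n0' : 0 < n%:R :> R by rewrite ltr0n.
have p4 : 0 < p / 4 by rewrite divr_gt0.
have l0 : 0 < p / 4 * n%:R `^ (1 / 2 - p) by rewrite mulr_gt0// powR_gt0.
have s_lower : p / 4 * n%:R `^ (1 / 2 - p) <= sd n.
  rewrite -(ler_pXn2r (n := 2))// ?nnegrE ?(ltW l0) ?sqrtr_ge0// sd2.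
  apply: le_trans (sigma2_lower p0 p12 n0); rewrite exprMn ler_wpM2l ?sqr_ge0//.
  rewrite expr2 -powRD ?(gt_eqF n0') ?implybT//.
  by rewrite le_eqVlt; apply/orP; left; apply/eqP; congr (_ `^ _); field.
have s0 : 0 < sd n by exact: lt_le_trans s_lower.
apply/andP; split; first by rewrite divr_ge0// ltW// rho0.
apply: (@le_trans _ _ (rho n / (p / 4 * n%:R `^ (1 / 2 - p)))).
  by rewrite ler_wpM2l ?(ltW (rho0 n n0))// lef_pV2.
rewrite /rho invfM mulrACA ler_wpM2l ?(ltW (divr_gt0 C1 p4))//.
rewrite -powRN -powRD ?(gt_eqF n0') ?implybT//.
by rewrite le_eqVlt; apply/orP; left; apply/eqP; congr (_ `^ _); field.
Unshelve. all: by end_near. Qed.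

Let L2 n x : (\int[omegaP n]_w ((x + clin (coef p n) w) ^+ 2)%:E = (x ^+ 2 + sd n ^+ 2)%:E)%E.
Proof. by rewrite clin_square sd2. Qed.

Let mL n : measurable_fun setT (fun w : omega n => clin (coef p n) w).
Proof. exact: measurable_clin. Qed.

Lemma cost_variance_finite : \forall n \near \oo,
  (\int[omegaP n]_x ((cost G 0 x - cost_mean n) ^+ 2)%:E = (cost_variance n)%:E)%E.
Proof.
have [rho [rho0 hrho _]] := cost_perturbation; near=> n.
have n0 : (0 < n)%N by near: n; exact: nbhs_infty_gt.
have mY := measurable_cost0 mG 0 (k := n).
have := perturbation_variance mY (@mL n) (sd_gt0 n0) (rho0 n n0) (L2 n) (hrho n n0).

by [].
Unshelve. all: by end_near. Qed.

Lemma cost_variance_cvg (gamma : R) :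
  (n%:R `^ (1 - 2 * p))^-1 * sigma2 p n @[n --> \oo] --> gamma ->
  cost_variance n / n%:R `^ (1 - 2 * p) @[n --> \oo] --> gamma.
Proof.
move=> cg; have [rho [rho0 hrho e_cvg]] := cost_perturbation.
have ratio : cost_variance n / sd n ^+ 2 @[n --> \oo] --> (1 : R).
  have lo : 1 - 3 * (rho n / sd n) @[n --> \oo] --> 1 - 3 * (0 : R).
    by apply: cvgB; [exact: cvg_cst|apply: cvgM => //; exact: cvg_cst].
  have hi : (1 + rho n / sd n) * (1 + rho n / sd n) @[n --> \oo] --> (1 + 0) * (1 + 0 : R).
    by apply: cvgM; apply: cvgD => //; exact: cvg_cst.
  rewrite mulr0 subr0 in lo; rewrite addr0 mulr1 in hi.
  apply: (squeeze_cvgr _ lo hi); near=> n.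
  have n0 : (0 < n)%N by near: n; exact: nbhs_infty_gt.
  have mY := measurable_cost0 mG 0 (k := n).
  have e4 : rho n / sd n <= 1 / 4.
    near: n; apply: (cvgr_le 0) => //; lra.
  have s20 : 0 < sd n ^+ 2 by rewrite exprn_gt0// sd_gt0.
  rewrite ler_pdivlMr// ler_pdivrMr// -expr2; apply/andP; split.
    exact: (perturbation_variance_ge mY (@mL n) (sd_gt0 n0) (rho0 n n0) (L2 n) (hrho n n0) e4).
  exact: (perturbation_upper mY (@mL n) (sd_gt0 n0) (rho0 n n0) (L2 n) (hrho n n0)).
have c : cost_variance n / sd n ^+ 2 * ((n%:R `^ (1 - 2 * p))^-1 * sigma2 p n)
    @[n --> \oo] --> 1 * gamma.
  exact: cvgM.
rewrite mul1r in c; apply: cvg_trans c; apply: near_eq_cvg; near=> n.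
have n0 : (0 < n)%N by near: n; exact: nbhs_infty_gt.
have s20 : 0 < sigma2 p n by rewrite -sd2 exprn_gt0// sd_gt0.
rewrite sd2; have p20 : 0 < n%:R `^ (1 - 2 * p) by rewrite powR_gt0// ltr0n.
by field; rewrite !gt_eqF.
Unshelve. all: by end_near. Qed.

(** The linear part divided by its standard deviation is covered by [gaussian_limit]:
its coefficients are bounded while the standard deviation tends to infinity. *)
Lemma cost_clt (f : R -> R) : continuous f -> bounded_fun f ->
  fine (\int[omegaP n]_x (f ((cost G 0 x - cost_mean n) / Num.sqrt (cost_variance n)))%:E)
  @[n --> \oo] --> fine (\int[normal_prob (0 : R) 1]_z (f z)%:E)%E.
Proof.
move=> cf bf; have [rho [rho0 hrho e_cvg]] := cost_perturbation.
apply/cvgrPdist_le => e e0; have [eta eta0 h] := gaussian_limit cf bf e0.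
near=> n.
have n0 : (0 < n)%N by near: n; exact: nbhs_infty_gt.
have n0' : 0 < n%:R :> R by rewrite ltr0n.
have mY := measurable_cost0 mG 0 (k := n).
have e4 : rho n / sd n <= 1 / 4 by near: n; apply: (cvgr_le 0) => //; lra.
have eeta : rho n / sd n <= (eta / 7) ^+ 2.
  by near: n; apply: (cvgr_le 0) => //; rewrite exprn_gt0// divr_gt0.
have s0 := sd_gt0 n0.
have e0' : 0 < rho n / sd n by rewrite divr_gt0// rho0.
rewrite distrC; apply: (h n (fun j => coef p n j / sd n)).
- by apply: measurable_funM => //; exact: measurable_funB.
- under eq_bigr do rewrite expr_div_n.
  by rewrite -mulr_suml -/(sigma2 p n) sd2 divff// gt_eqF// -sd2 exprn_gt0.
- move=> j jn; have /andP[j1 jn'] := jn; rewrite expr_div_n sd2.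
  have c4 : coef p n j ^+ 2 <= 4.
    have : coef p n j <= 2.
      apply: (le_trans (coef_upper p0 p12 jn)); rewrite -[leRHS]mulr1 ler_wpM2l//.
      rewrite powRN invf_le1 ?powR_gt0 ?ltr0n//.
      rewrite -[leLHS]/((fun=> 1 : R) p) -powR1.
      by rewrite ge0_ler_powR ?nnegrE ?(ltW p0) ?ler1n.
    have := coef_ge0 p0 n j; nra.
  have cn : (p / 4) ^+ 2 * n%:R `^ (1 - 2 * p) <= sigma2 p n by exact: sigma2_lower.
  have pn0 : 0 < (p / 4) ^+ 2 * n%:R `^ (1 - 2 * p).
    by rewrite mulr_gt0 ?exprn_gt0 ?divr_gt0// powR_gt0.
  have s20 : 0 < sigma2 p n by exact: lt_le_trans cn.
  apply: (@le_trans _ _ (4 / ((p / 4) ^+ 2 * n%:R `^ (1 - 2 * p)))).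
    by rewrite ler_pM ?sqr_ge0 ?invr_ge0 ?(ltW s20)// lef_pV2.
  rewrite invfM mulrA -powRN; near: n.
  apply: (cvgr_le 0) => //.
  rewrite -[X in _ --> X](mulr0 (4 / (p / 4) ^+ 2)).
  by apply: cvgM; [exact: cvg_cst|apply: cvg_powRN; move: p12 => ?; lra].
- under eq_integral do rewrite clin_scale.
  apply: le_trans (perturbation_standardized mY (@mL n) s0 (rho0 n n0) (L2 n) (hrho n n0) e4) _.
  rewrite lee_fin mulrC -ler_pdivlMr//.
  rewrite -[leRHS]ger0_norm ?divr_ge0 ?(ltW eta0)// -sqrtr_sqr.
  by rewrite ler_wsqrtr.
Unshelve. all: by end_near. Qed.

End asymptotics.

Theorem theorem1p3 (R : realType) (d : R) (hd : 2 < d) :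
  exists gamma : R, 0 < gamma /\
  forall (rho : R -> R) (zeta r : R),
    is_density rho ->
    d / 2 < zeta ->
    (fun z : R => (\int[lebesgue_measure]_(x in `[0, z]) rho x) - z `^ d)
      =O_ (0^'+) (fun z : R => z `^ (d + zeta)) ->
    4 * d / (d - 2) < r ->
    (\int[lebesgue_measure]_(x in `[0%R, +oo[) (x `^ r * rho x)%:E < +oo)%E ->
  forall (disp : nat -> measure_display) (T : forall n, measurableType (disp n))
    (P : forall n, probability (T n) R)
    (w : forall n, edge n -> {RV (P n) >-> R}),
    (forall n e, has_density (P n) rho (w n e)) ->
    (forall n, mutually_independent (P n) (w n)) ->
  let C n : {RV (P n) >-> R} := random_stable_cost (P n) (w n) in
  ('V_(P n)[C n] * ((n%:R `^ (1 - 2 / d))^-1)%:E)%E @[n --> \oo] --> gamma%:E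
  /\
  cvg_in_distribution P (fun n => standardize (P n) (C n)) (normal_prob 0 1).
Proof.
have d0 : 0 < d by lra.
pose p := d^-1; have p0 : 0 < p by rewrite invr_gt0.
have p12 : p < 1 / 2 by rewrite div1r ltf_pV2 ?posrE.
have [gamma gamma0 sg] := sigma2_cvg p0 p12.
exists gamma; split => // rho zeta r rd hz hO hr hmom disp T P w w_density w_indep C.
(* the law of a cost, realised by the only edge of the graph with one vertex on each
   side; [X1] is that cost with values in the type that carries Borel measures *)
pose X0 : T 1%N -> measurableTypeR R := w 1%N (ord0, ord0).
have mX0 : measurable_fun setT X0 by exact: (measurable_funPT (w 1%N (ord0, ord0))).
pose X1 : {mfun T 1%N >-> measurableTypeR R} :=
  HB.pack X0 (isMeasurableFun.Build _ _ (T 1%N) (measurableTypeR R) X0 mX0).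
pose mu : probability (measurableTypeR R) R :=
  [the probability (measurableTypeR R) R of distribution (P 1%N) X1].
have muE (A : set R) : measurable A ->
    (mu A = \int[lebesgue_measure]_(x in A `&` `[0%R, +oo[) (rho x)%:E)%E.
  by move=> mA; exact: w_density.
pose G := quantile rd muE.
have r4 : 4 < r.
  apply: lt_trans hr; rewrite ltr_pdivlMr ?subr_gt0// ltr_pM2l// ltrBlDr ltrDl//.
have dz : 1 / 2 < zeta / d by rewrite ltr_pdivlMr// mulrC mulrA mulr1.
(* an exponent strictly between [1 / 2 + p] and 1 allowed by [quantile_near0] *)
pose a := Num.min ((1 / 2 + p + 1) / 2) (p + zeta / d).
have pa : 1 / 2 + p < a by rewrite lt_min; apply/andP; split; lra.
have a1 : a < 1 by rewrite gt_min; apply/orP; left; lra.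
have ap : a <= p + zeta / d by rewrite ge_min lexx orbT.
have d1 : 1 <= d by lra.
have z0 : 0 < zeta by apply: lt_trans hz; rewrite divr_gt0.
have ap1 : a <= p + 1 by lra.
have [K [u0 [K0 u00 near0]]] := quantile_near0 rd muE d1 z0 hO ap ap1.
have G4 := quantile_moment rd muE r4 hmom.
have mG := measurable_quantile rd muE.
have G0 := quantile_ge0 rd muE.
have Gnd u v : u <= v -> G u <= G v by exact: quantile_nd.
have G00 : G 0 = 0 by exact: quantile_le0.
have vfin := cost_variance_finite p0 p12 pa a1 K0 u00 mG G0 Gnd near0 G00 G4.
have vcvg := cost_variance_cvg p0 p12 pa a1 K0 u00 mG G0 Gnd near0 G00 G4 sg.
split.
  have c : (cost_variance G n / n%:R `^ (1 - 2 * p))%:E @[n --> \oo] --> gamma%:E.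
    by apply: cvg_EFin => //; near=> n.
  apply: cvg_trans c; apply: near_eq_cvg; near=> n.
  have vE : (\int[omegaP n]_x ((cost G 0 x - cost_mean G n) ^+ 2)%:E = (cost_variance G n)%:E)%E.
    by near: n.
  by rewrite EFinM -vE /C (stable_cost_variance rd muE (w_density n) (w_indep n)).
move=> f cf bf.
have cl := cost_clt p0 p12 pa a1 K0 u00 mG G0 Gnd near0 G00 G4 cf bf.
have [M [_ /(_ (M + 1))]] := bf; rewrite ltrDl => /(_ ltr01) fM.
have mf : measurable_fun setT f by exact: continuous_measurable_fun.
have finN : (\int[normal_prob (0 : R) 1]_z (f z)%:E)%E \is a fin_num.
  apply: integrable_fin_num => //.
  by apply: (@integrable_bounded _ _ (measurableTypeR R) (normal_prob (0 : R) 1) f (M + 1)) =>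
    // x; exact: fM.
rewrite -(fineK finN).
have fin n :
    (\int[omegaP n]_x (f ((cost G 0 x - cost_mean G n) / Num.sqrt (cost_variance G n)))%:E)%E
    \is a fin_num.
  have mY := measurable_cost0 mG 0 (k := n).
  apply: integrable_fin_num => //.
  apply: (@integrable_bounded _ _ (omega n) (omegaP n)
    (fun x => f ((cost G 0 x - cost_mean G n) / Num.sqrt (cost_variance G n))) (M + 1)).
    by apply: (measurableT_comp mf); apply: measurable_funM => //; exact: measurable_funB.
  by move=> x; exact: fM.
have c := cvg_EFin (nearW _ fin) cl.
apply: cvg_trans; last exact: c.
apply: near_eq_cvg; apply: nearW => n.
by rewrite (stable_cost_standardized rd muE (w_density n) (w_indep n) cf bf).
Unshelve. all: by end_near. Qed.
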